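(* Let $H\in\,]1/2,1[$, $\sigma\in\mathbb R\setminus\{0\}$, and let $B$ be a fractional Brownian motion of Hurst index $H$. Let $b\in\mathrm{Lip}_b^{\infty}(\mathbb R)$ be such that there is a constant $M>0$ with $b'(y)\leqslant -M$ for every $y\in\mathbb R$. Let $K:\mathbb R\to\mathbb R_+$ be continuously differentiable, with $K$ and $K'$ bounded, $\mathrm{supp}(K)=[-1,1]$ and $\int_{\mathbb R}K=1$. Let $X$ be the solution of $X(t)=X_0+\int_0^tb(X(s))ds+\sigma B(t)$ with initial condition $X_0$. Then for every $x\in\mathbb R$ and $h>0$, the pathwise Nadaraya-Watson estimator $$\widetilde b_{T,h}(x):=\frac{\int_0^TK\left(\frac{X(s)-x}{h}\right)dX(s)}{\int_0^TK\left(\frac{X(s)-x}{h}\right)ds}$$ converges to $0$ in probability as $T\to\infty$.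
   Context: $\mathrm{Lip}_b^m(\mathbb R)$ is the set of Lipschitz $\varphi\in C^m(\mathbb R)$ with $\|\varphi^{(k)}\|_\infty<\infty$ for $1\leqslant k\leqslant m$; $\mathrm{Lip}_b^\infty(\mathbb R)=\bigcap_{m\geqslant1}\mathrm{Lip}_b^m(\mathbb R)$. The integral with respect to $dX(s)$ is the pathwise Young integral (the limit of left-point Riemann sums as the mesh of the partition tends to $0$). The estimator is considered where its denominator is positive. *)

(* Defs.v *)
From HB Require Import structures.
From mathcomp Require Import all_boot all_order all_algebra.
From mathcomp Require Import all_classical all_reals all_analysis.

Set Implicit Arguments.
Unset Strict Implicit.
Unset Printing Implicit Defensive.
Import Order.TTheory GRing.Theory Num.Theory.
Import numFieldTopology.Exports numFieldNormedType.Exports.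

Local Open Scope classical_set_scope.
Local Open Scope ring_scope.

Section function_classes.
Context {R : realType}.
Implicit Types (f : R -> R) (m : nat).

Definition class_C m f :=
  (forall k, (k < m)%N -> forall y : R, derivable (derive1n k f) y 1) /\
  continuous (derive1n m f).

(* Only the derivatives of order 1 <= k <= m are bounded, not f itself. *)
Definition Lip_b m f :=
  [/\ lipschitz f, class_C m f &
      forall k, (1 <= k <= m)%N -> bounded_fun (derive1n k f)].

Definition Lip_b_infty f := forall m, (1 <= m)%N -> Lip_b m f.

Definition supp f : set R := closure [set y | f y != 0].

End function_classes.

Section young_integral.
Context {R : realType}.
Implicit Types (a b : R) (f g : R -> R) (s : seq R).

(* A partition a = t_0 < t_1 < ... < t_n = b of [a, b] is encoded, as in
   [itv_partition], by the sequence s = [:: t_1; ...; t_n]. *)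
Definition left_riemann_sum f g a b s := let t := nth b (a :: s) in
  \sum_(0 <= i < size s) f (t i) * (g (t i.+1) - g (t i)).

Definition mesh_lt a b (e : R) s :=
  forall i, (i < size s)%N -> nth b (a :: s) i.+1 - nth b (a :: s) i < e.

Definition mesh_filter a b : set_system (seq R) :=
  filter_from [set e : R | 0 < e]
    (fun e => [set s | itv_partition a b s /\ mesh_lt a b e s]).

Global Instance mesh_filter_filter a b : Filter (mesh_filter a b).
Proof.
apply: filter_from_filter; first by exists 1; rewrite /= ltr01.
move=> e1 e2 /= e10 e20; exists (Num.min e1 e2) => /=.
  by rewrite lt_min e10.
move=> s [ps hs]; split; split=> // i si.
- by have := hs i si; rewrite lt_min => /andP[].
- by have := hs i si; rewrite lt_min => /andP[].
Qed.

Lemma mesh_filter_proper a b : a <= b -> ProperFilter (mesh_filter a b).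
Proof.
rewrite le_eqVlt => /predU1P[->|ab].
  apply: (filter_from_proper (mesh_filter_filter _ _)) => e e0.
  by exists [::]; split => //=.
apply: (filter_from_proper (mesh_filter_filter _ _)) => e /= e0.
have d0 : 0 < b - a by rewrite subr_gt0.
have [n hn n1] : exists2 n, (b - a) / e < n%:R & (0 < n)%N.
  by exists (Num.truncn ((b - a) / e)).+1 => //; exact: truncnS_gt.
have n0 : 0 < n%:R :> R by rewrite ltr0n.
pose u i := a + (b - a) * (i%:R / n%:R).
have u0 : u 0%N = a by rewrite /u mul0r mulr0 addr0.
have un : u n = b by rewrite /u divff ?gt_eqF// mulr1 addrC subrK.
have usub i : u i.+1 - u i = (b - a) / n%:R.
  by rewrite /u opprD addrACA subrr add0r -mulrBr -mulrBl -natr1 addrAC subrr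
    add0r mul1r.
have ult i : u i < u i.+1 by rewrite -subr_gt0 usub divr_gt0.
have nthu i : (i <= n)%N -> nth b (a :: [seq u i | i <- iota 1 n]) i = u i.
  case: i => [|i] ile; first by rewrite u0.
  by rewrite /= (nth_map 0%N) ?size_iota// nth_iota.
exists [seq u i | i <- iota 1 n]; split; first split.
- apply/(pathP b) => i; rewrite size_map size_iota => ilt.
  by rewrite nthu ?(ltnW ilt)// (nth_map 0%N) ?size_iota// nth_iota.
- by rewrite (last_nth b) size_map size_iota nthu// un.
- move=> i /=; rewrite size_map size_iota => ilt.
  have /= -> := nthu i.+1 ilt; have /= -> := nthu i (ltnW ilt).
  by rewrite usub ltr_pdivrMr// mulrC -ltr_pdivrMr//.
Qed.

Definition young_integrable f g a b :=
  cvg (left_riemann_sum f g a b s @[s --> mesh_filter a b]).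

Definition young_integral f g a b : R :=
  lim (left_riemann_sum f g a b s @[s --> mesh_filter a b]).

End young_integral.

Section probability_notions.
Context d (Omega : measurableType d) (R : realType) (P : probability Omega R).
Implicit Types (H l : R) (D : R -> set Omega) (Y : R -> Omega -> R).

Definition gaussian_rv (Y : Omega -> R) :=
  exists m s : R,
    (0 < s /\
      forall A : set R, measurable A -> P (Y @^-1` A) = normal_prob m s A) \/
    (forall A : set R, measurable A -> P (Y @^-1` A) = \d_m A).

Definition gaussian_process (B : R -> {RV P >-> R}) :=
  forall (n : nat) (t a : 'I_n -> R), (forall i, 0 <= t i) ->
    gaussian_rv (fun w => \sum_(i < n) a i * B (t i) w).

(* Processes are indexed by all of R, but only times t >= 0 are constrained. *)
Definition fractional_brownian_motion H (B : R -> {RV P >-> R}) :=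
  [/\ gaussian_process B,
      forall t : R, 0 <= t -> ('E_P[B t] = 0)%E,
      forall s t : R, 0 <= s -> 0 <= t ->
        covariance P (B s) (B t) =
        ((s `^ (2 * H) + t `^ (2 * H) - `|t - s| `^ (2 * H)) / 2)%:E &
      {ae P, forall w, {within `[0, +oo[, continuous (fun t : R => B t w)}}].

Definition sde_solution (b : R -> R) (sigma : R) (B : R -> {RV P >-> R})
    (X0 : {RV P >-> R}) (X : R -> {RV P >-> R}) :=
  {ae P, forall w,
    {within `[0, +oo[, continuous (fun t : R => X t w)} /\
    forall t : R, 0 <= t ->
      X t w =
      X0 w + (\int[lebesgue_measure]_(s in `[0, t]) b (X s w)) +
      sigma * B t w}.

(* Convergence in probability to l, as t --> +oo, of random variables Y t
   defined on the event D t: the event that Y t is defined and within e of l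
   has a probability tending to 1. The complementary event is measured by the
   outer measure of P, which is P on measurable sets, because the random
   variables are only determined up to a P-null set and P need not be
   complete. *)
Definition cvg_in_probability D Y l :=
  forall e : R, 0 < e ->
    mu_ext P (~` (D t `&` [set w | `|Y t w - l| <= e])) @[t --> +oo] --> 0%E.

End probability_notions.

Section nadaraya_watson.
Context {R : realType} (K : R -> R) (x h : R).
Implicit Types (T : R) (X : R -> R).

Definition nw_weight X (s : R) := K ((X s - x) / h).

Definition nw_denominator T X : R :=
  \int[lebesgue_measure]_(s in `[0, T]) nw_weight X s.

Definition nw_numerator T X : R := young_integral (nw_weight X) X 0 T.

Definition nw_defined T X :=
  young_integrable (nw_weight X) X 0 T /\ 0 < nw_denominator T X.

Definition nw_estimator T X : R := nw_numerator T X / nw_denominator T X.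

End nadaraya_watson.

(* Main.v *)
Require Import Defs.
From HB Require Import structures.
From mathcomp Require Import all_boot all_order all_algebra.
From mathcomp Require Import all_classical all_reals all_analysis measurable_realfun.
From mathcomp Require Import ring lra zify.

(* Let F be the primitive of k = K((. - x) / h) given by the rescaled cumulative
   integral of K. Since H > 1/2, the quadratic variation of X vanishes, so the
   Riemann sums of k(X) dX converge to F(X_T) - F(X_0), which lies in [-h, h];
   it remains to show that the occupation integral of k(X) on [0, T] tends to
   infinity in probability.

   By dissipativity, X stays close to its Euler scheme y driven by the increments
   of sigma B, uniformly in the horizon, up to an initial error that is forgotten
   exponentially fast. The time average A of k(y) is a smooth function of these
   increments, whose partial derivatives are O(1/T); as the increments of B are
   nonnegatively correlated, a Gaussian Poincare inequality bounds the variance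
   of A by O(T^-2 Var(B_T)) = O(T^(2H - 2)). The mean of A is bounded below
   uniformly in T and in the step: when the sum xi of the increments over the last
   window of fixed duration is replaced by an independent copy, y_k becomes an
   increasing bi-Lipschitz function of this copy, and the small-ball estimate for
   xi applies. *)

Set Implicit Arguments.
Unset Strict Implicit.
Unset Printing Implicit Defensive.
Import Order.TTheory GRing.Theory Num.Theory.
Import numFieldTopology.Exports numFieldNormedType.Exports.
Local Open Scope classical_set_scope.
Local Open Scope ring_scope.

(** * Gaussian calculus *)

(** The Gaussian estimates are made at a fixed step, with constants free of the step and of the
    horizon. The step then tends to 0 without any convergence of expectations: off the event that
    the time averages are eventually small, infinitely many steps have a large average, and these
    already bound the occupation integral below. The sum of the absolute increments of the noise
    diverges as the step vanishes, so moments are controlled through variances of block sums, by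
    Abel summation. Likewise a single increment has too little variance to spread the law of [y_k];
    the window has the fixed duration 1/(2L), short enough for the damping factor inside it to stay
    at least 1/2. Joint Gaussianity enters only through the integrals of cos(linear form + c), which
    determine a law on tuples; rotation invariance and independence of regression residuals thus
    reduce to identities between variances. The assumption H > 1/2 serves twice: t^(2H) is convex,
    whence the nonnegative correlations, and 2^(1-2H) < 1, whence summable dyadic quadratic
    variations. *)

Section normal_stein.
Context {R : realType}.
Local Notation mu := (@lebesgue_measure R).

(** The Radon-Nikodym derivative of [normal_prob] and [normal_pdf] have the same integral over every
    measurable set, hence agree almost everywhere. *)
Lemma normal_prob_integralE (m s : R) (f : R -> \bar R) :
  (normal_prob m s).-integrable setT f ->
  (\int[normal_prob m s]_x f x = \int[mu]_x (f x * (normal_pdf m s x)%:E))%E.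
Proof.
move=> fi; have dom := @normal_prob_dominates R m s.
have mf : measurable_fun setT f := measurable_int _ fi.
rewrite -(Radon_Nikodym_change_of_variables dom)//=.
apply: ae_eq_integral => //.
- apply: emeasurable_funM => //; apply: (measurable_int mu).
- apply: emeasurable_funM => //=; apply/measurableT_comp => //=.
  exact: measurable_normal_pdf.
- apply: ae_eqe_mul2l => /=.
  rewrite Radon_NikodymE//=.
  case: cid => /= h [h1 h2 h3].
  apply: integral_ae_eq => //=.
  + by apply/measurable_EFinP; exact: measurable_normal_pdf.
  + by move=> E _ mE; rewrite -h3//=; exact: dom.
Qed.

Lemma normal_prob_integrable_pdf (m s : R) (g : R -> R) :
  (normal_prob m s).-integrable setT (EFin \o g) ->
  mu.-integrable setT (fun x => (g x * normal_pdf m s x)%:E).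
Proof.
move=> gi; have mg : measurable_fun setT g.
  by apply/measurable_EFinP; exact: (measurable_int _ gi).
apply/integrableP; split.
  apply/measurable_EFinP; apply: measurable_funM => //.
  exact: measurable_normal_pdf.
have := normal_prob_integralE (integrable_abse gi).
under [in X in _ = X -> _]eq_integral do
  rewrite /= -EFinM -{1}(ger0_norm (normal_pdf_ge0 m s _)) -normrM.
move=> <-.
by move/integrableP : gi => [].
Qed.

(** The fundamental theorem of calculus on [-n-1, n+1] leaves boundary terms that vanish in the
    limit, and |f| dominates the truncated integrands. *)
Lemma integralT_derive_eq0 (F f : R -> R) :
  (forall x, is_derive x (1 : R) F (f x)) -> continuous f ->
  mu.-integrable setT (EFin \o f) ->
  F n%:R @[n --> \oo] --> (0 : R) -> F (- n%:R) @[n --> \oo] --> (0 : R) ->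
  (\int[mu]_x (f x)%:E = 0)%E.
Proof.
move=> dF cf fi Fn FNn.
have contF : continuous F.
  move=> x; apply/differentiable_continuous/derivable1_diffP.
  by have [] := dF x.
pose I n : set R := `[- n.+1%:R, n.+1%:R]%classic.
have h : (\int[mu]_x (f x * \1_(I n) x)%:E)%E @[n --> \oo] -->
         (\int[mu]_x (f x)%:E)%E.
  apply: (@dominated_cvg _ _ R mu setT measurableT _ _ (fun x => `|f x|%:E)) => //.
  - move=> n; apply/measurable_EFinP; apply: measurable_funM.
      exact: continuous_measurable_fun.
    by apply: measurable_indic; exact: measurable_itv.
  - move=> x _; apply: cvg_EFin; first by near=> n.
    apply/cvgrPdist_le => /= e e0; near=> n.
    rewrite indicE mem_set ?mulr1 ?subrr ?normr0 ?ltW//.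
    rewrite /I /= in_itv/= -ler_norml.
    apply: (@le_trans _ _ n%:R); last by rewrite ler_nat.
    by near: n; exact: nbhs_infty_ger.
  - exact: integrable_abse fi.
  - move=> n x _ /=; rewrite lee_fin normrM ler_piMr// indicE.
    by case: (_ \in _); rewrite ?normr1 ?normr0.
have h2 : (\int[mu]_x (f x * \1_(I n) x)%:E)%E @[n --> \oo] --> 0%E.
  have -> : (fun n => \int[mu]_x (f x * \1_(I n) x)%:E)%E =
            EFin \o (fun n => F n.+1%:R - F (- n.+1%:R)).
    apply/funext => n.
    have nn : - n.+1%:R < n.+1%:R :> R by rewrite gtrN.
    transitivity (\int[mu]_(x in I n) (f x)%:E)%E.
      rewrite [in RHS]integral_mkcond; apply: eq_integral => x _.
      rewrite patchE indicE; case: (_ \in _); by rewrite ?mulr1 ?mulr0.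
    rewrite /I (continuous_FTC2 nn _ (F := F))//.
    - by apply: continuous_subspaceT.
    - split.
      + by move=> x _; have [] := dF x.
      + by apply: cvg_at_right_filter; exact: contF.
      + by apply: cvg_at_left_filter; exact: contF.
    - by move=> x _; rewrite derive1E; have [_ ->] := dF x.
  apply: cvg_EFin; first by near=> n.
  rewrite -[X in _ --> X](subr0 (0 : R)).
  apply: (@cvgB _ R^o).
    by rewrite (cvg_shiftS (fun n => F n%:R)).
  by rewrite (cvg_shiftS (fun n => F (- n%:R))).
by rewrite -(cvg_lim _ h)// (cvg_lim _ h2).
Unshelve. all: by end_near. Qed.

Lemma is_derive_normal_pdf (m s x : R) : s != 0 ->
  is_derive x (1 : R) (normal_pdf m s)
    (- (x - m) / s ^+ 2 * normal_pdf m s x).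
Proof.
move=> s0; rewrite normal_pdfE// /normal_fun.
apply: is_derive_eq.
rewrite /GRing.scale /=; field.
by rewrite s0.
Qed.

(** Rests on u <= exp u, at u = (x - m)^2 / (2 s^2). *)
Lemma normal_pdf_sqr_le (m s x : R) : s != 0 ->
  (x - m) ^+ 2 * normal_pdf m s x <= normal_peak s * (s ^+ 2 *+ 2).
Proof.
move=> s0; rewrite normal_pdfE// /normal_fun mulrCA.
rewrite ler_pM2l ?normal_peak_gt0//.
have s2 : 0 < s ^+ 2 *+ 2 by rewrite pmulrn_lgt0// exprn_even_gt0.
rewrite -[leRHS]mulr1 -ler_pdivrMl// mulrA mulNr expRN (mulrC _^-1).
rewrite ler_pdivrMr ?expR_gt0// mul1r.
by apply: le_trans (expR_ge1Dx _); rewrite lerDr.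
Qed.

(** Stein's identity. The product of [f] and the density has derivative f' - (x - m) f / s^2 times
    the density; it vanishes at infinity since [f] grows at most linearly, so this derivative has
    integral 0. *)
Lemma normal_stein (m s : R) (f f' : R -> R) : s != 0 ->
  (forall x, is_derive x (1 : R) f (f' x)) -> continuous f' ->
  (exists C, forall x, `|f x| <= C * (1 + `|x - m|)) ->
  (normal_prob m s).-integrable setT (EFin \o f') ->
  (normal_prob m s).-integrable setT (fun x => ((x - m) * f x)%:E) ->
  (\int[normal_prob m s]_x ((x - m) * f x)%:E =
   (s ^+ 2)%:E * \int[normal_prob m s]_x (f' x)%:E)%E.
Proof.
move=> s0 df cf' [C fC] f'i xfi.
have cf : continuous f.
  move=> x; apply/differentiable_continuous/derivable1_diffP.
  by have [] := df x.
have s20 : s ^+ 2 != 0 by rewrite sqrf_eq0.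
pose g x := f' x - (x - m) * f x / s ^+ 2.
have gi : (normal_prob m s).-integrable setT (EFin \o g).
  by apply: eq_integrable (integrableB measurableT f'i
    (integrableZr measurableT (s ^+ 2)^-1 xfi)).
(* [D] bounds the density times 1 + (x - m)^2. With the linear growth of [f], the boundary term is
   then O(1 / (1 + |x - m|)). *)
pose D := normal_peak s + normal_peak s * (s ^+ 2 *+ 2).
have lim_aux (u : nat -> R) : (forall n, u n = n%:R \/ u n = - n%:R) ->
    f (u n) * normal_pdf m s (u n) @[n --> \oo] --> (0 : R).
  move=> un; apply/cvgrPdist_le => /= e e0; near=> n.
  set v := u n; rewrite sub0r normrN normrM (ger0_norm (normal_pdf_ge0 m s v)).
  have v1 : 0 < 1 + `|v - m| by rewrite ltr_pwDl.
  have pD : (1 + (v - m) ^+ 2) * normal_pdf m s v <= D.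
    by rewrite mulrDl mul1r lerD ?normal_pdf_ub ?normal_pdf_sqr_le.
  have C0 : 0 <= C.
    by rewrite -(pmulr_lge0 _ v1); apply: le_trans (fC v).
  apply: (@le_trans _ _ (C * (2 * D) / (1 + `|v - m|))).
    rewrite ler_pdivlMr// mulrAC.
    apply: (@le_trans _ _ ((C * (1 + `|v - m|)) * (1 + `|v - m|) * normal_pdf m s v)).
      by rewrite ler_wpM2r ?normal_pdf_ge0// ler_wpM2r// ltW.
    rewrite -!mulrA ler_wpM2l//.
    apply: (@le_trans _ _ (2 * ((1 + (v - m) ^+ 2) * normal_pdf m s v))); last first.
      by rewrite ler_wpM2l.
    rewrite !mulrA ler_wpM2r ?normal_pdf_ge0//.
    have := sqr_ge0 (1 - `|v - m|); rewrite -[in X in _ -> X](real_normK (num_real (v - m))).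
    by set w := `|_|; nra.
  rewrite ler_pdivrMr// [leRHS]mulrC -ler_pdivrMr//.
  have : n%:R <= `|v - m| + `|m|.
    have : `|v| = n%:R by rewrite /v; case: (un n) => ->; rewrite ?normrN normr_nat.
    by move=> <-; rewrite -{1}(subrK m v) ler_normD.
  rewrite -lerBlDr => h.
  apply: (@le_trans _ _ (n%:R - `|m|)); last by apply: (le_trans h); rewrite lerDr.
  rewrite lerBrDr; near: n; exact: nbhs_infty_ger.
have := @integralT_derive_eq0 (fun x => f x * normal_pdf m s x)
  (fun x => g x * normal_pdf m s x).
have -> : (\int[mu]_x (g x * normal_pdf m s x)%:E = 
  \int[normal_prob m s]_x (f' x)%:E -
  \int[normal_prob m s]_x ((x - m) * f x)%:E * (s ^+ 2)^-1%:E)%E.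
  rewrite -integralZr// -integralB//; last first.
    exact: (integrableZr measurableT (s ^+ 2)^-1 xfi).
  transitivity (\int[mu]_x ((EFin \o g) x * (normal_pdf m s x)%:E))%E.
    by apply: eq_integral.
  by rewrite -normal_prob_integralE.
move=> H.
have {H} : (\int[normal_prob m s]_x (f' x)%:E =
  \int[normal_prob m s]_x ((x - m) * f x)%:E * (s ^+ 2)^-1%:E)%E.
  apply/eqP; rewrite -[eqbRHS]add0e -sube_eq.
  - apply/eqP; apply: H.
    + move=> x; have := is_derive_normal_pdf m x s0 => d.
      apply: is_derive_eq; rewrite /g /GRing.scale /=; field.
      by rewrite s0.
    + move=> x; apply: cvgM; last exact: continuous_normal_pdf.
      apply: (@cvgB _ R^o); first exact: cf'.
      apply: cvgM; last exact: cvg_cst.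
      apply: cvgM; last exact: cf.
      by apply: (@cvgB _ R^o); [exact: cvg_id|exact: cvg_cst].
    + exact: normal_prob_integrable_pdf.
    + by apply: (lim_aux (fun n => n%:R)) => n; left.
    + by apply: (lim_aux (fun n => - n%:R)) => n; right.
  - by apply: integrable_fin_num.
  - by rewrite fin_num_adde_defl// fin_numM// integrable_fin_num.
move=> ->; rewrite muleC -muleA -EFinM mulVf// mule1.
by [].
Unshelve. all: by end_near. Qed.

End normal_stein.

Section expectation_toolbox.
Context d (T : measurableType d) (R : realType) (P : probability T R).
Implicit Types f g : T -> R.

Lemma integrable_fD f g : P.-integrable setT (EFin \o f) ->
  P.-integrable setT (EFin \o g) ->
  P.-integrable setT (EFin \o (fun x => f x + g x)).
Proof. by move=> fi gi; exact: (integrableD measurableT fi gi). Qed.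

Lemma integrable_fB f g : P.-integrable setT (EFin \o f) ->
  P.-integrable setT (EFin \o g) ->
  P.-integrable setT (EFin \o (fun x => f x - g x)).
Proof. by move=> fi gi; exact: (integrableB measurableT fi gi). Qed.

Lemma integrable_fZ (k : R) f : P.-integrable setT (EFin \o f) ->
  P.-integrable setT (EFin \o (fun x => k * f x)).
Proof. by move=> fi; exact: (integrableZl measurableT k fi). Qed.

Lemma integrable_fcst (k : R) : P.-integrable setT (EFin \o (fun=> k)).
Proof. exact: finite_measure_integrable_cst. Qed.

Lemma integrable_fsum n (F : nat -> T -> R) :
  (forall i, P.-integrable setT (EFin \o F i)) ->
  P.-integrable setT (EFin \o (fun x => \sum_(i < n) F i x)).
Proof.
move=> Fi; apply: (eq_integrable measurableT (fun x => \sum_(i < n) (F i x)%:E)%E).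
  by move=> x _; rewrite /= sumEFin.
by apply: integrable_sum => // i _; exact: Fi.
Qed.

Lemma integrable_bounded f (C : R) : measurable_fun setT f ->
  (forall x, `|f x| <= C) -> P.-integrable setT (EFin \o f).
Proof.
move=> mf fC; apply: measurable_bounded_integrable => //.
  by rewrite (le_lt_trans (probability_le1 _ _)) ?ltry.
exists C; split; first exact: num_real.
by move=> D CD x _ /=; exact: le_trans (fC x) (ltW CD).
Qed.

Lemma integrable_dominated f g : measurable_fun setT f ->
  (forall x, `|f x| <= g x) -> P.-integrable setT (EFin \o g) ->
  P.-integrable setT (EFin \o f).
Proof.
move=> mf fg; apply: le_integrable => //; first exact/measurable_EFinP.
by move=> x _ /=; rewrite lee_fin; apply: le_trans (fg x) (ler_norm _).
Qed.

Lemma integrable_square_integrable f : measurable_fun setT f ->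
  P.-integrable setT (EFin \o (fun x => f x ^+ 2)) ->
  P.-integrable setT (EFin \o f).
Proof.
move=> mf f2; apply: (@integrable_dominated _ (fun x => 1 + f x ^+ 2)) => //.
  move=> x; have := sqr_ge0 (1 - `|f x|).
  rewrite -(real_normK (num_real (f x))).
  by have := normr_ge0 (f x); set w := `|_|; nra.
by apply: integrable_fD => //; exact: integrable_fcst.
Qed.

Lemma integrable_mul_square f g : measurable_fun setT f -> measurable_fun setT g ->
  P.-integrable setT (EFin \o (fun x => f x ^+ 2)) ->
  P.-integrable setT (EFin \o (fun x => g x ^+ 2)) ->
  P.-integrable setT (EFin \o (fun x => f x * g x)).
Proof.
move=> mf mg f2 g2.
apply: (@integrable_dominated _ (fun x => f x ^+ 2 + g x ^+ 2)).
- exact: measurable_funM.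
- move=> x; rewrite ler_norml; apply/andP; split.
    by have := sqr_ge0 (f x + g x); have := sqr_ge0 (f x - g x); nra.
  by have := sqr_ge0 (f x - g x); have := sqr_ge0 (f x + g x); nra.
- exact: integrable_fD.
Qed.

Lemma Rintegral_sum n (F : nat -> T -> R) :
  (forall i, P.-integrable setT (EFin \o F i)) ->
  \int[P]_x (\sum_(i < n) F i x) = \sum_(i < n) \int[P]_x F i x.
Proof.
move=> Fi; elim: n => [|n ih].
  under eq_Rintegral do rewrite big_ord0.
  by rewrite big_ord0 Rintegral_cst// mul0r.
under eq_Rintegral do rewrite big_ord_recr/=.
by rewrite RintegralD// ?ih ?big_ord_recr//; exact: integrable_fsum.
Qed.

Lemma Rintegral_probability_cst (c : R) : \int[P]_x c = c.
Proof. by rewrite Rintegral_cst//= [X in fine X](probability_setT P) mulr1. Qed.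

End expectation_toolbox.

Section gaussian_characteristic.
Context d (T : measurableType d) (R : realType) (P : probability T R).
Variable Y : {mfun T >-> R}.
Let mY : measurable_fun setT Y. Proof. exact: measurable_funPT. Qed.
Hypothesis Y2 : P.-integrable setT (EFin \o (fun w => Y w ^+ 2)).

Let Yi : P.-integrable setT (EFin \o Y).
Proof. exact: integrable_square_integrable. Qed.

Section normal_case.
Variables m s : R.
Hypothesis s0 : s != 0.
Hypothesis YN : forall A : set R, measurable A ->
  P (Y @^-1` A) = normal_prob m s A.

(** The same map with values in [measurableTypeR R], so that its law and [normal_prob] live on one
    measurable space. *)
Let Y1mf := isMeasurableFun.Build _ _ T (measurableTypeR R) Y mY.
Let Y1 : {mfun T >-> measurableTypeR R} := HB.pack (Y : T -> measurableTypeR R) Y1mf.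

Let int_normalE (f : R -> \bar R) :
  (\int[normal_prob m s]_x f x = \int[pushforward P Y1]_x f x)%E.
Proof.
have := @eq_measure_integral _ (measurableTypeR R) R setT (distribution P Y1)
  (normal_prob m s).
by apply => A mA _; symmetry; apply: (YN mA).
Qed.

Let transfer (f : R -> R) : measurable_fun setT f ->
  P.-integrable setT (EFin \o (f \o Y)) ->
  (normal_prob m s).-integrable setT (EFin \o f) /\
  (\int[normal_prob m s]_x (f x)%:E = \int[P]_w (f (Y w))%:E)%E.
Proof.
move=> mf fY; have mEf : measurable_fun [set: R] (EFin \o f).
  exact/measurable_EFinP.
split.
  apply/integrableP; split => //.
  rewrite int_normalE.
  rewrite ge0_integral_pushforward//.
  - by have /integrableP[] := fY.
  - exact/measurable_EFinP/measurableT_comp.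
rewrite int_normalE.
by rewrite integral_pushforward.
Qed.

Let stein (f f' : R -> R) :
  (forall x, is_derive x (1 : R) f (f' x)) -> continuous f' ->
  (exists C, forall x, `|f x| <= C * (1 + `|x - m|)) ->
  P.-integrable setT (EFin \o (f' \o Y)) ->
  P.-integrable setT (EFin \o (fun w => (Y w - m) * f (Y w))) ->
  \int[P]_w ((Y w - m) * f (Y w)) = s ^+ 2 * \int[P]_w f' (Y w).
Proof.
move=> df cf' fC f'i xfi.
have mf : measurable_fun setT f.
  apply: continuous_measurable_fun => x.
  by apply/differentiable_continuous/derivable1_diffP; have [] := df x.
have [f'N f'E] := transfer (continuous_measurable_fun cf') f'i.
have mxf : measurable_fun setT (fun x : R => (x - m) * f x).
  by apply: measurable_funM => //; apply: measurable_funB.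
have [xfN xfE] := transfer mxf xfi.
have := normal_stein s0 df cf' fC f'N xfN.
rewrite f'E xfE /Rintegral => ->.
by rewrite fineM// integrable_fin_num.
Qed.

Hypothesis EY : \int[P]_w Y w = 0.

(** Stein's identity for the constant function 1; the variance comes next from the identity
    function. *)
Lemma normal_mean0 : m = 0.
Proof.
have := @stein (cst 1) (cst 0).
rewrite /= Rintegral_cst// mul0r mulr0.
under eq_Rintegral do rewrite mulr1.
rewrite RintegralB//; last exact: finite_measure_integrable_cst.
rewrite EY Rintegral_probability_cst sub0r => h; apply/eqP.
rewrite -oppr_eq0; apply/eqP; apply: h.
- by move=> x; exact: cvg_cst.
- by exists 1 => x; rewrite normr1 mul1r lerDl.
- exact: finite_measure_integrable_cst.
- apply: (eq_integrable measurableT (EFin \o (fun w => Y w - m))).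
    by move=> w _; rewrite /= mulr1.
  by apply: integrable_fB => //; exact: integrable_fcst.
Qed.

Lemma normal_variance : s ^+ 2 = \int[P]_w (Y w) ^+ 2.
Proof.
have := @stein id (cst 1); rewrite Rintegral_probability_cst mulr1.
have E w : (Y w - m) * id (Y w) = Y w ^+ 2 by rewrite /= normal_mean0 subr0 expr2.
under eq_Rintegral do rewrite E.
move=> -> //.
- by move=> x; exact: cvg_cst.
- exists 1 => x; rewrite normal_mean0 subr0 mul1r.
  by rewrite lerDr.
- exact: finite_measure_integrable_cst.
- apply: eq_integrable Y2 => // w _.
  by rewrite /= normal_mean0 subr0 expr2.
Qed.

(** With phi(a) the mean of cos(a Y + c), differentiation under the integral and Stein's identity
    for sin(a y + c) give phi' = - a s^2 phi, so phi(a) exp(a^2 s^2 / 2) is constant. The free phase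
    [c] lets a real integral carry both parts of the characteristic function. *)
Lemma normal_char (c : R) :
  \int[P]_w cos (Y w + c) = cos c * expR (- (\int[P]_w (Y w) ^+ 2) / 2).
Proof.
rewrite -normal_variance.
pose phi a := \int[P]_w cos (a * Y w + c).
have maY a : measurable_fun setT (fun w => a * Y w + c).
  by apply: measurable_funD => //; apply: measurable_funM.
have mcos a : measurable_fun setT (fun w => cos (a * Y w + c)).
  by apply: measurableT_comp => //; exact: (continuous_measurable_fun (@continuous_cos R)).
have msin a : measurable_fun setT (fun w => sin (a * Y w + c)).
  by apply: measurableT_comp => //; exact: (continuous_measurable_fun (@continuous_sin R)).
have icos a : P.-integrable setT (EFin \o (fun w => cos (a * Y w + c))).
  by apply: (@integrable_bounded _ _ _ _ _ 1) => // w; rewrite ler_norml cos_geN1 cos_le1.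
have isin a : P.-integrable setT (EFin \o (fun w => Y w * sin (a * Y w + c))).
  apply: (@integrable_dominated _ _ _ _ _ (fun w => `|Y w|)).
  - exact: measurable_funM.
  - by move=> w; rewrite normrM ler_piMr// ler_norml sin_geN1 sin_le1.
  - exact: integrable_norm.
have d1 a w : is_derive a (1 : R) (fun a => cos (a * Y w + c))
    (- (Y w * sin (a * Y w + c))).
  apply: is_derive_eq; rewrite /GRing.scale /=; ring.
have dphi a : is_derive a (1 : R) phi (- (a * s ^+ 2) * phi a).
  have Ia : `](a - 1), (a + 1)[%classic a.
    by rewrite /= in_itv/=; apply/andP; split; lra.
  have p1 x w : partial1of2 (fun a w => cos (a * Y w + c)) x w =
      - (Y w * sin (x * Y w + c)).
    by rewrite partial1of2E; have [_ ->] := d1 x w.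
  have h1 := @derivable_under_integral R _ T P (fun a w => cos (a * Y w + c))
    setT measurableT a (a - 1) (a + 1) Ia (fun x _ => icos x)
    (fun x w _ _ => let: DeriveDef h _ := d1 x w in h) (fun w => `|Y w|)
    (fun w => normr_ge0 _) (integrable_norm Yi).
  have h2 := @differentiation_under_integral R _ T P (fun a w => cos (a * Y w + c))
    setT measurableT a (a - 1) (a + 1) Ia (fun x _ => icos x)
    (fun x w _ _ => let: DeriveDef h _ := d1 x w in h) (fun w => `|Y w|)
    (fun w => normr_ge0 _) (integrable_norm Yi).
  have ub x w : `](a - 1), (a + 1)[%classic x -> [set: T] w ->
      `|partial1of2 (fun a w => cos (a * Y w + c)) x w| <= `|Y w|.
    by move=> _ _; rewrite p1 normrN normrM ler_piMr// ler_norml sin_geN1 sin_le1.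
  apply: DeriveDef; first exact: h1.
  rewrite -derive1E h2//.
  under eq_Rintegral do rewrite p1 -mulN1r.
  rewrite RintegralZl// mulN1r mulNr; congr (- _).
  transitivity (\int[P]_w ((Y w - m) * sin (a * Y w + c))).
    by apply: eq_Rintegral => w _; rewrite normal_mean0 subr0.
  have d2 x : is_derive x (1 : R) (fun y => sin (a * y + c)) (a * cos (a * x + c)).
    apply: is_derive_eq; rewrite /GRing.scale /=; ring.
  rewrite (@stein _ (fun y => a * cos (a * y + c)) d2).
  - rewrite RintegralZl// mulrA; congr (_ * _); ring.
  - move=> x; apply: cvgM; first exact: cvg_cst.
    apply: (cvg_comp (fun y => a * y + c) cos); last exact: continuous_cos.
    apply: (@cvgD _ R^o); last exact: cvg_cst.
    by apply: cvgM; [exact: cvg_cst|exact: cvg_id].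
  - exists 1 => x; rewrite mul1r (@le_trans _ _ 1)//.
      by rewrite ler_norml sin_geN1 sin_le1.
    by rewrite lerDl.
  - exact: (integrableZl measurableT a (icos a)).
  - apply: eq_integrable (isin a) => // w _.
    by rewrite /= normal_mean0 subr0.
pose psi a := phi a * expR (a ^+ 2 * s ^+ 2 / 2).
have dpsi a : is_derive a (1 : R) psi 0.
  apply: is_derive_eq; rewrite /GRing.scale /=; field => //.
have : psi 1 = psi 0 by apply: is_derive_0_is_cst.
rewrite /psi /phi expr1n mul1r expr0n/= !mul0r expR0 mulr1.
under eq_Rintegral do rewrite mul1r.
under [X in _ = X]eq_Rintegral do rewrite mul0r add0r.
rewrite Rintegral_probability_cst => <-.
by rewrite -mulrA -expRD mulNr subrr expR0 mulr1.
Qed.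

End normal_case.

Lemma dirac_expectation (m : R) (f : R -> R) :
  (forall A : set R, measurable A -> P (Y @^-1` A) = \d_m A) ->
  measurable_fun setT f -> \int[P]_w f (Y w) = f m.
Proof.
move=> YD mf.
have aeY : {ae P, forall w, Y w = m}.
  exists (Y @^-1` (~` [set m])); split.
  - by rewrite -[_ @^-1` _]setTI; apply: mY => //; apply: measurableC.
  - rewrite YD; last exact: measurableC.
    by rewrite diracE memNset// => /(_ erefl).
  - by move=> w /= Yw ? ; exact: Yw.
rewrite -[RHS](Rintegral_probability_cst P); congr fine.
apply: ae_eq_integral => //.
- exact/measurable_EFinP/measurableT_comp.
- by case: aeY => N [mN N0 sN]; exists N; split => // w nw; apply: sN => /= Yw;
    apply: nw => _; rewrite Yw.
Qed.

(** A centered degenerate law is the Dirac mass at 0, for which both sides equal [cos c]. *)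
Lemma gaussian_char (c : R) : gaussian_rv P Y -> \int[P]_w Y w = 0 ->
  \int[P]_w cos (Y w + c) = cos c * expR (- (\int[P]_w (Y w) ^+ 2) / 2).
Proof.
move=> [m [s [[s_gt0 YN]|YD]]] EY.
  by apply: (@normal_char m s) => //; rewrite gt_eqF.
have m0 : m = 0 by rewrite -(@dirac_expectation m id YD)// EY.
rewrite (@dirac_expectation m (fun y => cos (y + c)) YD); last first.
  apply: continuous_measurable_fun => x.
  apply: (cvg_comp (fun y => y + c) cos); last exact: continuous_cos.
  by apply: (@cvgD _ R^o); [exact: cvg_id|exact: cvg_cst].
rewrite (@dirac_expectation m (fun y => y ^+ 2) YD); last exact: measurable_funX.
by rewrite m0 add0r expr0n/= oppr0 mul0r expR0 mulr1.
Qed.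

(** Every point of [a, a + l] has modulus at most rho + l, where the centered density is at least
    the factor in front of [l]. The positive variance excludes the Dirac case. *)
Lemma gaussian_small_ball (s rho l a : R) : gaussian_rv P Y ->
  \int[P]_w Y w = 0 -> 0 < s -> \int[P]_w (Y w) ^+ 2 = s ^+ 2 -> 0 <= l ->
  `|a| <= rho ->
  ((normal_peak s * expR (- (rho + l) ^+ 2 / (s ^+ 2 *+ 2)) * l)%:E <=
   P [set w | (a <= Y w <= a + l)%R])%E.
Proof.
move=> [m [t [[t_gt0 YN]|YD]]] EY s0 Vs l0 ar; last first.
  have m0 : m = 0 by rewrite -(@dirac_expectation m id YD)// EY.
  have := @dirac_expectation m (fun y => y ^+ 2) YD.
  rewrite Vs m0 expr0n/= => /(_ (measurable_funX _ (@measurable_id _ _ setT))) /eqP.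
  by rewrite sqrf_eq0 gt_eqF.
have t0 : t != 0 by rewrite gt_eqF.
have m0 : m = 0 by exact: (normal_mean0 t0 YN EY).
have ts : t = s.
  have : t ^+ 2 = s ^+ 2 by rewrite -Vs; exact: (normal_variance t0 YN EY).
  by move/eqP; rewrite eqrXn2 ?ltW// => /eqP.
rewrite (_ : [set w | _] = Y @^-1` `[a, (a + l)]); last first.
  by apply/seteqP; split => w /=; rewrite in_itv.
rewrite YN// m0 ts /normal_prob.
set k := normal_peak s * _.
have -> : (k * l)%:E = (\int[lebesgue_measure]_(x in `[a, (a + l)%R]) k%:E)%E.
  rewrite integral_cst//= lebesgue_measure_itv/= lte_fin ltrDl.
  have [lp|] := ltP 0 l; first by rewrite -EFinD addrAC subrr add0r EFinM.
  move=> l0'; have -> : l = 0 by apply/eqP; rewrite eq_le l0 l0'.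
  by rewrite mulr0 mule0.
have s0' : s != 0 by rewrite gt_eqF.
apply: ge0_le_integral => //=.
- by move=> x _; rewrite lee_fin mulr_ge0 ?normal_peak_ge0 ?expR_ge0.
- by apply/measurable_EFinP; apply: measurable_funTS; exact: measurable_normal_pdf.
- move=> x; rewrite in_itv/= => /andP[ax xa]; rewrite lee_fin normal_pdfE//.
  rewrite ler_pM2l ?normal_peak_gt0// /normal_fun ler_expR subr0.
  rewrite ler_pM2r; last by rewrite invr_gt0 pmulrn_lgt0// exprn_gt0.
  rewrite lerN2 -(real_normK (num_real x)) lerXn2r// ?nnegrE//.
    by apply: addr_ge0 => //; apply: le_trans ar.
  move: ar; rewrite !ler_norml => /andP[h1 h2]; apply/andP; split; lra.
Qed.

End gaussian_characteristic.

(** * Laws of finite sequences of random variables *)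

(** The cubic p(t) = (3t - t^3)/2 is odd, fixes 0, 1 and -1, and satisfies 1 - p(u) = (1 - u)^2 (2 +
    u)/2. On [t, 1] with t > 0 the distance to 1 thus shrinks by a factor at most 1 - t/2. *)
Lemma smoothstep_cvg_sgr (R : realType) (y : R) : `|y| <= 1 ->
  iter n (fun t => (3 * t - t ^+ 3) / 2) y @[n --> \oo] --> Num.sg y.
Proof.
set p := fun t : R => (3 * t - t ^+ 3) / 2.
have pos (t : R) : 0 < t <= 1 -> iter n p t @[n --> \oo] --> (1 : R).
  move=> /andP[t0 t1].
  have bnd n : t <= iter n p t <= 1 /\ 1 - iter n p t <= (1 - t / 2) ^+ n.
    elim: n => [|n [/andP[ih1 ih2] ih3]]; first by rewrite /= lexx t1; split => //; lra.
    rewrite iterS; set u := iter n p t in ih1 ih2 ih3 *.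
    have step : 1 - p u = (1 - u) * ((1 - u) * (2 + u) / 2) by rewrite /p; field.
    have cst : (1 - u) * (2 + u) / 2 <= 1 - t / 2 by nra.
    have cst0 : 0 <= (1 - u) * (2 + u) / 2 by nra.
    split; first (apply/andP; split).
    - have : 1 - p u <= 1 - u by rewrite step ler_piMr//; nra.
      by move: ih1; lra.
    - have : 0 <= 1 - p u by rewrite step mulr_ge0// subr_ge0.
      by lra.
    - by rewrite step exprSr ler_pM// subr_ge0.
  apply/cvgrPdist_le => /= e e0.
  have : (1 - t / 2) ^+ n @[n --> \oo] --> (0 : R).
    by apply: cvg_expr; rewrite ger0_norm; lra.
  move=> /cvgrPdist_le /(_ e e0); apply: filterS => n.
  rewrite sub0r normrN => h; have [/andP[_ b1] b2] := bnd n.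
  rewrite ger0_norm ?subr_ge0//; apply: le_trans b2 _.
  exact: le_trans (ler_norm _) h.
move=> y1; have [y0|y0|->] := ltrgt0P y.
- by rewrite gtr0_sg//; apply: pos; rewrite y0 -(gtr0_norm y0).
- rewrite ltr0_sg//.
  have odd n : iter n p y = - iter n p (- y).
    elim: n => [|n ih]; first by rewrite /= opprK.
    by rewrite /= ih /p; field.
  under eq_fun do rewrite odd.
  by apply: (@cvgN _ R^o); apply: pos; rewrite oppr_gt0 y0 -(ltr0_norm y0).
- rewrite sgr0; have -> : (fun n => iter n p 0) = cst (0 : R).
    apply/funext => n; by elim: n => //= n ->; rewrite /p; field.
  exact: cvg_cst.
Qed.

Lemma measurable_cos_comb d (T : measurableType d) (R : realType) n
    (U : 'I_n -> T -> R) (a : 'I_n -> R) (c : R) :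
  (forall i, measurable_fun setT (U i)) ->
  measurable_fun setT (fun z => cos (\sum_(i < n) a i * U i z + c)).
Proof.
move=> mU; apply: measurableT_comp.
  exact: (continuous_measurable_fun (@continuous_cos R)).
apply: measurable_funD => //; apply: measurable_sum => i.
by apply: measurable_funM.
Qed.

Section tuple_law_unique.
Context (R : realType) (n : nat).
Local Notation T := (n.-tuple R).
Variables mu nu : probability T R.

Let lin (a : 'I_n -> R) (z : T) := \sum_(i < n) a i * tnth z i.

Hypothesis cosE : forall a c,
  \int[mu]_z cos (lin a z + c) = \int[nu]_z cos (lin a z + c).

(* The class [multiplier] below contains the functions cos (lin a z + c) and is
   stable under linear combinations, products and bounded limits. It contains
   sgr y as the limit of sgr (sin (y / k)), where sgr on [-1, 1] is the limit of
   the iterates of a polynomial, hence the indicators of boxes. *)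
Let matched (f : T -> R) := [/\ measurable_fun setT f,
  exists C, forall z, `|f z| <= C &
  forall a c, \int[mu]_z (f z * cos (lin a z + c)) =
              \int[nu]_z (f z * cos (lin a z + c))].

Let mcos a c : measurable_fun setT (fun z => cos (lin a z + c)).
Proof. by apply: measurable_cos_comb => i; exact: measurable_tnth. Qed.

Let abs_cos_le1 (x : R) : `|cos x| <= 1.
Proof. by rewrite ler_norml cos_geN1 cos_le1. Qed.

Let int_cos (P : probability T R) f a c : matched f ->
  P.-integrable setT (EFin \o (fun z => f z * cos (lin a z + c))).
Proof.
move=> [mf [C fC] _]; apply: (@integrable_bounded _ _ _ _ _ C).
  exact: measurable_funM.
by move=> z; rewrite normrM; apply: le_trans (fC z); rewrite ler_piMr.
Qed.

Let matched_lin k f g : matched f -> matched g ->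
  matched (fun z => k * f z + g z).
Proof.
move=> mf mg; case: (mf) (mg) => [mf1 [C fC] fE] [mg1 [D gD] gE].
have E (P : probability T R) a c :
    \int[P]_z ((k * f z + g z) * cos (lin a z + c)) =
    k * \int[P]_z (f z * cos (lin a z + c)) + \int[P]_z (g z * cos (lin a z + c)).
  under eq_Rintegral do rewrite mulrDl -mulrA.
  rewrite RintegralD ?RintegralZl//; try exact: int_cos.
  by apply: integrable_fZ; exact: int_cos.
split.
- by apply: measurable_funD => //; exact: measurable_funM.
- exists (`|k| * C + D) => z; rewrite (le_trans (ler_normD _ _))// lerD//.
  by rewrite normrM ler_wpM2l.
- by move=> a c; rewrite !E fE gE.
Qed.

Let matched_lim (f : nat -> T -> R) (g : T -> R) C :
  (forall k, matched (f k)) -> (forall k z, `|f k z| <= C) ->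
  (forall z, f k z @[k --> \oo] --> g z) -> matched g.
Proof.
move=> mf fC fg.
have mg : measurable_fun setT g.
  apply: (@measurable_fun_cvg _ _ _ _ f) => //; first by move=> k; have [] := mf k.
have gC z : `|g z| <= C.
  have h : `|f k z| @[k --> \oo] --> `|g z| by apply: cvg_norm; exact: fg.
  by apply: (cvgr_to_le h); near=> k; exact: fC.
split => //; first by exists C.
move=> a c.
have L (P : probability T R) : \int[P]_z (f k z * cos (lin a z + c)) @[k --> \oo] -->
    \int[P]_z (g z * cos (lin a z + c)).
  have C0 : 0 <= C by apply: le_trans (fC 0%N [tuple 0 | i < n]).
  apply: fine_cvg; rewrite fineK; last first.
    apply: integrable_fin_num => //.
    apply: (@integrable_bounded _ _ _ _ (fun z => g z * cos (lin a z + c)) C).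
      exact: measurable_funM.
    by move=> z; rewrite normrM; apply: le_trans (gC z); rewrite ler_piMr.
  apply: (@dominated_cvg _ _ _ P setT measurableT _ _ (cst C%:E)) => //.
  - move=> k; apply/measurable_EFinP; apply: measurable_funM => //.
    by have [] := mf k.
  - move=> z _; apply: cvg_EFin; first by near=> k.
    by apply: cvgM; [exact: fg|exact: cvg_cst].
  - exact: integrable_fcst.
  - move=> k z _; rewrite lee_fin normrM; apply: le_trans (fC k z).
    by rewrite ler_piMr.
have L1 := L mu; have L2 := L nu.
have E : (fun k => \int[mu]_z (f k z * cos (lin a z + c))) =
         (fun k => \int[nu]_z (f k z * cos (lin a z + c))).
  by apply/funext => k; have [] := mf k.
rewrite E in L1.
exact: (cvg_unique (@norm_hausdorff _ R^o) L1 L2).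
Unshelve. all: by end_near. Qed.

Let multiplier (g : T -> R) := (exists C, forall z, `|g z| <= C) /\
  forall f, matched f -> matched (fun z => g z * f z).

(** 2 cos u cos v = cos(u - v) + cos(u + v), and both arguments on the right are again affine in
    [z]. *)
Let multiplier_cos a c : multiplier (fun z => cos (lin a z + c)).
Proof.
split; first by exists 1 => z.
move=> f mf; case: (mf) => [mf1 [C fC] fE]; split.
- exact: measurable_funM.
- by exists C => z; rewrite normrM; apply: le_trans (fC z); rewrite ler_piMl.
- move=> a' c'.
  have E (P : probability T R) :
    \int[P]_z (cos (lin a z + c) * f z * cos (lin a' z + c')) =
    2^-1 * (\int[P]_z (f z * cos (lin (fun i => a i - a' i) z + (c - c'))) +
            \int[P]_z (f z * cos (lin (fun i => a i + a' i) z + (c + c')))).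
    rewrite -RintegralD//; try exact: int_cos.
    rewrite -RintegralZl//; last by apply: integrable_fD; exact: int_cos.
    apply: eq_Rintegral => z _.
    have -> : lin (fun i => a i - a' i) z + (c - c') =
              (lin a z + c) - (lin a' z + c').
      rewrite /lin opprD addrACA; congr (_ + _); rewrite -sumrB.
      by apply: eq_bigr => i _; rewrite mulrBl.
    have -> : lin (fun i => a i + a' i) z + (c + c') =
              (lin a z + c) + (lin a' z + c').
      rewrite /lin addrACA; congr (_ + _); rewrite -big_split/=.
      by apply: eq_bigr => i _; rewrite mulrDl.
    move: (lin a z + c) (lin a' z + c') => u v.
    by rewrite cosB cosD; field.
  by rewrite !E !fE.
Qed.

Let multiplier_cst k : multiplier (cst k).
Proof.
split; first by exists `|k|.
move=> f mf; case: (mf) => [mf1 [C fC] fE].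
have m0 : matched (cst 0).
  split; [by []|by exists 0 => z; rewrite normr0|].
  by move=> a c; rewrite /Rintegral; congr fine;
    rewrite !integral0_eq// => z _; rewrite mul0r.
have := matched_lin k mf m0; congr matched.
by apply/funext => z; rewrite addr0.
Qed.

Let multiplier_lin k f g : multiplier f -> multiplier g ->
  multiplier (fun z => k * f z + g z).
Proof.
move=> [[C fC] mf] [[D gD] mg]; split.
  exists (`|k| * C + D) => z; rewrite (le_trans (ler_normD _ _))// lerD//.
  by rewrite normrM ler_wpM2l.
move=> h mh; have := matched_lin k (mf _ mh) (mg _ mh); congr matched.
by apply/funext => z; rewrite mulrDl mulrA.
Qed.

Let multiplier_mul f g : multiplier f -> multiplier g ->
  multiplier (fun z => f z * g z).
Proof.
move=> [[C fC] mf] [[D gD] mg]; split.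
  by exists (C * D) => z; rewrite normrM ler_pM.
move=> h mh; have := mf _ (mg _ mh); congr matched.
by apply/funext => z; rewrite mulrA.
Qed.

Let multiplier_lim (f : nat -> T -> R) (g : T -> R) C :
  (forall k, multiplier (f k)) -> (forall k z, `|f k z| <= C) ->
  (forall z, f k z @[k --> \oo] --> g z) -> multiplier g.
Proof.
move=> mf fC fg; split.
  exists C => z.
  have h : `|f k z| @[k --> \oo] --> `|g z| by apply: cvg_norm; exact: fg.
  by apply: (cvgr_to_le h); near=> k; exact: fC.
move=> h mh; case: (mh) => [mh1 [D hD] _].
apply: (@matched_lim (fun k z => f k z * h z) _ (C * D)).
- by move=> k; exact: (mf k).2.
- by move=> k z; rewrite normrM ler_pM.
- by move=> z; apply: cvgM; [exact: fg|exact: cvg_cst].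
Unshelve. all: by end_near. Qed.

Let multiplier_sgr g : (forall z, `|g z| <= 1) -> multiplier g ->
  multiplier (fun z => Num.sg (g z)).
Proof.
move=> g1 mg.
pose p := fun t : R => (3 * t - t ^+ 3) / 2.
(* Both 1 + p(t) and 1 - p(t) factor as a square times a positive term, so the iterates stay in
   [-1, 1] and the bounded limit applies. *)
have pb (t : R) : `|t| <= 1 -> `|p t| <= 1.
  rewrite !ler_norml => /andP[h1 h2]; apply/andP; split.
    rewrite -subr_ge0 (_ : _ - _ = (1 + t) ^+ 2 * ((2 - t) / 2)); last first.
      by rewrite /p; field.
    by rewrite mulr_ge0 ?sqr_ge0//; lra.
  rewrite -subr_ge0 (_ : _ - _ = (1 - t) ^+ 2 * ((2 + t) / 2)); last first.
    by rewrite /p; field.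
  by rewrite mulr_ge0 ?sqr_ge0//; lra.
apply: (@multiplier_lim (fun k z => iter k p (g z)) _ 1).
- elim => [|k ih] //=.
  have := multiplier_lin (3 / 2) ih (multiplier_lin (- 2^-1)
    (multiplier_mul ih (multiplier_mul ih ih)) (multiplier_cst 0)).
  by congr multiplier; apply/funext => z /=; set u := iter k p (g z); rewrite /p; field.
- by move=> k z; elim: k => [|k ih] //=; exact: pb.
- by move=> z; exact: smoothstep_cvg_sgr.
Qed.

Let multiplier_ray (i : 'I_n) x : multiplier (fun z => Num.sg (tnth z i - x)).
Proof.
apply: (@multiplier_lim (fun k z => Num.sg (sin ((tnth z i - x) / k.+1%:R))) _ 1).
- move=> k; apply: multiplier_sgr.
    by move=> z; rewrite ler_norml sin_geN1 sin_le1.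
  (* The phase -pi/2 turns the cosine into a sine; the coefficients select coordinate [i], scaled by
     1/(k + 1). *)
  have := multiplier_cos (fun j => (j == i)%:R / k.+1%:R) (- x / k.+1%:R - pi / 2).
  congr multiplier; apply/funext => z.
  rewrite addrA cosB cos_pihalf sin_pihalf mulr0 mulr1 add0r; congr sin.
  rewrite mulrBl mulNr; congr (_ - _).
  rewrite /lin (bigD1 i)//= eqxx big1 ?addr0 ?mul1r 1?mulrC//.
  by move=> j /negPf ->; rewrite !mul0r.
- by move=> k z; rewrite normr_sg; case: (_ != 0); rewrite ?normr1 ?normr0.
- move=> z; apply: cvg_near_cst.
  near=> k; rewrite /=.
  set y := tnth z i - x.
  (* Once |y|/(k + 1) < pi, the sine has the sign of [y]: the sequence is eventually constant. *)
  have small : `|y| / k.+1%:R < pi.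
    rewrite ltr_pdivrMr// mulrC -ltr_pdivrMr ?pi_gt0//.
    apply: (@lt_le_trans _ _ k%:R); last by rewrite ler_nat.
    by near: k; exact: nbhs_infty_gtr.
  have [y0|y0|->] := ltrgt0P y.
  + rewrite (gtr0_sg y0) gtr0_sg// sin_gt0_pi// divr_gt0//=.
    by rewrite -(gtr0_norm y0).
  + rewrite (ltr0_sg y0) -[_ / _]opprK sinN ltr0_sg// oppr_lt0 sin_gt0_pi//.
    by rewrite -mulNr divr_gt0 ?oppr_gt0//= -(ltr0_norm y0).
  + by rewrite mul0r sin0.
Unshelve. all: by end_near. Qed.

Let good (A : set T) := measurable A /\ multiplier (\1_A : T -> R).

Let good_ray (i : 'I_n) x : good ((@tnth n R ^~ i) @^-1` `]x, +oo[).
Proof.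
split.
  by rewrite -[_ @^-1` _]setTI; apply: measurable_tnth => //; exact: measurable_itv.
have m := multiplier_ray i x.
(* For a sign s, (s^2 + s)/2 is 1 if s = 1 and 0 if s is 0 or -1: the indicator of the open ray. *)
have := multiplier_lin 2^-1 (multiplier_mul m m) (multiplier_lin 2^-1 m (multiplier_cst 0)).
congr multiplier; apply/funext => z; rewrite indicE /=.
have -> : (z \in @tnth n R ^~ i @^-1` `]x, +oo[) = (0 < tnth z i - x).
  by rewrite subr_gt0; apply/idP/idP; rewrite inE /= in_itv/= andbT.
by case: sgrP => _; rewrite /=; field.
Qed.

Let goodC A : good A -> good (~` A).
Proof.
move=> [mA gA]; split; first exact: measurableC.
have := multiplier_lin (- 1) gA (multiplier_cst 1).
congr multiplier; apply/funext => z; rewrite !indicE in_setC.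
by case: (_ \in _); rewrite /=; ring.
Qed.

Let goodU A B : good A -> good B -> good (A `|` B).
Proof.
move=> [mA gA] [mB gB]; split; first exact: measurableU.
have := multiplier_lin 1 gA (multiplier_lin 1 gB (multiplier_lin (- 1)
  (multiplier_mul gA gB) (multiplier_cst 0))).
congr multiplier; apply/funext => z; rewrite !indicE in_setU.
by do 2 case: (_ \in _); rewrite /=; ring.
Qed.

Let good0 : good set0.
Proof.
split; first exact: measurable0.
by have := multiplier_cst 0; congr multiplier; apply/funext => z; rewrite indic0.
Qed.

(** At each point the indicators of the finite unions are eventually constant, so that of the
    countable union is a bounded limit of multipliers. *)
Let good_sigma_algebra : sigma_algebra setT good.
Proof.
split; [exact: good0|by move=> A gA; rewrite setTD; exact: goodC|].
move=> F gF; split; first by apply: bigcup_measurable => k _; have [] := gF k.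
have gp k : good (\big[setU/set0]_(i < k) F i).
  elim: k => [|k ih]; first by rewrite big_ord0; exact: good0.
  by rewrite big_ord_recr; exact: goodU.
apply: (@multiplier_lim (fun k => \1_(\big[setU/set0]_(i < k) F i)) _ 1).
- by move=> k; have [] := gp k.
- by move=> k z; rewrite indicE; case: (_ \in _); rewrite ?normr1 ?normr0.
- move=> z; have [[k _ Fkz]|nF] := pselect ((\bigcup_k F k) z).
    apply: cvg_near_cst.
    have h1 : z \in \bigcup_k F k by rewrite inE; exists k.
    near=> m.
    have h2 : z \in \big[setU/set0]_(i < m) F i.
      rewrite inE -bigcup_mkord; exists k => //=.
      by near: m; exists k.+1.
    by rewrite !indicE h1 h2.
  apply: cvg_near_cst.
  apply: nearW => m; rewrite !indicE (memNset nF) memNset//.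
  by rewrite -bigcup_mkord => -[k _ Fk]; apply: nF; exists k.
Unshelve. all: by end_near. Qed.

(** Preimages of open rays under the coordinates generate the sigma-algebra of tuples. An indicator
    that is a multiplier is then tested against the constant 1, with zero linear form and zero
    phase. *)
Lemma tuple_law_unique (A : set T) : measurable A -> mu A = nu A.
Proof.
move=> mA; suff gA : good A.
  have m1 : matched (cst 1).
    split; [by []|by exists 1 => z; rewrite normr1|].
    move=> a c; under eq_Rintegral do rewrite mul1r.
    by under [RHS]eq_Rintegral do rewrite mul1r; exact: cosE.
  have [_ _ /(_ (fun=> 0) 0)] := gA.2.2 _ m1.
  have E (P : probability T R) :
      \int[P]_z ((\1_A z : R) * cst 1 z * cos (lin (fun=> 0) z + 0)) = fine (P A).
    have -> : P A = (\int[P]_z (\1_A z)%:E)%E by rewrite integral_indic// setIT.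
    apply: eq_Rintegral => z _; rewrite /lin big1 ?addr0 ?cos0 ?mulr1// => i _.
    by rewrite mul0r.
  rewrite !E => h.
  by rewrite -[LHS]fineK ?fin_num_measure// h fineK// fin_num_measure.
move: A mA; apply: smallest_sub; first exact: good_sigma_algebra.
move=> A; rewrite -bigcup_seq => -[/= i _ [B mB <-]]; rewrite setTI.
have : <<s @RGenOInfty.G R >> B.
  by have := @RGenOInfty.measurableE R; rewrite /measurable /= => <-.
suff : <<s @RGenOInfty.G R >> `<=`
    [set C | good (@tnth n R ^~ i @^-1` C)] by exact.
apply: smallest_sub; last by move=> _ [x ->]; exact: good_ray.
split.
- by rewrite /mkset preimage_set0; exact: good0.
- by move=> C gC; rewrite /mkset setTD preimage_setC; exact: goodC.
- move=> F gF; rewrite /mkset preimage_bigcup.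
  by have [_ _] := good_sigma_algebra; apply.
Qed.

End tuple_law_unique.

Section functionals.
Context (R : realType).
Implicit Types f : (nat -> R) -> R.

(** Functionals act on infinite sequences, so that the number of variables is a property and not a
    type index. *)
Definition local_functional n f :=
  forall z z' : nat -> R, (forall i, (i < n)%N -> z i = z' i) -> f z = f z'.

(** Measurability is expressed by composition with measurable families, which spares a sigma-algebra
    on sequences. *)
Definition measurable_functional f :=
  forall d (T : measurableType d) (U : nat -> T -> R),
    (forall i, measurable_fun setT (U i)) ->
    measurable_fun setT (fun x => f (fun i => U i x)).

End functionals.

(** [f] factors through the first [n] coordinates, whose joint laws coincide by [tuple_law_unique].
    Nonnegativity of [f] gives the change of variables without integrability. *)
Lemma law_transfer (R : realType) d1 (T1 : measurableType d1)
    (P1 : probability T1 R) d2 (T2 : measurableType d2) (P2 : probability T2 R)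
    n (U : nat -> T1 -> R) (V : nat -> T2 -> R) :
  (forall i, measurable_fun setT (U i)) -> (forall i, measurable_fun setT (V i)) ->
  (forall (a : nat -> R) c,
    \int[P1]_x cos (\sum_(i < n) a i * U i x + c) =
    \int[P2]_x cos (\sum_(i < n) a i * V i x + c)) ->
  forall f, local_functional n f -> measurable_functional f ->
  (forall z, 0 <= f z) ->
  (\int[P1]_x (f (fun i => U i x))%:E = \int[P2]_x (f (fun i => V i x))%:E)%E.
Proof.
move=> mU mV cosE f lf mf f0.
pose tup d (T : measurableType d) (W : nat -> T -> R) x : n.-tuple R :=
  [tuple W i x | i < n].
have mtup d (T : measurableType d) (W : nat -> T -> R) :
    (forall i, measurable_fun setT (W i)) -> measurable_fun setT (tup d T W).
  move=> mW; apply/measurable_fun_tnthP => i.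
  by rewrite (_ : _ \o _ = W i)//; apply/funext => x /=; rewrite tnth_mktuple.
have nthtup d (T : measurableType d) (W : nat -> T -> R) x i : (i < n)%N ->
    nth 0 (tup d T W x) i = W i x.
  move=> il; rewrite (_ : i = Ordinal il)// -tnth_nth tnth_mktuple//.
have mnth i : measurable_fun setT (fun t : n.-tuple R => nth 0 t i).
  have [il|li] := ltnP i n.
    have -> : (fun t : n.-tuple R => nth 0 t i) = @tnth n R ^~ (Ordinal il).
      by apply/funext => t; rewrite (tnth_nth 0).
    exact: measurable_tnth.
  have -> : (fun t : n.-tuple R => nth 0 t i) = cst 0.
    by apply/funext => t; rewrite nth_default// size_tuple.
  exact: measurable_cst.
have mF : measurable_fun setT (fun t : n.-tuple R => (f (fun i => nth 0 t i))%:E).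
  by apply/measurable_EFinP; exact: mf.
pose mu1mf := isMeasurableFun.Build _ _ _ _ _ (mtup _ _ _ mU).
pose X1 : {mfun T1 >-> n.-tuple R} := HB.pack (tup _ _ U) mu1mf.
pose mu2mf := isMeasurableFun.Build _ _ _ _ _ (mtup _ _ _ mV).
pose X2 : {mfun T2 >-> n.-tuple R} := HB.pack (tup _ _ V) mu2mf.
have push d (T : measurableType d) (P : probability T R) (W : nat -> T -> R)
    (X : {mfun T >-> n.-tuple R}) : (forall x, X x = tup _ _ W x) ->
    (\int[distribution P X]_t (f (fun i => nth 0 t i))%:E =
     \int[P]_x (f (fun i => W i x))%:E)%E.
  move=> XE; rewrite ge0_integral_distribution//=; last first.
    by move=> t; rewrite lee_fin.
  apply: eq_integral => x _; congr EFin; apply: lf => i il.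
  by rewrite XE nthtup.
rewrite -(push _ _ _ U X1)// -(push _ _ _ V X2)//.
apply: (@eq_measure_integral _ _ R setT (distribution P2 X2) (distribution P1 X1)).
move=> A mA _; apply: (@tuple_law_unique R n (distribution P1 X1) (distribution P2 X2)) => //.
(* Coefficients indexed by ['I_n] are extended by 0 to all of [nat]. *)
move=> a c; pose a' k := if insub k is Some i then a i else 0.
have a'E (i : 'I_n) : a i = a' i by rewrite /a' valK.
have pushc d (T : measurableType d) (P : probability T R) (W : nat -> T -> R)
    (X : {mfun T >-> n.-tuple R}) : (forall i, measurable_fun setT (W i)) ->
    (forall x, X x = tup _ _ W x) ->
    \int[distribution P X]_t cos (\sum_(i < n) a i * tnth t i + c) =
    \int[P]_x cos (\sum_(i < n) a' i * W i x + c).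
  move=> mW XE; rewrite /Rintegral; congr fine.
  have E x : \sum_(i < n) a i * tnth (X x) i = \sum_(i < n) a' i * W i x.
    by apply: eq_bigr => i _; rewrite XE tnth_mktuple a'E.
  rewrite integral_distribution//=.
  - by apply: eq_integral => x _ /=; rewrite E.
  - by apply/measurable_EFinP; apply: measurable_cos_comb => i; exact: measurable_tnth.
  - apply: (@integrable_bounded _ _ _ _ (fun x => cos (\sum_(i < n) a i * tnth (X x) i + c)) 1).
      under eq_fun do rewrite E.
      by apply: (@measurable_cos_comb _ _ _ _ (fun i => W (val i)) (fun i => a' (val i))).
    by move=> x; rewrite ler_norml cos_geN1 cos_le1.
by rewrite (pushc _ _ _ U)// (pushc _ _ _ V).
Qed.

Section centered_gaussian.
Context d (T : measurableType d) (R : realType) (P : probability T R).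
Implicit Types (Z : nat -> T -> R) (a : nat -> R).

(** The real form of the Gaussian characteristic function of every linear combination, degenerate
    ones included; the phases 0 and -pi/2 give its real and imaginary parts. *)
Definition centered_gaussian n Z := [/\ forall i, measurable_fun setT (Z i),
  forall i, P.-integrable setT (EFin \o (fun w => Z i w ^+ 2)) &
  forall a c, \int[P]_w cos (\sum_(i < n) a i * Z i w + c) =
    cos c * expR (- (\int[P]_w (\sum_(i < n) a i * Z i w) ^+ 2) / 2)].

Variables (n : nat) (Z : nat -> T -> R).
Hypothesis gZ : centered_gaussian n Z.

Let mZ i : measurable_fun setT (Z i). Proof. by case: gZ. Qed.
Let Z2 i : P.-integrable setT (EFin \o (fun w => Z i w ^+ 2)).
Proof. by case: gZ. Qed.

Let L a w := \sum_(i < n) a i * Z i w.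

Lemma measurable_comb a : measurable_fun setT (L a).
Proof. by apply: measurable_sum => i; exact: measurable_funM. Qed.

Lemma integrable_comb_mul a b :
  P.-integrable setT (EFin \o (fun w => L a w * L b w)).
Proof.
apply: (eq_integrable measurableT (EFin \o (fun w =>
    \sum_(i < n) \sum_(j < n) (a i * b j) * (Z i w * Z j w)))).
  move=> w _; rewrite /= /L big_distrlr/=; congr EFin.
  by apply: eq_bigr => i _; apply: eq_bigr => j _; ring.
apply: (@integrable_fsum _ _ _ P n (fun i w => \sum_(j < n) a i * b j * (Z i w * Z j w))) => i.
apply: (@integrable_fsum _ _ _ P n (fun j w => a i * b j * (Z i w * Z j w))) => j.
by apply: integrable_fZ; exact: integrable_mul_square.
Qed.

Lemma integrable_comb_sqr a : P.-integrable setT (EFin \o (fun w => L a w ^+ 2)).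
Proof.
by have := integrable_comb_mul a a; congr (P.-integrable setT (EFin \o _)).
Qed.

Lemma integral_comb_mul a b :
  \int[P]_w (L a w * L b w) = \sum_(i < n) \sum_(j < n) a i * b j * \int[P]_w (Z i w * Z j w).
Proof.
transitivity (\int[P]_w (\sum_(i < n) \sum_(j < n) (a i * b j) * (Z i w * Z j w))).
  apply: eq_Rintegral => w _; rewrite /L big_distrlr/=.
  by apply: eq_bigr => i _; apply: eq_bigr => j _; ring.
have I i j : P.-integrable setT (EFin \o (fun w => a i * b j * (Z i w * Z j w))).
  by apply: integrable_fZ; exact: integrable_mul_square.
rewrite (@Rintegral_sum _ _ _ P n (fun i w => \sum_(j < n) a i * b j * (Z i w * Z j w))).
  apply: eq_bigr => i _.
  rewrite (@Rintegral_sum _ _ _ P n (fun j w => a i * b j * (Z i w * Z j w)))//.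
  by apply: eq_bigr => j _; rewrite RintegralZl//; exact: integrable_mul_square.
by move=> i; apply: (@integrable_fsum _ _ _ P n (fun j w => a i * b j * (Z i w * Z j w))).
Qed.

Local Notation PP := (P \x P)%E.

(** By Fubini, the inner integral is the one-copy formula with phase [L a w + c]; the exponents then
    add. *)
Lemma gaussian_pair_char a b c :
  \int[PP]_x cos (L a x.1 + L b x.2 + c) =
  cos c * expR (- (\int[P]_w L a w ^+ 2 + \int[P]_w L b w ^+ 2) / 2).
Proof.
have mcos : measurable_fun setT (fun x : T * T => cos (L a x.1 + L b x.2 + c)).
  apply: measurableT_comp; first exact: (continuous_measurable_fun (@continuous_cos R)).
  apply: measurable_funD => //; apply: measurable_funD.
    by apply: measurableT_comp => //; exact: measurable_comb.
  by apply: measurableT_comp => //; exact: measurable_comb.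
have icos : PP.-integrable setT (EFin \o (fun x : T * T => cos (L a x.1 + L b x.2 + c))).
  by apply: (@integrable_bounded _ _ _ PP _ 1) => // x; rewrite ler_norml cos_geN1 cos_le1.
case: gZ => _ _ ch.
rewrite /Rintegral -(integral12_prod_meas1 icos).
transitivity (\int[P]_w (cos (L a w + c) * expR (- (\int[P]_w L b w ^+ 2) / 2))).
  congr fine; apply: eq_integral => w _; rewrite /fubini_F /=.
  rewrite -[RHS](congr1 EFin (ch b (L a w + c))) fineK.
    by apply: eq_integral => w' _; congr (cos _)%:E; rewrite -/(L b w'); ring.
  apply: integrable_fin_num => //.
  apply: (@integrable_bounded _ _ _ P (fun w' => cos (L b w' + (L a w + c))) 1).
    apply: measurableT_comp; first exact: (continuous_measurable_fun (@continuous_cos R)).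
    by apply: measurable_funD => //; exact: measurable_comb.
  by move=> w'; rewrite ler_norml cos_geN1 cos_le1.
rewrite RintegralZr//; last first.
  apply: (@integrable_bounded _ _ _ P (fun w' => cos (L a w' + c)) 1).
    apply: measurableT_comp; first exact: (continuous_measurable_fun (@continuous_cos R)).
    by apply: measurable_funD => //; exact: measurable_comb.
  by move=> w'; rewrite ler_norml cos_geN1 cos_le1.
rewrite ch -mulrA -expRD; by rewrite -mulrDl -opprD.
Qed.

End centered_gaussian.

(** * Gaussian concentration *)

Lemma sqr_sum_le (R : realType) n (a : nat -> R) :
  (\sum_(i < n) a i) ^+ 2 <= n%:R * \sum_(i < n) a i ^+ 2.
Proof.
elim: n => [|n ih]; first by rewrite !big_ord0 expr0n mulr0.
rewrite !big_ord_recr/= -natr1.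
have Q0 : 0 <= \sum_(i < n) a i ^+ 2 by apply: sumr_ge0 => i _; exact: sqr_ge0.
move: ih Q0; set S := \sum_(i < n) a i; set Q := \sum_(i < n) _ => ih Q0.
have [n0|n0] := eqVneq n 0%N.
  by rewrite /S /Q n0 !big_ord0 !add0r mul1r.
have N0 : 0 < n%:R :> R by rewrite ltr0n lt0n.
rewrite -(ler_pM2l N0).
by have := sqr_ge0 (S - n%:R * a n); nra.
Qed.

Lemma lipschitz1_bound (R : realType) (f f' : R -> R) (x : R) :
  (forall y, is_derive y (1 : R) f (f' y)) -> (forall y, `|f' y| <= 1) ->
  `|f x - f 0| <= `|x|.
Proof.
move=> df f'1.
have cf a b : {within `[a, b], continuous f}.
  apply: continuous_subspaceT => y.
  by apply/differentiable_continuous/derivable1_diffP; have [] := df y.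
have [x0|x0|->] := ltrgt0P x.
- have [c _ ->] := MVT x0 (fun y _ => df y) (cf _ _).
  by rewrite normrM subr0 (gtr0_norm x0) ler_piMl// ltW.
- have [c _] := MVT x0 (fun y _ => df y) (cf _ _).
  rewrite distrC => ->.
  by rewrite normrM sub0r normrN (ltr0_norm x0) ler_piMl// oppr_ge0 ltW.
- by rewrite subrr normr0.
Qed.

Section product_toolbox.
Context d (T : measurableType d) (R : realType) (P : probability T R).
Local Notation PP := (P \x P)%E.

Lemma integrable_fst (g : T -> R) : P.-integrable setT (EFin \o g) ->
  PP.-integrable setT (EFin \o (fun x : T * T => g x.1)).
Proof.
move=> gi; have mg : measurable_fun setT g.
  by apply/measurable_EFinP; exact: measurable_int gi.
apply/integrable12ltyP => /=.
  by apply/measurable_EFinP; exact: measurableT_comp.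
under eq_integral do rewrite integral_cst//= [X in (_ * X)%E](probability_setT P) mule1.
by have /integrableP[] := gi.
Qed.

Lemma integrable_snd (g : T -> R) : P.-integrable setT (EFin \o g) ->
  PP.-integrable setT (EFin \o (fun x : T * T => g x.2)).
Proof.
move=> gi; have mg : measurable_fun setT g.
  by apply/measurable_EFinP; exact: measurable_int gi.
apply/integrable21ltyP => /=.
  by apply/measurable_EFinP; exact: measurableT_comp.
under eq_integral do rewrite integral_cst//= [X in (_ * X)%E](probability_setT P) mule1.
by have /integrableP[] := gi.
Qed.

Lemma integrable_sqr_sum (n : nat) (F : nat -> T -> R) :
  (forall i, measurable_fun setT (F i)) ->
  (forall i, P.-integrable setT (EFin \o (fun x => F i x ^+ 2))) ->
  P.-integrable setT (EFin \o (fun x => (\sum_(i < n) F i x) ^+ 2)).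
Proof.
move=> mF Fi.
apply: (@integrable_dominated _ _ _ _ _ (fun x => n%:R * \sum_(i < n) F i x ^+ 2)).
- by apply: measurable_funX; apply: measurable_sum.
- by move=> x; rewrite ger0_norm ?sqr_ge0//; exact: (@sqr_sum_le R n (fun i => F i x)).
- apply: integrable_fZ.
  exact: (@integrable_fsum _ _ _ P n (fun i x => F i x ^+ 2)).
Qed.

(** Chebyshev's inequality, with the variance replaced by an integral over two independent copies,
    the quantity that the rotation argument bounds. *)
Lemma chebyshev_copy (X : T -> R) (K c : R) : measurable_fun setT X ->
  (forall w, `|X w| <= K) -> 0 < c -> c <= \int[P]_w X w ->
  (P [set w | (X w <= c / 2)%R] * ((c / 2) ^+ 2)%:E <=
   \int[PP]_x ((X x.1 - X x.2) ^+ 2)%:E)%E.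
Proof.
move=> mX XK c0 cm; set m := \int[P]_w X w in cm.
have Xi : P.-integrable setT (EFin \o X) by exact: integrable_bounded XK.
set A := [set w | X w <= c / 2]; have mA : measurable A.
  rewrite (_ : A = X @^-1` `]-oo, (c / 2)]); last first.
    by apply/seteqP; split => w /=; rewrite in_itv.
  by rewrite -[_ @^-1` _]setTI; exact: mX.
rewrite fubini_tonelli1//; last 2 first.
- apply/measurable_EFinP; apply: measurable_funX; apply: measurable_funB;
    exact: measurableT_comp.
- by move=> x; rewrite lee_fin sqr_ge0.
have -> : P A = (\int[P]_w (\1_A w)%:E)%E by rewrite integral_indic// setIT.
rewrite muleC -ge0_integralZl//; last 2 first.
- by apply/measurable_EFinP; exact: measurable_indic.
- by rewrite lee_fin sqr_ge0.
have msq (u : R) : measurable_fun setT (fun w => (u - X w) ^+ 2).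
  by apply: measurable_funX; exact: measurable_funB.
apply: ge0_le_integral => //.
- by move=> w _; rewrite mule_ge0// lee_fin ?sqr_ge0.
- by apply/measurable_EFinP; apply: measurable_funM => //; exact: measurable_indic.
- apply: measurable_fun_fubini_tonelli_F => //.
    by apply/measurable_EFinP; apply: measurable_funX; apply: measurable_funB;
      exact: measurableT_comp.
  by move=> x; rewrite lee_fin sqr_ge0.
move=> w _; rewrite /fubini_F /= -EFinM.
have sqi (u : R) : P.-integrable setT (EFin \o (fun w' => (u - X w') ^+ 2)).
  apply: (@integrable_bounded _ _ _ _ _ ((`|u| + K) ^+ 2)) => //.
  move=> w'; rewrite normrX lerXn2r ?nnegrE//.
    by rewrite addr_ge0//; apply: le_trans (XK w').
  by apply: le_trans (ler_normB _ _) _; rewrite lerD2l.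
(* Jensen's inequality through the tangent bound v^2 >= 2 u v - u^2, with u = X w - m and v = X w -
   X w', integrated in w'. *)
have h : (X w - m) ^+ 2 <= \int[P]_w' ((X w - X w') ^+ 2).
  have -> : (X w - m) ^+ 2 = \int[P]_w' (2 * (X w - m) * (X w - X w') - (X w - m) ^+ 2).
    rewrite RintegralB//; last 2 first.
    - apply: integrable_fZ; apply: integrable_fB => //; exact: integrable_fcst.
    - exact: integrable_fcst.
    rewrite RintegralZl//; last by apply: integrable_fB => //; exact: integrable_fcst.
    rewrite RintegralB//; last exact: integrable_fcst.
    by rewrite !Rintegral_probability_cst -/m; ring.
  apply: le_Rintegral => //.
  - apply: integrable_fB; last exact: integrable_fcst.
    by apply: integrable_fZ; apply: integrable_fB => //; exact: integrable_fcst.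
  - move=> w' _; have := sqr_ge0 ((X w - X w') - (X w - m)); nra.
rewrite -[leRHS]fineK; last by apply: integrable_fin_num => //; exact: sqi.
rewrite lee_fin.
apply: le_trans h; rewrite indicE.
have [/set_mem wA|_] := boolP (_ \in _); last by rewrite mulr0 sqr_ge0.
have {}wA : X w <= c / 2 := wA.
by rewrite mulr1 -[leRHS]sqrrN opprB lerXn2r ?nnegrE//; lra.
Qed.

End product_toolbox.

(** * Poincare inequality by rotation of two independent copies *)

Section gaussian_variance.
Context d (T : measurableType d) (R : realType) (P : probability T R).
Variables (n : nat) (Z : nat -> T -> R).
Hypothesis gZ : centered_gaussian P n Z.
Local Notation PP := (P \x P)%E.

Let mZ i : measurable_fun setT (Z i). Proof. by case: gZ. Qed.
Let Z2 i : P.-integrable setT (EFin \o (fun w => Z i w ^+ 2)).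
Proof. by case: gZ. Qed.

(** [rot'] is the derivative of [rot] in the angle; [glue] lists both as one family of 2n
    variables. *)
Let rot t (x : T * T) i := cos t * Z i x.1 + sin t * Z i x.2.
Let rot' t (x : T * T) i := - sin t * Z i x.1 + cos t * Z i x.2.
Let glue (u v : nat -> R) k := if (k < n)%N then u k else v (k - n)%N.

Let mrot t i : measurable_fun setT (fun x => rot t x i).
Proof.
by apply: measurable_funD; apply: measurable_funM => //; exact: measurableT_comp.
Qed.

Let mrot' t i : measurable_fun setT (fun x => rot' t x i).
Proof.
by apply: measurable_funD; apply: measurable_funM => //; exact: measurableT_comp.
Qed.

Let sum_glue (a u v : nat -> R) :
  \sum_(k < n + n) a k * glue u v k =
  \sum_(i < n) a i * u i + \sum_(i < n) a (n + i)%N * v i.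
Proof.
rewrite big_split_ord/=; congr (_ + _); apply: eq_bigr => i _.
  by rewrite /glue ltn_ord.
by rewrite /glue -ltn_subRL subnn ltn0 addKn.
Qed.

(** A rotation of the pair amounts to a rotation of the pairs of coefficients, which leaves the sum
    of the two variances unchanged because cos^2 + sin^2 = 1. Hence the characteristic functionals
    agree. *)
Lemma rotation_invariance t (g : (nat -> R) -> R) :
  local_functional (n + n) g -> measurable_functional g -> (forall z, 0 <= g z) ->
  \int[PP]_x g (glue (rot t x) (rot' t x)) = \int[PP]_x g (glue (rot 0 x) (rot' 0 x)).
Proof.
move=> lg mg g0; congr fine.
have char s (a : nat -> R) c :
    \int[PP]_x cos (\sum_(k < n + n) a k * glue (rot s x) (rot' s x) k + c) =
    cos c * expR (- (\int[P]_w (\sum_(i < n) a i * Z i w) ^+ 2 +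
                     \int[P]_w (\sum_(i < n) a (n + i)%N * Z i w) ^+ 2) / 2).
  pose al i := cos s * a i - sin s * a (n + i)%N.
  pose be i := sin s * a i + cos s * a (n + i)%N.
  transitivity (cos c * expR (- (\int[P]_w (\sum_(i < n) al i * Z i w) ^+ 2 +
                     \int[P]_w (\sum_(i < n) be i * Z i w) ^+ 2) / 2)).
    rewrite -(gaussian_pair_char gZ); apply: eq_Rintegral => x _.
    congr (cos (_ + _)); rewrite sum_glue -!big_split/=.
    by apply: eq_bigr => i _; rewrite /rot /rot' /al /be; ring.
  congr (_ * expR (- _ / 2)).
  rewrite -!RintegralD//; try exact: (integrable_comb_sqr gZ).
  - apply: eq_Rintegral => w _.
    have -> : \sum_(i < n) al i * Z i w = cos s * (\sum_(i < n) a i * Z i w) -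
        sin s * (\sum_(i < n) a (n + i)%N * Z i w).
      rewrite !mulr_sumr -sumrB; apply: eq_bigr => i _; rewrite /al; ring.
    have -> : \sum_(i < n) be i * Z i w = sin s * (\sum_(i < n) a i * Z i w) +
        cos s * (\sum_(i < n) a (n + i)%N * Z i w).
      rewrite !mulr_sumr -big_split/=; apply: eq_bigr => i _; rewrite /be; ring.
    set A := \sum_(i < n) _; set B := \sum_(i < n) _.
    rewrite -[RHS]mul1r -(cos2Dsin2 s); ring.
  - exact: (integrable_comb_sqr gZ (fun i => a (n + i)%N)).
have mglue s k : measurable_fun setT (fun x => glue (rot s x) (rot' s x) k).
  by rewrite /glue; case: (k < n)%N; [exact: mrot|exact: mrot'].
apply: (@law_transfer R _ _ PP _ _ PP (n + n) (fun k x => glue (rot t x) (rot' t x) k)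
  (fun k x => glue (rot 0 x) (rot' 0 x) k)) => //.
by move=> a c; rewrite !char.
Qed.

Variables (f : (nat -> R) -> R) (p : (nat -> R) -> nat -> R) (K C l : R).
Hypotheses (lf : local_functional n f) (mf : measurable_functional f)
  (fK : forall z, `|f z| <= K)
  (fC : forall z z', `|f z - f z'| <= C * \sum_(i < n) `|z i - z' i|)
  (df : forall z v, is_derive (0 : R) (1 : R)
    (fun e => f (fun i => cos e * z i + sin e * v i)) (\sum_(i < n) p z i * v i))
  (pl : forall z i, (i < n)%N -> `|p z i| <= l)
  (posZ : forall i j, (i < n)%N -> (j < n)%N -> 0 <= \int[P]_w (Z i w * Z j w)).

Let Phi t x := f (rot t x).

Let mPhi t : measurable_fun setT (Phi t). Proof. by apply: mf => i; exact: mrot. Qed.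

Let iPhi s t : PP.-integrable setT (EFin \o (fun x => (Phi s x - Phi t x) ^+ 2)).
Proof.
apply: (@integrable_bounded _ _ _ PP _ ((K + K) ^+ 2)).
  by apply: measurable_funX; exact: measurable_funB.
move=> x; have K0 : 0 <= K by apply: le_trans (fK (rot s x)).
rewrite normrX lerXn2r ?nnegrE ?addr_ge0//.
by apply: le_trans (ler_normB _ _) _; apply: lerD; exact: fK.
Qed.

(* As in Maurey and Pisier, f(Z) - f(Z') telescopes along N + 1 rotations of the
   pair (Z, Z') by the angle pi / (2 (N + 1)), whose increments all have the same
   law; then N tends to infinity. *)
Let stationary s e : \int[PP]_x ((Phi (s + e) x - Phi s x) ^+ 2) =
  \int[PP]_x ((Phi e x - Phi 0 x) ^+ 2).
Proof.
(* By the addition formulas, [rot (s + e)] is cos e times [rot s] plus sin e times [rot' s]: the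
   increment is a function of a pair whose law does not depend on [s]. *)
pose g (z : nat -> R) := (f (fun i => cos e * z i + sin e * z (n + i)%N) - f z) ^+ 2.
have gE t x : g (glue (rot t x) (rot' t x)) = (Phi (t + e) x - Phi t x) ^+ 2.
  congr ((_ - _) ^+ 2); apply: lf => i il.
    rewrite /glue il -ltn_subRL subnn ltn0 addKn /rot /rot' cosD sinD; ring.
  by rewrite /glue il.
transitivity (\int[PP]_x g (glue (rot s x) (rot' s x))).
  by apply: eq_Rintegral => x _; rewrite gE.
transitivity (\int[PP]_x g (glue (rot 0 x) (rot' 0 x))); last first.
  by apply: eq_Rintegral => x _; rewrite gE add0r.
apply: rotation_invariance.
- move=> z z' zz'; congr ((_ - _) ^+ 2); apply: lf => i il.
    by rewrite zz' ?ltn_addr// zz' ?ltn_add2l.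
  by rewrite zz'// ltn_addr.
- move=> d' T' U mU; apply: measurable_funX; apply: measurable_funB; last by apply: mf.
  by apply: mf => i; apply: measurable_funD; exact: measurable_funM.
- by move=> z; exact: sqr_ge0.
Qed.

(** Cauchy-Schwarz on N + 1 telescoping terms costs a factor N + 1, and stationarity makes the N + 1
    squared integrals equal; together they give the factor N + 1 inside the square. *)
Let chain N : \int[PP]_x ((f (fun i => Z i x.1) - f (fun i => Z i x.2)) ^+ 2) <=
  \int[PP]_x ((N.+1%:R * (Phi (pi / 2 / N.+1%:R) x - Phi 0 x)) ^+ 2).
Proof.
set e := pi / 2 / N.+1%:R.
have Phi0 x : Phi 0 x = f (fun i => Z i x.1).
  by apply: lf => i _; rewrite /rot cos0 sin0 mul1r mul0r addr0.
have Phi1 x : Phi (N.+1%:R * e) x = f (fun i => Z i x.2).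
  apply: lf => i _; rewrite /rot (_ : _ * e = pi / 2); last by rewrite /e mulrC divfK.
  by rewrite cos_pihalf sin_pihalf mul1r mul0r add0r.
pose D (k : nat) x := Phi (k%:R * e + e) x - Phi (k%:R * e) x.
have tele x : f (fun i => Z i x.2) - f (fun i => Z i x.1) = \sum_(k < N.+1) D k x.
  rewrite -Phi0 -Phi1; elim: N.+1 => [|M ih].
    by rewrite big_ord0 mul0r subrr.
  by rewrite big_ord_recr/= -ih /D -natr1 mulrDl mul1r; ring.
have iD k : PP.-integrable setT (EFin \o (fun x => D k x ^+ 2)) by exact: iPhi.
apply: (@le_trans _ _ (\int[PP]_x (N.+1%:R * \sum_(k < N.+1) D k x ^+ 2))).
  apply: le_Rintegral => //.
  - apply: eq_integrable (iPhi 0 (N.+1%:R * e)) => // x _ /=.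
    by rewrite Phi0 Phi1.
  - by apply: integrable_fZ; exact: (@integrable_fsum _ _ _ PP N.+1 (fun k x => D k x ^+ 2)).
  - move=> x _; rewrite -sqrrN opprB tele.
    exact: (@sqr_sum_le R N.+1 (fun k => D k x)).
rewrite RintegralZl//; last exact: (@integrable_fsum _ _ _ PP N.+1 (fun k x => D k x ^+ 2)).
rewrite (@Rintegral_sum _ _ _ PP N.+1 (fun k x => D k x ^+ 2))//.
under eq_bigr do rewrite stationary.
rewrite sumr_const card_ord -[X in _ * X <= _]mulr_natr.
under [leRHS]eq_Rintegral do rewrite exprMn.
rewrite RintegralZl//.
by rewrite [X in _ * X <= _]mulrC mulrA -expr2.
Qed.

Let grad (x : T * T) := \sum_(i < n) p (fun i => Z i x.1) i * Z i x.2.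

(** The angle is (pi/2)/(N + 1), so the rescaled increment tends to pi/2 times the derivative at
    angle 0, which pairs the gradient at the first copy with the second copy. *)
Let slope_cvg x : (N.+1%:R * (Phi (pi / 2 / N.+1%:R) x - Phi 0 x)) @[N --> \oo] -->
  pi / 2 * grad x.
Proof.
have [dx dE] := df (fun i => Z i x.1) (fun i => Z i x.2).
have c0 : (fun N : nat => pi / 2 / N.+1%:R : R) @ \oo --> (0 : R).
  rewrite -[X in _ --> X](mulr0 (pi / 2)); apply: cvgM; first exact: cvg_cst.
  exact: cvg_harmonic.
have h0 N : pi / 2 / N.+1%:R != 0 :> R.
  by rewrite !mulf_neq0 ?invr_neq0 ?gt_eqF ?pi_gt0.
move: dx; rewrite /derivable => /cvg_ex[l0 hl].
have l0E : l0 = grad x by rewrite /grad -dE; apply/esym/cvg_lim.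
move: hl => /cvgr_dnbhsP /(_ _ (conj h0 c0)); rewrite l0E => hl.
pose w N := (pi / 2 / N.+1%:R)^-1 * (Phi (pi / 2 / N.+1%:R) x - Phi 0 x).
have hw : w N @[N --> \oo] --> grad x.
  by move: hl; under eq_fun do rewrite /GRing.scale /= mulr1 addr0.
have -> : (fun N => N.+1%:R * (Phi (pi / 2 / N.+1%:R) x - Phi 0 x)) =
    (fun N => pi / 2 * w N).
  apply/funext => N; rewrite /w mulrA; congr (_ * _).
  by rewrite [in RHS]invfM invrK mulrA divff ?mul1r// gt_eqF// divr_gt0 ?pi_gt0.
by apply: cvgM; [exact: cvg_cst|exact: hw].
Qed.

Let S (x : T * T) := \sum_(i < n) (`|Z i x.1| + `|Z i x.2|).

Let slope_bound N x :
  `|N.+1%:R * (Phi (pi / 2 / N.+1%:R) x - Phi 0 x)| <= C * (pi / 2) * S x.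
Proof.
set e := pi / 2 / N.+1%:R.
have e0 : 0 <= e by rewrite !divr_ge0 ?pi_ge0.
have ce : `|cos e - 1| <= e.
  rewrite -cos0 -[leRHS]ger0_norm//.
  apply: (@lipschitz1_bound R cos (fun y => - sin y)).
  by move=> y; rewrite normrN ler_norml sin_geN1 sin_le1.
have se : `|sin e| <= e.
  rewrite -[sin e]subr0 -{1}sin0 -[leRHS]ger0_norm//.
  apply: (@lipschitz1_bound R sin cos).
  by move=> y; rewrite ler_norml cos_geN1 cos_le1.
(* The Lipschitz bound forces [C >= 0] unless there are no coordinates, when the bound is
   trivial. *)
have C0 : 0 <= C \/ n = 0%N.
  have [->|n0] := eqVneq n 0%N; [by right|left].
  have := fC (fun=> 1) (fun=> 0); rewrite subr0 normr1 sumr_const card_ord => h.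
  have n1 : 0 < n%:R :> R by rewrite ltr0n lt0n.
  by rewrite -(pmulr_lge0 _ n1); apply: le_trans h.
rewrite normrM ger0_norm//.
have -> : C * (pi / 2) * S x = N.+1%:R * (C * (e * S x)).
  by rewrite /e; field; rewrite ?ltr0n.
rewrite ler_wpM2l//; apply: le_trans (fC _ _) _.
case: C0 => [C0|n0]; last by rewrite /S n0 !big_ord0 !mulr0.
rewrite ler_wpM2l// /S mulr_sumr; apply: ler_sum => i _.
rewrite /rot cos0 sin0 mul1r mul0r addr0 addrAC -{2}[Z i x.1]mul1r -mulrBl.
rewrite mulrDr; apply: le_trans (ler_normD _ _) _.
by rewrite !normrM lerD// ler_wpM2r.
Qed.

Let mgrad : measurable_fun setT (fun x => pi / 2 * grad x).
Proof.
apply: (@measurable_fun_cvg _ _ _ _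
  (fun N x => N.+1%:R * (Phi (pi / 2 / N.+1%:R) x - Phi 0 x))).
  by move=> N; apply: measurable_funM => //; exact: measurable_funB.
by move=> x _; exact: slope_cvg.
Qed.

Let iS2 : PP.-integrable setT (EFin \o (fun x => S x ^+ 2)).
Proof.
apply: (@integrable_sqr_sum _ _ _ PP n (fun i x => `|Z i x.1| + `|Z i x.2|)).
  move=> i; apply: measurable_funD; do 2 apply: measurableT_comp => //.
move=> i; apply: (@integrable_dominated _ _ _ PP _
    (fun x => 2 * (Z i x.1 ^+ 2 + Z i x.2 ^+ 2))).
- apply: measurable_funX; apply: measurable_funD; do 2 apply: measurableT_comp => //.
- move=> x; rewrite ger0_norm ?sqr_ge0//.
  rewrite -(real_normK (num_real (Z i x.1))) -(real_normK (num_real (Z i x.2))).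
  by have := sqr_ge0 (`|Z i x.1| - `|Z i x.2|); nra.
- apply: integrable_fZ; apply: integrable_fD.
    exact: (integrable_fst (Z2 i)).
  exact: (integrable_snd (Z2 i)).
Qed.

(** Dominated convergence turns the chained increments into pi/2 times the gradient at Z paired with
    a copy Z'. For fixed Z its variance is the sum of p_i p_j Cov(Z_i, Z_j), and nonnegative
    covariances allow each p_i p_j to be replaced by l^2, which leaves the variance of the total
    sum. *)
Lemma gaussian_variance_le :
  (\int[PP]_x ((f (fun i => Z i x.1) - f (fun i => Z i x.2)) ^+ 2)%:E <=
  ((pi / 2) ^+ 2 * (l ^+ 2 * \int[P]_w (\sum_(i < n) Z i w) ^+ 2))%:E)%E.
Proof.
have h : (\int[PP]_x ((N.+1%:R * (Phi (pi / 2 / N.+1%:R) x - Phi 0 x)) ^+ 2)%:E)%E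
    @[N --> \oo] --> (\int[PP]_x ((pi / 2 * grad x) ^+ 2)%:E)%E.
  apply: (@dominated_cvg _ _ _ PP setT measurableT _ _
    (fun x => ((C * (pi / 2)) ^+ 2 * S x ^+ 2)%:E)) => //.
  - move=> N; apply/measurable_EFinP; apply: measurable_funX.
    by apply: measurable_funM => //; exact: measurable_funB.
  - move=> x _; apply: cvg_EFin; first exact: nearW.
    by apply: cvgM; exact: slope_cvg.
  - exact: integrable_fZ.
  - move=> N x _; rewrite lee_fin ger0_norm ?sqr_ge0// -exprMn.
    rewrite -(real_normK (num_real (_ * (_ - _)))).
    by rewrite lerXn2r ?nnegrE// (le_trans _ (slope_bound N x)).
set I0 := (X in (X <= _)%E).
have I0E : I0 = (\int[PP]_x ((f (fun i => Z i x.1) - f (fun i => Z i x.2)) ^+ 2))%:E.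
  rewrite fineK// integrable_fin_num//.
  apply: eq_integrable (iPhi 0 (pi / 2)) => // x _ /=; congr ((_ - _) ^+ 2)%:E.
    by apply: lf => i _; rewrite /rot cos0 sin0 mul1r mul0r addr0.
  by apply: lf => i _; rewrite /rot cos_pihalf sin_pihalf mul1r mul0r add0r.
apply: (@le_trans _ _ (\int[PP]_x ((pi / 2 * grad x) ^+ 2)%:E)%E).
  apply: (cvge_to_ge h); apply: nearW => N.
  have := chain N; rewrite -lee_fin -I0E => /le_trans; apply.
  rewrite fineK// integrable_fin_num//.
  have := integrable_fZ (N.+1%:R ^+ 2) (iPhi (pi / 2 / N.+1%:R) 0).
  by apply: eq_integrable => // x _ /=; rewrite exprMn.
rewrite fubini_tonelli1//; last 2 first.
- by apply/measurable_EFinP; exact: measurable_funX.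
- by move=> x; rewrite lee_fin sqr_ge0.
set B := (X in (_ <= X%:E)%E).
have -> : B%:E = (\int[P]_w B%:E)%E.
  by rewrite integral_cst//= [X in (_ * X)%E](probability_setT P) mule1.
apply: ge0_le_integral => //.
- by move=> w _; apply: integral_ge0 => w' _; rewrite lee_fin sqr_ge0.
- apply: measurable_fun_fubini_tonelli_F => //.
    by apply/measurable_EFinP; exact: measurable_funX.
  by move=> x; rewrite lee_fin sqr_ge0.
move=> w _; rewrite /fubini_F /grad /=.
pose a := p (fun i => Z i w).
have ia := integrable_comb_sqr gZ a.
under eq_integral do rewrite exprMn.
rewrite -[leLHS]fineK; last first.
  by rewrite integrable_fin_num//; exact: (integrable_fZ ((pi / 2) ^+ 2) ia).
rewrite lee_fin /B -[leLHS]/(\int[P]_w' ((pi / 2) ^+ 2 *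
  (\sum_(i < n) a i * Z i w') ^+ 2)) RintegralZl// ler_wpM2l ?sqr_ge0//.
have -> : \int[P]_w' (\sum_(i < n) a i * Z i w') ^+ 2 =
    \sum_(i < n) \sum_(j < n) a i * a j * \int[P]_w (Z i w * Z j w).
  by rewrite -(integral_comb_mul gZ); apply: eq_Rintegral => w' _; rewrite expr2.
have -> : \int[P]_w' (\sum_(i < n) Z i w') ^+ 2 =
    \sum_(i < n) \sum_(j < n) \int[P]_w (Z i w * Z j w).
  have := integral_comb_mul gZ (fun=> 1) (fun=> 1).
  under [in X in _ = X -> _]eq_bigr do under eq_bigr do rewrite !mul1r.
  move=> <-; apply: eq_Rintegral => w' _; rewrite expr2.
  by congr (_ * _); apply: eq_bigr => i _; rewrite mul1r.
rewrite mulr_sumr; apply: ler_sum => i _; rewrite mulr_sumr; apply: ler_sum => j _.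
rewrite ler_wpM2r ?posZ//; apply: le_trans (ler_norm _) _.
by rewrite normrM expr2 ler_pM ?pl.
Qed.

End gaussian_variance.

(** * The Euler scheme *)

Section euler_scheme.
Context (R : realType).
Variables (b : R -> R) (dl : R).

(** The scheme starts at 0 whatever the initial value of the solution, since the contraction forgets
    the difference. *)
Fixpoint euler (z : nat -> R) k :=
  if k is k'.+1 then euler z k' + dl * b (euler z k') + z k' else 0.

Lemma euler_local k : local_functional k (euler^~ k).
Proof.
elim: k => [//|k ih] z z' zz' /=.
by rewrite (ih z z') ?zz'// => i ik; rewrite zz'// ltnS ltnW.
Qed.

Variables (b' : R -> R) (M L : R).
Hypotheses (M0 : 0 < M) (dl0 : 0 < dl) (dlL : dl * L <= 1)
  (db : forall x, is_derive x (1 : R) b (b' x))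
  (bM : forall x, b' x <= - M) (bL : forall x, - L <= b' x).

Lemma derive_continuous (f f' : R -> R) :
  (forall x, is_derive x (1 : R) f (f' x)) -> continuous f.
Proof.
move=> df x; apply/differentiable_continuous/derivable1_diffP.
by have [] := df x.
Qed.

Lemma euler_measurable k : measurable_functional (euler^~ k).
Proof.
move=> d T U mU; elim: k => [|k ih] /=; first exact: measurable_cst.
apply: measurable_funD => //; apply: measurable_funD => //.
apply: measurable_funM => //; apply: measurableT_comp => //.
by apply: continuous_measurable_fun; exact: (derive_continuous db).
Qed.

Lemma contraction_ratio : 0 <= 1 - dl * M <= 1.
Proof.
have ML : M <= L by rewrite -lerN2; exact: le_trans (bL 0) (bM 0).
have : dl * M <= dl * L by rewrite ler_pM2l.
have := mulr_gt0 dl0 M0; move: dlL; lra.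
Qed.

Lemma drift_derivative_bound c : - (dl * L) <= dl * b' c <= - (dl * M).
Proof. by rewrite -!mulrN !ler_pM2l// bL bM. Qed.

(** The mean value theorem applied to [b]. With [dl * L <= 1] the slope is nonnegative, so one step
    is monotone; the lower slope later keeps the response to the noise away from 0. *)
Lemma drift_slope x y : exists s, [/\ 1 - dl * L <= s, s <= 1 - dl * M &
  x + dl * b x - (y + dl * b y) = s * (x - y)].
Proof.
have slope u v : u < v -> exists c, b v - b u = b' c * (v - u).
  move=> uv; have [c _ ->] := MVT uv (fun y _ => db y)
    (continuous_subspaceT (derive_continuous db)).
  by exists c.
have bnd c : 1 - dl * L <= 1 + dl * b' c /\ 1 + dl * b' c <= 1 - dl * M.
  by case/andP: (drift_derivative_bound c); split; lra.
have [xy|xy|->] := ltgtP x y.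
- have [c h] := slope _ _ xy; exists (1 + dl * b' c); have [h1 h2] := bnd c.
  split=> //; transitivity (- ((y - x) + dl * (b y - b x))); first by ring.
  by rewrite h; ring.
- have [c h] := slope _ _ xy; exists (1 + dl * b' c); have [h1 h2] := bnd c.
  split=> //; transitivity ((x - y) + dl * (b x - b y)); first by ring.
  by rewrite h; ring.
- by exists (1 + dl * b' 0); have [h1 h2] := bnd 0; split => //; rewrite !subrr mulr0.
Qed.

Lemma drift_contraction x y :
  `|x + dl * b x - (y + dl * b y)| <= (1 - dl * M) * `|x - y|.
Proof.
have [s [s1 s2 ->]] := drift_slope x y.
rewrite normrM ler_wpM2r// ger0_norm//; apply: le_trans s1.
by rewrite subr_ge0.
Qed.

Lemma euler_lipschitz k z z' :
  `|euler z k - euler z' k| <= \sum_(i < k) `|z i - z' i|.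
Proof.
elim: k => [|k ih] /=; first by rewrite big_ord0 subrr normr0.
rewrite big_ord_recr/= opprD addrACA; apply: le_trans (ler_normD _ _) _.
rewrite lerD2r; apply: le_trans (drift_contraction _ _) _; apply: le_trans ih.
by rewrite ler_piMl//; case/andP: contraction_ratio.
Qed.

(** The partial derivative of [euler z k] in [z i]: the increment [i] enters at time i + 1 undamped,
    and each later step multiplies its effect by 1 + dl b'. *)
Definition sensitivity (z : nat -> R) k i : R :=
  if (i < k)%N then \prod_(i.+1 <= j < k) (1 + dl * b' (euler z j)) else 0.

Lemma sensitivity_bound z k i : (i < k)%N ->
  0 <= sensitivity z k i <= (1 - dl * M) ^+ (k - i.+1).
Proof.
move=> ik; rewrite /sensitivity ik.
have bnd c : 0 <= 1 + dl * b' c <= 1 - dl * M.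
  by case/andP: (drift_derivative_bound c); move: dlL => *; apply/andP; split; lra.
apply/andP; split; first by apply: prodr_ge0 => j _; case/andP: (bnd (euler z j)).
apply: (@le_trans _ _ (\prod_(i.+1 <= j < k) (1 - dl * M))).
  by apply: ler_prod => j _; exact: bnd.
by rewrite prodr_const_nat.
Qed.

(** [sensitivity] vanishes for indices from [k] on, so the sum may run to any [N >= k]; all times of
    the average then share one index set. *)
Lemma euler_derive z v k N : (k <= N)%N ->
  is_derive (0 : R) (1 : R) (fun e => euler (fun i => cos e * z i + sin e * v i) k)
    (\sum_(i < N) sensitivity z k i * v i).
Proof.
have z0 : (fun i => cos 0 * z i + sin 0 * v i) = z.
  by apply/funext => i; rewrite cos0 sin0 mul1r mul0r addr0.
elim: k => [|k ih] kN.
  rewrite big1; first exact: is_derive_cst.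
  by move=> i _; rewrite /sensitivity ltn0 mul0r.
have {}ih := ih (ltnW kN).
set y := fun e => euler _ k in ih.
have dy : is_derive (0 : R) (1 : R) (fun e => b (y e))
    (b' (euler z k) * \sum_(i < N) sensitivity z k i * v i).
  apply: is_derive1_comp; rewrite /y z0; exact: db.
have -> : \sum_(i < N) sensitivity z k.+1 i * v i =
    (1 + dl * b' (euler z k)) * (\sum_(i < N) sensitivity z k i * v i) + v k.
  rewrite mulr_sumr (bigD1 (Ordinal kN))//= [in RHS](bigD1 (Ordinal kN))//=.
  rewrite {1}/sensitivity ltnSn big_geq// mul1r.
  rewrite {2}/sensitivity ltnn mul0r mulr0 add0r addrC; congr (_ + _).
  apply: eq_bigr => i ik; rewrite mulrA; congr (_ * _); rewrite /sensitivity.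
  have ik' : (i : nat) != k by apply: contra ik => /eqP ik; apply/eqP/val_inj.
  rewrite ltnS leq_eqVlt (negPf ik')/=; case: ifP => [ik''|_]; last by rewrite mulr0.
  by rewrite big_nat_recr//= mulrC.
rewrite /= -/(y _).
have dk : is_derive (0 : R) (1 : R) (fun e : R => cos e * z k + sin e * v k) (v k).
  apply: is_derive_eq; rewrite /GRing.scale /= sin0 cos0; ring.
apply: is_derive_eq; rewrite /GRing.scale /=; ring.
Qed.

Section time_average.
Variables (G G' : R -> R) (G0 G1 : R) (N : nat).
Hypotheses (G_ge0 : forall x, 0 <= G x) (GG0 : forall x, G x <= G0)
  (dG : forall x, is_derive x (1 : R) G (G' x)) (GG1 : forall x, `|G' x| <= G1)
  (N0 : (0 < N)%N).

Definition time_average (z : nat -> R) := N%:R^-1 * \sum_(k < N) G (euler z k).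

Let p z i := N%:R^-1 * \sum_(k < N) G' (euler z k) * sensitivity z k i.

Lemma derive_lipschitz (f f' : R -> R) (K : R) x y :
  (forall x, is_derive x (1 : R) f (f' x)) -> (forall x, `|f' x| <= K) ->
  `|f x - f y| <= K * `|x - y|.
Proof.
move=> df fK; wlog xy : x y / x <= y.
  by move=> h; have [/h//|/ltW/h] := leP x y; rewrite distrC (distrC y).
move: xy; rewrite le_eqVlt => /predU1P[->|xy]; first by rewrite !subrr normr0 mulr0.
have [c _ h] := MVT xy (fun y _ => df y) (continuous_subspaceT (derive_continuous df)).
by rewrite distrC h normrM (distrC x) ler_wpM2r.
Qed.

Lemma time_average_local : local_functional N time_average.
Proof.
move=> z z' zz'; congr (_ * _); apply: eq_bigr => k _; congr G.
by apply: euler_local => i ik; rewrite zz'// (ltn_trans ik).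
Qed.

Lemma time_average_measurable : measurable_functional time_average.
Proof.
move=> d T U mU; apply: measurable_funM => //; apply: measurable_sum => k.
apply: measurableT_comp; last exact: euler_measurable.
by apply: continuous_measurable_fun; exact: (derive_continuous dG).
Qed.

Lemma time_average_ge0 z : 0 <= time_average z.
Proof. by rewrite mulr_ge0// sumr_ge0. Qed.

Lemma time_average_bound z : `|time_average z| <= G0.
Proof.
rewrite ger0_norm ?time_average_ge0// /time_average mulrC ler_pdivrMr ?ltr0n//.
apply: (@le_trans _ _ (\sum_(k < N) G0)); first by apply: ler_sum.
by rewrite sumr_const card_ord mulr_natr.
Qed.

Lemma time_average_lipschitz z z' :
  `|time_average z - time_average z'| <= G1 * \sum_(i < N) `|z i - z' i|.
Proof.
rewrite /time_average -mulrBr normrM ger0_norm// mulrC ler_pdivrMr ?ltr0n//.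
rewrite -sumrB; apply: le_trans (ler_norm_sum _ _ _) _.
apply: (@le_trans _ _ (\sum_(k < N) (G1 * \sum_(i < N) `|z i - z' i|))); last first.
  by rewrite sumr_const card_ord mulr_natr.
apply: ler_sum => k _; apply: le_trans (derive_lipschitz _ _ dG GG1) _.
rewrite ler_wpM2l//; first by apply: le_trans (GG1 0).
apply: le_trans (euler_lipschitz k z z') _.
rewrite (big_ord_widen _ (fun i => `|z i - z' i|) (ltnW (ltn_ord k))) big_mkcond/=.
by apply: ler_sum => i _; case: ifP.
Qed.

Lemma time_average_derive z v :
  is_derive (0 : R) (1 : R) (fun e => time_average (fun i => cos e * z i + sin e * v i))
    (\sum_(i < N) p z i * v i).
Proof.
have z0 : (fun i => cos 0 * z i + sin 0 * v i) = z.
  by apply/funext => i; rewrite cos0 sin0 mul1r mul0r addr0.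
have dk (k : 'I_N) : is_derive (0 : R) (1 : R)
    (fun e => G (euler (fun i => cos e * z i + sin e * v i) k))
    (G' (euler z k) * \sum_(i < N) sensitivity z k i * v i).
  apply: (@is_derive1_comp _ G (fun e => euler (fun i => cos e * z i + sin e * v i) k)).
    by rewrite z0; exact: dG.
  by apply: euler_derive; exact: ltnW.
have -> : \sum_(i < N) p z i * v i = N%:R^-1 *
    \sum_(k < N) G' (euler z k) * \sum_(i < N) sensitivity z k i * v i.
  under eq_bigr do rewrite /p -mulrA mulr_suml.
  rewrite -mulr_sumr exchange_big/=; congr (_ * _); apply: eq_bigr => k _.
  by rewrite mulr_sumr; apply: eq_bigr => i _; rewrite mulrA.
have := is_derive_sum (fun k : 'I_N => dk k).
rewrite /time_average => ds.
have -> : (fun e => N%:R^-1 * \sum_(k < N) G (euler (fun i => cos e * z i + sin e * v i) k)) =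
   (N%:R^-1 : R) *: (\sum_(k < N) (fun e => G (euler (fun i => cos e * z i + sin e * v i) k))).
  by apply/funext => e; rewrite /GRing.scale /= fct_sumE.
exact: is_deriveZ.
Qed.

(** An increment influences later times with geometric decay, so the sum over [k] is at most 1/(dl
    M). The average divides by [N], which leaves 1/(T M) with T = N dl. *)
Lemma time_average_gradient z i : (i < N)%N -> `|p z i| <= G1 / (N%:R * dl * M).
Proof.
move=> iN; have G10 : 0 <= G1 by apply: le_trans (GG1 0).
have r01 := contraction_ratio; case/andP: (r01) => r0 _.
rewrite /p normrM ger0_norm//.
have -> : G1 / (N%:R * dl * M) = N%:R^-1 * (G1 * (dl * M)^-1).
  by rewrite -!mulrA invfM mulrCA.
rewrite ler_wpM2l//; apply: le_trans (ler_norm_sum _ _ _) _.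
apply: (@le_trans _ _ (\sum_(k < N) G1 * (if (i < k)%N then (1 - dl * M) ^+ (k - i.+1) else 0))).
  apply: ler_sum => k _; rewrite normrM ler_pM//.
  case: ifP => ik; last by rewrite /sensitivity ik normr0.
  by case/andP: (sensitivity_bound z ik) => s0 s1; rewrite ger0_norm.
rewrite -mulr_sumr ler_wpM2l//.
have geo n : (\sum_(j < n) (1 - dl * M) ^+ j) <= (dl * M)^-1.
  have dM : 0 < dl * M by rewrite mulr_gt0.
  rewrite -(ler_pM2l dM) divff ?gt_eqF//.
  have := subrX1 (1 - dl * M) n; rewrite (_ : 1 - dl * M - 1 = - (dl * M)); last by ring.
  have : 0 <= (1 - dl * M) ^+ n by exact: exprn_ge0.
  by set s := \sum_(j < n) _; lra.
have shift n : \sum_(k < n) (if (i < k)%N then (1 - dl * M) ^+ (k - i.+1) else 0) =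
    \sum_(j < n - i.+1) (1 - dl * M) ^+ j.
  elim: n => [|n ih]; first by rewrite !big_ord0.
  rewrite big_ord_recr/= ih; case: ltnP => [ni|ni].
    by rewrite subSn// big_ord_recr.
  by rewrite addr0 (eqP (_ : n - i.+1 == 0)%N) ?subn_eq0 1?ltnW// subSS (eqP (_ : n - i == 0)%N) ?subn_eq0.
by rewrite shift; exact: geo.
Qed.

Lemma time_average_concentration d (T : measurableType d) (P : probability T R)
    (Z : nat -> T -> R) (c : R) : centered_gaussian P N Z ->
  (forall i j, (i < N)%N -> (j < N)%N -> 0 <= \int[P]_w (Z i w * Z j w)) ->
  0 < c -> c <= \int[P]_w time_average (fun i => Z i w) ->
  (P [set w | (time_average (fun i => Z i w) <= c / 2)%R] * ((c / 2) ^+ 2)%:E <=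
   ((pi / 2) ^+ 2 * ((G1 / (N%:R * dl * M)) ^+ 2 *
      \int[P]_w (\sum_(i < N) Z i w) ^+ 2))%:E)%E.
Proof.
move=> gZ posZ c0 cE.
apply: le_trans (@gaussian_variance_le _ _ _ P N Z gZ time_average p G0 G1 _
  time_average_local time_average_measurable time_average_bound
  time_average_lipschitz time_average_derive time_average_gradient posZ).
apply: (@chebyshev_copy _ _ _ P (fun w => time_average (fun i => Z i w)) G0) => //.
- by apply: time_average_measurable; case: gZ.
- by move=> w; exact: time_average_bound.
Qed.

End time_average.
End euler_scheme.

(** * Discrete Ornstein-Uhlenbeck recursion and Abel summation *)

Section autoregression.
Context (R : realType).
Implicit Types (r : R) (z : nat -> R).

(** With r = 1 - dl M this is the Euler scheme of the linear drift -M x. Fed with regression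
    coefficients, it measures the linear response to a change of the window sum. *)
Fixpoint autoregression r z k : R :=
  if k is k'.+1 then r * autoregression r z k' + z k' else 0.

Lemma autoregressionE r z k :
  autoregression r z k = \sum_(j < k) r ^+ j * z (k - j.+1)%N.
Proof.
elim: k => [|k ih] /=; first by rewrite big_ord0.
rewrite big_ord_recl/= expr0 mul1r subn1 /= addrC ih mulr_sumr; congr (_ + _).
by apply: eq_bigr => j _; rewrite /bump/= add1n subSS exprS mulrA.
Qed.

(** Abel summation trades single increments for block sums, whose size is controlled uniformly in
    the step. *)
Lemma sum_by_parts r (d : nat -> R) k : \sum_(j < k) r ^+ j * d j =
  r ^+ k * (\sum_(j < k) d j) + (1 - r) * \sum_(j < k) r ^+ j * \sum_(i < j.+1) d i.
Proof.
elim: k => [|k ih]; first by rewrite !big_ord0 !mulr0 addr0.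
rewrite 3!big_ord_recr/= ih [in RHS]big_ord_recr/= exprS.
set S := \sum_(j < k) d j; set Q := \sum_(j < k) _; ring.
Qed.

(** The Abel weights against blocks of size 1 + j dl. The constant part telescopes to 1; the part j
    dl is the Abel form of the constant sequence dl, a geometric sum of at most 1/M. *)
Lemma sum_by_parts_weight (dl M : R) k : 0 < dl -> 0 < M -> 0 <= 1 - dl * M ->
  (1 - dl * M) ^+ k * (1 + k%:R * dl) +
  dl * M * \sum_(j < k) (1 - dl * M) ^+ j * (1 + j.+1%:R * dl) <= 1 + M^-1.
Proof.
move=> dl0 M0 r0; set r := 1 - dl * M in r0 *.
have rE : dl * M = 1 - r by rewrite /r; ring.
have h1 : r ^+ k + (1 - r) * \sum_(j < k) r ^+ j = 1.
  by have := subrX1 r k; set s := \sum_(j < k) _; lra.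
have h2 := sum_by_parts r (fun=> dl) k.
have cst j : \sum_(i < j) dl = j%:R * dl by rewrite sumr_const card_ord mulr_natl.
rewrite cst in h2.
have cst' : \sum_(j < k) r ^+ j * (\sum_(i < j.+1) dl) =
    \sum_(j < k) r ^+ j * (j.+1%:R * dl) by apply: eq_bigr => j _; rewrite cst.
rewrite cst' in h2.
have h3 : \sum_(j < k) r ^+ j * dl <= M^-1.
  rewrite -mulr_suml -[leRHS]mul1r ler_pdivlMr// -mulrA rE mulrC.
  have : 0 <= r ^+ k by exact: exprn_ge0.
  by move: h1; set s := \sum_(j < k) _; lra.
rewrite rE.
have -> : \sum_(j < k) r ^+ j * (1 + j.+1%:R * dl) =
    \sum_(j < k) r ^+ j + \sum_(j < k) r ^+ j * (j.+1%:R * dl).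
  by rewrite -big_split/=; apply: eq_bigr => j _; rewrite mulrDr mulr1.
have E u s q t : u * (1 + t) + (1 - r) * (s + q) =
  (u + (1 - r) * s) + (u * t + (1 - r) * q) by ring.
by rewrite E h1 -h2 lerD2l.
Qed.

Lemma autoregression_bound (dl M A : R) z k : 0 < dl -> 0 < M -> 0 <= 1 - dl * M ->
  (forall j, (j <= k)%N -> `|\sum_(i < j) z (k - i.+1)%N| <= A * (1 + j%:R * dl)) ->
  `|autoregression (1 - dl * M) z k| <= A * (1 + M^-1).
Proof.
move=> dl0 M0 r0 zA; have A0 : 0 <= A.
  by have := zA 0%N (leq0n _); rewrite big_ord0 normr0 mul0r addr0 mulr1.
rewrite autoregressionE (sum_by_parts _ (fun j => z (k - j.+1)%N)).
apply: le_trans (ler_wpM2l A0 (sum_by_parts_weight k dl0 M0 r0)).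
rewrite (_ : 1 - (1 - dl * M) = dl * M); last by ring.
apply: le_trans (ler_normD _ _) _; rewrite mulrDr lerD//.
  by rewrite normrM ger0_norm ?exprn_ge0// mulrCA ler_wpM2l ?exprn_ge0// zA.
have dM : 0 <= dl * M by rewrite mulr_ge0// ltW.
rewrite normrM ger0_norm// mulrCA ler_wpM2l// mulr_sumr.
apply: le_trans (ler_norm_sum _ _ _) _; apply: ler_sum => j _.
by rewrite normrM ger0_norm ?exprn_ge0// mulrCA ler_wpM2l ?exprn_ge0// zA.
Qed.

Lemma bernoulli_le (x : R) m : 0 <= x <= 1 -> 1 - m%:R * x <= (1 - x) ^+ m.
Proof.
move=> /andP[x0 x1]; elim: m => [|m ih]; first by rewrite mul0r subr0.
rewrite exprS -natr1; have m0 : 0 <= m%:R :> R by [].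
have := ler_wpM2l (_ : 0 <= 1 - x) ih; rewrite subr_ge0 => /(_ x1); nra.
Qed.

(** Only the last [m] inputs are kept, and each of them is damped fewer than [m] times. *)
Lemma autoregression_window (q : R) (c : nat -> R) k m : 0 <= q <= 1 -> (m <= k)%N ->
  (forall i, (i < k)%N -> 0 <= c i) ->
  q ^+ m * \sum_(j < m) c (k - j.+1)%N <= autoregression q c k.
Proof.
move=> /andP[q0 q1] mk c0; rewrite autoregressionE.
have ck j : (j < k)%N -> 0 <= c (k - j.+1)%N.
  by move=> jk; apply: c0; rewrite ltn_subrL/= (leq_ltn_trans _ jk).
apply: (@le_trans _ _ (\sum_(j < m) q ^+ j * c (k - j.+1)%N)).
  rewrite mulr_sumr; apply: ler_sum => j _; rewrite ler_wpM2r//.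
    by apply: ck; exact: leq_trans mk.
  by rewrite ler_wiXn2l// ltnW.
rewrite (big_ord_widen _ (fun j => q ^+ j * c (k - j.+1)%N) mk) big_mkcond/=.
apply: ler_sum => j _; case: ifP => // _.
by rewrite mulr_ge0 ?exprn_ge0// ck.
Qed.

End autoregression.

Section second_moments.
Context d (T : measurableType d) (R : realType) (P : probability T R).
Implicit Types U V : T -> R.

Lemma cauchy_schwarz_moment U V :
  measurable_fun setT U -> measurable_fun setT V ->
  P.-integrable setT (EFin \o (fun w => U w ^+ 2)) ->
  P.-integrable setT (EFin \o (fun w => V w ^+ 2)) ->
  0 < \int[P]_w V w ^+ 2 ->
  (\int[P]_w (U w * V w)) ^+ 2 <= (\int[P]_w U w ^+ 2) * (\int[P]_w V w ^+ 2).
Proof.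
move=> mU mV U2 V2; set v := \int[P]_w V w ^+ 2; set u := \int[P]_w U w ^+ 2 => v0.
have UV := integrable_mul_square mU mV U2 V2; set c := \int[P]_w (U w * V w).
have : 0 <= \int[P]_w (v * U w - c * V w) ^+ 2.
  by apply: Rintegral_ge0 => w _; exact: sqr_ge0.
have -> : \int[P]_w (v * U w - c * V w) ^+ 2 = v * (v * u - c ^+ 2).
  transitivity (\int[P]_w (v ^+ 2 * U w ^+ 2 + (- (2 * v * c) * (U w * V w) +
      c ^+ 2 * V w ^+ 2))).
    by apply: eq_Rintegral => w _; ring.
  have I1 := integrable_fZ (v ^+ 2) U2; have I2 := integrable_fZ (- (2 * v * c)) UV.
  have I3 := integrable_fZ (c ^+ 2) V2.
  rewrite RintegralD//; last exact: (integrable_fD I2 I3).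
  rewrite RintegralD// !RintegralZl// -/u -/v -/c; ring.
by rewrite pmulr_rge0// subr_ge0 mulrC.
Qed.

Lemma abs_moment_le U (s : R) : measurable_fun setT U ->
  P.-integrable setT (EFin \o (fun w => U w ^+ 2)) -> 0 <= s ->
  \int[P]_w U w ^+ 2 <= s ^+ 2 -> \int[P]_w `|U w| <= s.
Proof.
move=> mU U2 s0 Us; set m := \int[P]_w `|U w|.
have Ui := integrable_norm (integrable_square_integrable mU U2).
have m0 : 0 <= m by apply: Rintegral_ge0.
rewrite -(@ler_pXn2r _ 2)// ?nnegrE//; apply: le_trans Us.
rewrite -subr_ge0.
have : 0 <= \int[P]_w (`|U w| - m) ^+ 2.
  by apply: Rintegral_ge0 => w _; exact: sqr_ge0.
have -> : \int[P]_w (`|U w| - m) ^+ 2 =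
    \int[P]_w (U w ^+ 2 + (- (2 * m) * `|U w| + m ^+ 2)).
  apply: eq_Rintegral => w _; rewrite -(real_normK (num_real (U w))); ring.
have I1 := integrable_fZ (- (2 * m)) Ui; have I2 := integrable_fcst P (m ^+ 2).
rewrite RintegralD//; last exact: (integrable_fD I1 I2).
rewrite RintegralD// RintegralZl// Rintegral_probability_cst -/m.
by congr (_ <= _); ring.
Qed.

Lemma markov_half U (C : R) : measurable_fun setT U ->
  P.-integrable setT (EFin \o U) -> 0 < C -> \int[P]_w `|U w| <= C ->
  ((2^-1)%:E <= P [set w | (`|U w| <= 2 * C)%R])%E.
Proof.
move=> mU Ui C0 UC; set A := [set w | _].
have mA : measurable A.
  rewrite (_ : A = (fun w => `|U w|) @^-1` `]-oo, (2 * C)]); last first.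
    by apply/seteqP; split => w /=; rewrite in_itv.
  by rewrite -[_ @^-1` _]setTI; apply: measurableT_comp.
have Ai := integrable_indic P mA.
have PA : P A = (\int[P]_w (\1_A w))%:E.
  rewrite fineK; first by rewrite integral_indic// setIT.
  by rewrite integrable_fin_num.
rewrite PA lee_fin.
have : \int[P]_w (1 - `|U w| / (2 * C)) <= \int[P]_w (\1_A w).
  apply: le_Rintegral => //.
  - apply: integrable_fB; first exact: integrable_fcst.
    have := integrable_fZ (2 * C)^-1 (integrable_norm Ui).
    by apply: eq_integrable => // w _; rewrite /= mulrC.
  - move=> w _; rewrite indicE; have [_|] := boolP (_ \in _).
      by rewrite lerBlDr lerDl divr_ge0// mulr_ge0// ltW.
    rewrite notin_setE /A /= => /negP; rewrite -ltNge => h.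
    by rewrite subr_le0 ler_pdivlMr ?mulr_gt0// mul1r ltW.
apply: le_trans.
rewrite RintegralB//; last 2 first.
- exact: integrable_fcst.
- have := integrable_fZ (2 * C)^-1 (integrable_norm Ui).
  by apply: eq_integrable => // w _; rewrite /= mulrC.
rewrite Rintegral_probability_cst RintegralZr//; last exact: integrable_norm.
have : (\int[P]_w `|U w|) / (2 * C) <= 2^-1.
  by rewrite ler_pdivrMr ?mulr_gt0// mulKf.
by lra.
Qed.

End second_moments.

(** Slopes of at least 1/2 make [psi] reach [u1] within distance 2 (|u1| + K) of 0; slopes of at
    most [c1] keep it below [u2] over a length (u2 - u1)/c1. The arguments sent into [u1, u2] thus
    contain an interval of known length and bounded location. *)
Lemma slope_interval (R : realType) (psi : R -> R) (c1 K u1 u2 : R) : 0 < c1 ->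
  (forall u u', u' <= u -> (u - u') / 2 <= psi u - psi u' <= c1 * (u - u')) ->
  `|psi 0| <= K -> u1 < u2 ->
  exists a, `|a| <= 2 * (`|u1| + K) /\
    forall u, a <= u <= a + (u2 - u1) / c1 -> u1 <= psi u <= u2.
Proof.
move=> c10 slope K0 u12.
have lip x y : `|psi x - psi y| <= c1 * `|x - y|.
  wlog xy : x y / y <= x.
    by move=> h; have [/h//|/ltW/h] := leP y x; rewrite distrC (distrC y).
  have /andP[h1 h2] := slope _ _ xy; have xy0 : 0 <= x - y by rewrite subr_ge0.
  by rewrite !ger0_norm// (le_trans _ h1)// divr_ge0.
have cpsi : continuous psi.
  move=> x; apply/cvgrPdist_le => /= e e0; near=> y.
  apply: le_trans (lip _ _) _; rewrite mulrC -ler_pdivlMr//.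
  near: y; apply: (@cvgr_dist_le _ R^o); first exact: cvg_id.
  by rewrite divr_gt0.
set rho := 2 * (`|u1| + K).
have K00 : 0 <= K by apply: le_trans K0.
have rho0 : 0 <= rho by rewrite mulr_ge0// addr_ge0.
have [a] : exists2 a, a \in `[- rho, rho] & psi a = u1.
  have /andP[h1 _] := slope _ _ rho0.
  have rho0' : - rho <= 0 by rewrite oppr_le0.
  have /andP[h2 _] := slope _ _ rho0'.
  move: K0; rewrite ler_norml => /andP[k1 k2].
  have n1 := ler_norm u1; have n2 := ler_norm (- u1); rewrite normrN in n2.
  apply: IVT; [lra|exact: continuous_subspaceT|].
  by rewrite ge_min le_max; apply/andP; split; apply/orP; [left|right];
    move: h1 h2; rewrite /rho; lra.
rewrite in_itv/= -ler_norml => a1 a2; exists a; split => // u /andP[au ua].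
have /andP[h1 h2] := slope _ _ au; rewrite -a2.
have ua0 : 0 <= (u - a) / 2 by rewrite divr_ge0// subr_ge0.
apply/andP; split; first by move: h1 ua0; lra.
have : c1 * (u - a) <= u2 - u1 by rewrite mulrC -ler_pdivlMr//; lra.
by move: h2; rewrite a2; lra.
Unshelve. all: by end_near. Qed.

(** * Lower bound for the mean along the Euler scheme *)

Section mean_lower_bound.
Context d (T : measurableType d) (R : realType) (P : probability T R).
Variables (b b' : R -> R) (dl M L : R).
Hypotheses (M0 : 0 < M) (dl0 : 0 < dl) (dlL : dl * L <= 1)
  (db : forall x, is_derive x (1 : R) b (b' x))
  (bM : forall x, b' x <= - M) (bL : forall x, `|b' x| <= L).
Variables (N m : nat) (Z : nat -> T -> R) (A s : R).
Hypotheses (gZ : centered_gaussian P N Z) (A0 : 0 < A) (s0 : 0 < s)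
  (posZ : forall i j, (i < N)%N -> (j < N)%N -> 0 <= \int[P]_w (Z i w * Z j w))
  (blockZ : forall k j, (j <= k <= N)%N ->
    \int[P]_w (\sum_(i < j) Z (k - i.+1)%N w) ^+ 2 <= (A * (1 + j%:R * dl)) ^+ 2)
  (windowZ : forall k, (m <= k <= N)%N ->
    \int[P]_w (\sum_(i < m) Z (k - i.+1)%N w) ^+ 2 = s ^+ 2)
  (mL : m%:R * (dl * L) <= 2^-1).

Local Notation PP := (P \x P)%E.

Let mZ i : measurable_fun setT (Z i). Proof. by case: gZ. Qed.
Let Z2 i : P.-integrable setT (EFin \o (fun w => Z i w ^+ 2)).
Proof. by case: gZ. Qed.
Let Zi i : P.-integrable setT (EFin \o Z i).
Proof. exact: integrable_square_integrable. Qed.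
Let bL' x : - L <= b' x. Proof. by have := bL x; rewrite ler_norml => /andP[]. Qed.
Let r := 1 - dl * M.
Let r01 : 0 <= r <= 1. Proof. exact: (contraction_ratio M0 dl0 dlL bM bL'). Qed.
Let L0 : 0 <= L. Proof. exact: le_trans (bL 0). Qed.
Let y k w := euler b dl (fun i => Z i w) k.
Let ar k w := autoregression r (fun i => Z i w) k.
Let block k j w := \sum_(i < j) Z (k - i.+1)%N w.

Let mblock k j : measurable_fun setT (block k j).
Proof. exact: measurable_sum. Qed.

Let block2 k j : P.-integrable setT (EFin \o (fun w => block k j w ^+ 2)).
Proof. exact: (@integrable_sqr_sum _ _ _ P j (fun i => Z (k - i.+1)%N)). Qed.

Let blocki k j : P.-integrable setT (EFin \o block k j).
Proof. exact: integrable_square_integrable. Qed.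

(** First-moment bound for the linear scheme: the block deviations A (1 + j dl) summed against the
    Abel weights. *)
Definition ou_moment := A * (1 + M^-1).

Let ou_moment_ge0 : 0 <= ou_moment.
Proof. by rewrite mulr_ge0 ?addr_ge0 ?invr_ge0// ltW. Qed.

Let ari k : P.-integrable setT (EFin \o ar k).
Proof.
elim: k => [|k ih]; first exact: integrable_fcst.
by apply: (@integrable_fD _ _ _ P (fun w => r * ar k w)) => //; exact: integrable_fZ.
Qed.

Let ar_moment k : (k <= N)%N -> \int[P]_w `|ar k w| <= ou_moment.
Proof.
move=> kN; case/andP: (r01) => r0 r1.
pose maj w := r ^+ k * `|block k k w| +
   \sum_(j < k) dl * M * r ^+ j * `|block k j.+1 w|.
have imaj1 : P.-integrable setT (EFin \o (fun w => r ^+ k * `|block k k w|)).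
  by apply: integrable_fZ; exact: integrable_norm.
have imaj2 (j : nat) : P.-integrable setT
    (EFin \o (fun w => dl * M * r ^+ j * `|block k j.+1 w|)).
  by apply: integrable_fZ; exact: integrable_norm.
have imaj3 := @integrable_fsum _ _ _ P k (fun j w => dl * M * r ^+ j * `|block k j.+1 w|) imaj2.
have bm j : (j <= k)%N -> \int[P]_w `|block k j w| <= A * (1 + j%:R * dl).
  move=> jk; apply: abs_moment_le => //; last by apply: blockZ; rewrite jk.
  by rewrite mulr_ge0 ?addr_ge0 ?mulr_ge0 ?(ltW dl0) ?(ltW A0).
apply: (@le_trans _ _ (\int[P]_w maj w)).
  apply: le_Rintegral => //; [exact: integrable_norm|exact: integrable_fD|].
  move=> w _; rewrite /ar autoregressionE (sum_by_parts _ (fun j => Z (k - j.+1)%N w)).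
  apply: le_trans (ler_normD _ _) _; rewrite lerD//.
    by rewrite normrM ger0_norm ?exprn_ge0.
  rewrite (_ : 1 - r = dl * M); last by rewrite /r; ring.
  rewrite mulr_sumr; apply: le_trans (ler_norm_sum _ _ _) _; apply: ler_sum => j _.
  by rewrite mulrA normrM ger0_norm// !mulr_ge0 ?exprn_ge0// ltW.
rewrite RintegralD// RintegralZl//; last exact: integrable_norm.
rewrite (@Rintegral_sum _ _ _ P k (fun j w => dl * M * r ^+ j * `|block k j.+1 w|))//.
apply: le_trans (ler_wpM2l (ltW A0) (sum_by_parts_weight k dl0 M0 r0)).
rewrite mulrDr lerD//.
  by rewrite mulrCA ler_wpM2l ?exprn_ge0// bm.
rewrite mulrCA mulr_sumr mulr_sumr; apply: ler_sum => j _.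
rewrite RintegralZl//; last exact: integrable_norm.
rewrite -mulrA ler_wpM2l ?mulr_ge0 ?(ltW dl0) ?(ltW M0)//.
by rewrite mulrCA ler_wpM2l ?exprn_ge0// bm.
Qed.

(** Bounds the mean of |b(a) + M a| along the linear scheme, the forcing that separates it from the
    nonlinear one. *)
Definition drift_moment := `|b 0| + (L + M) * ou_moment.

Let my k : measurable_fun setT (y k).
Proof. by apply: (euler_measurable _ db). Qed.

Let yi k : P.-integrable setT (EFin \o y k).
Proof.
apply: (@integrable_dominated _ _ _ P _
    (fun w => `|euler b dl (fun=> 0) k| + \sum_(i < k) `|Z i w|)) => //.
  move=> w; rewrite -[y k w](subrK (euler b dl (fun=> 0) k)) addrC.
  apply: le_trans (ler_normD _ _) _; rewrite lerD2l.
  apply: le_trans (euler_lipschitz M0 dl0 dlL db bM bL' k _ _) _.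
  by apply: ler_sum => i _; rewrite subr0.
apply: integrable_fD; first exact: integrable_fcst.
apply: (@integrable_fsum _ _ _ P k (fun i w => `|Z i w|)) => i.
exact: integrable_norm.
Qed.

Let b_growth x : `|b x| <= `|b 0| + L * `|x|.
Proof.
rewrite -[b x](subrK (b 0)) addrC; apply: le_trans (ler_normD _ _) _.
rewrite lerD2l -[x in leRHS]subr0; exact: (derive_lipschitz _ _ db bL).
Qed.

(** Both schemes receive the same noise, which cancels in the difference. What remains contracts by
    1 - dl M and is forced by at most dl * [drift_moment] in mean; [drift_moment / M] is the fixed
    point of this recursion. *)
Let dist_moment k : (k <= N)%N -> \int[P]_w `|y k w - ar k w| <= drift_moment / M.
Proof.
case/andP: (r01) => r0 r1.
have iD j : P.-integrable setT (EFin \o (fun w => `|y j w - ar j w|)).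
  exact/integrable_norm/integrable_fB.
elim: k => [|k ih] kN.
  under eq_Rintegral do rewrite subrr normr0.
  rewrite Rintegral_probability_cst divr_ge0 ?(ltW M0)//.
  by rewrite addr_ge0// mulr_ge0// addr_ge0// ltW.
have {}ih := ih (ltnW kN); have am := ar_moment (ltnW kN).
have i3 : P.-integrable setT (EFin \o (fun w => (L + M) * `|ar k w|)).
  by apply: integrable_fZ; exact: integrable_norm.
have i2 : P.-integrable setT (EFin \o (fun w => `|b 0| + (L + M) * `|ar k w|)).
  by apply: integrable_fD => //; exact: integrable_fcst.
apply: (@le_trans _ _ (\int[P]_w (r * `|y k w - ar k w| +
    dl * (`|b 0| + (L + M) * `|ar k w|)))).
  apply: le_Rintegral => //.
    by apply: integrable_fD; exact: integrable_fZ.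
  move=> w _; rewrite /y /ar /= -/(y k w) -/(ar k w).
  rewrite (_ : _ - _ = (y k w + dl * b (y k w) - (ar k w + dl * b (ar k w))) +
    dl * (b (ar k w) + M * ar k w)); last by rewrite /r; ring.
  apply: le_trans (ler_normD _ _) _; apply: lerD.
    exact: (drift_contraction dl0 dlL db bM bL').
  rewrite normrM gtr0_norm// ler_pM2l//; apply: le_trans (ler_normD _ _) _.
  rewrite mulrDl addrA normrM (gtr0_norm M0) lerD2r; exact: b_growth.
rewrite RintegralD//; [|exact: integrable_fZ|exact: integrable_fZ].
rewrite !RintegralZl// RintegralD//; last exact: integrable_fcst.
rewrite RintegralZl//; last exact: integrable_norm.
rewrite Rintegral_probability_cst.
have LM : 0 <= L + M by rewrite addr_ge0// ltW.
have h1 := ler_wpM2l r0 ih; have h2 := ler_wpM2l LM am.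
have h3 : dl * (`|b 0| + (L + M) * \int[P]_w `|ar k w|) <= dl * drift_moment.
  by rewrite ler_pM2l// lerD2l.
apply: le_trans (lerD h1 h3) _.
have -> // : r * (drift_moment / M) + dl * drift_moment = drift_moment / M.
by rewrite /r; field; rewrite gt_eqF.
Qed.

Definition euler_moment := drift_moment / M + ou_moment.

Lemma euler_first_moment k : (k <= N)%N -> \int[P]_w `|y k w| <= euler_moment.
Proof.
move=> kN; apply: le_trans (lerD (dist_moment kN) (ar_moment kN)).
have i1 : P.-integrable setT (EFin \o (fun w => `|y k w - ar k w|)).
  exact/integrable_norm/integrable_fB.
have i2 : P.-integrable setT (EFin \o (fun w => `|ar k w|)) by exact: integrable_norm.
rewrite -RintegralD//; apply: le_Rintegral => //.
- exact: integrable_norm.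
- exact: integrable_fD.
- by move=> w _; rewrite -{1}[y k w](subrK (ar k w)) ler_normD.
Qed.

Section fixed_time.
Variable k : nat.
Hypotheses (mk : (m <= k)%N) (kN : (k <= N)%N).

Let xi := block k m.
(** The regression coefficient of [Z i] on the window sum: [Z i - c i * xi] is uncorrelated with
    [xi]. The coefficients [e] of the next line write [xi] as a linear form in the increments. *)
Let c i := (\int[P]_w (Z i w * xi w)) / s ^+ 2.
Let e i : R := \sum_(j < m) ((k - j.+1)%N == i)%:R.

Let kj j : (j < m)%N -> (k - j.+1 < k)%N.
Proof. by move=> jm; rewrite ltn_subrL/= (leq_ltn_trans (leq0n j))// (leq_trans jm). Qed.

Let xiE w : xi w = \sum_(i < N) e i * Z i w.
Proof.
rewrite /xi /block /e; under [RHS]eq_bigr do rewrite mulr_suml.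
rewrite exchange_big/=; apply: eq_bigr => j _.
have jN : (k - j.+1 < N)%N by apply: leq_trans (kj (ltn_ord j)) _.
rewrite (bigD1 (Ordinal jN))//= eqxx mul1r big1 ?addr0// => i ij.
rewrite (_ : (_ == _) = false) ?mul0r//; apply/negP => /eqP h.
by move/eqP: ij; apply; apply/val_inj.
Qed.

Let xi_var : \int[P]_w xi w ^+ 2 = s ^+ 2.
Proof. by apply: windowZ; rewrite mk. Qed.

Let s20 : 0 < s ^+ 2. Proof. by rewrite exprn_gt0. Qed.

Let c_ge0 i : (i < k)%N -> 0 <= c i.
Proof.
move=> ik; apply: divr_ge0; last exact: ltW.
have -> : \int[P]_w (Z i w * xi w) = \sum_(j < m) \int[P]_w (Z i w * Z (k - j.+1)%N w).
  rewrite -(@Rintegral_sum _ _ _ P m (fun j w => Z i w * Z (k - j.+1)%N w)).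
    by apply: eq_Rintegral => w _; rewrite /xi /block mulr_sumr.
  by move=> j; exact: integrable_mul_square.
apply: sumr_ge0 => j _; apply: posZ; first exact: leq_trans kN.
by apply: leq_trans (kj (ltn_ord j)) _.
Qed.

Let Zxi i : P.-integrable setT (EFin \o (fun w => Z i w * xi w)).
Proof. by apply: integrable_mul_square => //; [exact: mblock|exact: block2]. Qed.

Let c_block j : \sum_(i < j) c (k - i.+1)%N = (\int[P]_w (block k j w * xi w)) / s ^+ 2.
Proof.
rewrite /c -mulr_suml; congr (_ / _).
rewrite -(@Rintegral_sum _ _ _ P j (fun i w => Z (k - i.+1)%N w * xi w)).
  by apply: eq_Rintegral => w _; rewrite /block mulr_suml.
by move=> i; exact: Zxi.
Qed.

Definition response_bound := A / s * (1 + M^-1).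

(** By Cauchy-Schwarz the covariance of a block with [xi] is at most A (1 + j dl) s. Divided by s^2,
    this bounds the block sums of [c], to which [autoregression_bound] applies. *)
Let response_upper : autoregression r c k <= response_bound.
Proof.
apply: le_trans (ler_norm _) _; case/andP: (r01) => r0 _.
apply: autoregression_bound => // j jk; rewrite c_block normrM.
rewrite [X in _ * X]gtr0_norm ?invr_gt0// ler_pdivrMr//.
have B0 : 0 <= A * (1 + j%:R * dl) * s.
  by rewrite !mulr_ge0 ?addr_ge0 ?mulr_ge0// ltW.
have -> : A / s * (1 + j%:R * dl) * s ^+ 2 = A * (1 + j%:R * dl) * s.
  by field; rewrite gt_eqF.
rewrite -(@ler_pXn2r _ 2)// ?nnegrE// real_normK ?num_real//.
have v0 : 0 < \int[P]_w xi w ^+ 2 by rewrite xi_var.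
apply: le_trans (cauchy_schwarz_moment (mblock k j) (mblock k m) (block2 k j)
  (block2 k m) v0) _.
by rewrite xi_var [leRHS]exprMn ler_wpM2r ?(ltW s20)// blockZ// jk.
Qed.

(** Over the window the coefficients [c] sum to Var(xi)/s^2 = 1, and Bernoulli's inequality gives (1
    - dl L)^m >= 1 - m dl L >= 1/2. *)
Let response_lower : 2^-1 <= autoregression (1 - dl * L) c k.
Proof.
have q01 : 0 <= 1 - dl * L <= 1 by rewrite subr_ge0 dlL lerBlDr lerDl mulr_ge0// ltW.
apply: le_trans (autoregression_window q01 mk c_ge0).
rewrite c_block (_ : \int[P]_w _ = s ^+ 2); last first.
  by rewrite -xi_var; apply: eq_Rintegral => w _; rewrite expr2.
rewrite divff ?gt_eqF// mulr1.
have dL : 0 <= dl * L <= 1 by rewrite dlL andbT mulr_ge0// ltW.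
by apply: le_trans (bernoulli_le m dL); move: mL; lra.
Qed.

(** Nonnegativity of [c] keeps the two trajectories ordered, so their difference follows a linear
    recursion whose factor lies between 1 - dl L and 1 - dl M. *)
Let slope z u u' j : (j <= k)%N -> u' <= u ->
  (u - u') * autoregression (1 - dl * L) c j <=
  euler b dl (fun i => z i + u * c i) j - euler b dl (fun i => z i + u' * c i) j <=
  (u - u') * autoregression r c j.
Proof.
move=> + uu; have uu0 : 0 <= u - u' by rewrite subr_ge0.
have q0 : 0 <= 1 - dl * L by rewrite subr_ge0.
have ar0 q i : 0 <= q -> (i <= k)%N -> 0 <= autoregression q c i.
  move=> q00; elim: i => [//|i ih] ik /=.
  by rewrite addr_ge0 ?c_ge0// mulr_ge0// ih// ltnW.
elim: j => [|j ih] jk; first by rewrite /= !mulr0 subrr lexx.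
have {ih} := ih (ltnW jk) => /=.
set y1 := euler _ _ _ _; set y2 := euler _ _ _ _ => /andP[h1 h2].
have [t [t1 t2 tE]] := drift_slope dl0 db bM bL' y1 y2.
have -> : y1 + dl * b y1 + (z j + u * c j) - (y2 + dl * b y2 + (z j + u' * c j)) =
    t * (y1 - y2) + (u - u') * c j.
  by rewrite -tE; ring.
have a0 := ar0 _ _ q0 (ltnW jk).
have y12 : 0 <= y1 - y2 by apply: le_trans h1; rewrite mulr_ge0.
rewrite [X in X <= _ <= _]mulrDr [X in _ <= _ <= X]mulrDr !lerD2r; apply/andP; split.
  rewrite mulrCA; apply: le_trans (ler_wpM2l q0 h1) _.
  by rewrite ler_wpM2r.
rewrite mulrCA; case/andP: r01 => r0 _.
apply: le_trans (ler_wpM2l r0 h2).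
by rewrite ler_wpM2r.
Qed.

(** [y k] as a function of the value [u] given to the window sum, the regression residuals being
    those of [w]. *)
Let psi w u := euler b dl (fun i => (Z i w - xi w * c i) + u * c i) k.

Let psi_slope w u u' : u' <= u ->
  (u - u') / 2 <= psi w u - psi w u' <= response_bound * (u - u').
Proof.
move=> uu; have uu0 : 0 <= u - u' by rewrite subr_ge0.
have /andP[h1 h2] := slope (fun i => Z i w - xi w * c i) (leqnn k) uu.
apply/andP; split; first by apply: le_trans h1; rewrite ler_wpM2l.
by apply: le_trans h2 _; rewrite mulrC ler_wpM2r.
Qed.

Let psi_xi w : psi w (xi w) = y k w.
Proof. by congr euler; apply/funext => i; rewrite subrK. Qed.

Let response_gt0 : 0 < response_bound.
Proof. by rewrite mulr_gt0 ?divr_gt0 ?addr_gt0 ?invr_gt0. Qed.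

Let mxi : measurable_fun setT xi. Proof. exact: mblock. Qed.

Let mpsi u : measurable_fun setT (psi^~ u).
Proof.
have h : measurable_functional (fun z => euler b dl z k) by move=> d' T' U' mU'; exact: (euler_measurable _ db).
apply: (h _ _ (fun i w => Z i w - xi w * c i + u * c i)) => i.
by apply: measurable_funD => //; apply: measurable_funB => //; exact: measurable_funM.
Qed.

Let psi0_le w : `|psi w 0| <= `|y k w| + response_bound * `|xi w|.
Proof.
rewrite -[psi w 0](subKr (psi w (xi w))) psi_xi.
apply: le_trans (ler_normB _ _) _; rewrite lerD2l -psi_xi.
have [x0|/ltW x0] := leP 0 (xi w).
  have /andP[h1 h2] := psi_slope w x0; rewrite subr0 in h1 h2.
  by rewrite !ger0_norm// (le_trans _ h1)// divr_ge0.
have /andP[h1 h2] := psi_slope w x0; rewrite sub0r in h1 h2.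
rewrite distrC (ler0_norm x0) ger0_norm//.
by apply: le_trans h1; rewrite divr_ge0// oppr_ge0.
Qed.

(** Bounds the mean of |psi w 0|: moving the argument from [xi w] to 0 costs at most
    [response_bound * s] in mean, which equals [ou_moment]. *)
Definition residual_moment := euler_moment + ou_moment.

Let psi0i : P.-integrable setT (EFin \o psi^~ 0).
Proof.
apply: (@integrable_dominated _ _ _ P _ _ (mpsi 0) psi0_le).
apply: integrable_fD; first exact: integrable_norm.
by apply: integrable_fZ; apply: integrable_norm; exact: blocki.
Qed.

Let psi0_moment : \int[P]_w `|psi w 0| <= residual_moment.
Proof.
have i1 : P.-integrable setT (EFin \o (fun w => `|y k w|)) by exact: integrable_norm.
have i2 : P.-integrable setT (EFin \o (fun w => `|xi w|)).
  by apply: integrable_norm; exact: blocki.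
apply: (@le_trans _ _ (\int[P]_w (`|y k w| + response_bound * `|xi w|))).
  apply: le_Rintegral => //; first exact: integrable_norm.
  by apply: integrable_fD => //; exact: integrable_fZ.
rewrite RintegralD//; last exact: integrable_fZ.
rewrite lerD ?euler_first_moment// RintegralZl//.
have -> : ou_moment = response_bound * s.
  by rewrite /ou_moment /response_bound; field; rewrite !gt_eqF.
rewrite ler_pM2l//; apply: abs_moment_le; rewrite ?xi_var ?(ltW s0)//.
exact: block2.
Qed.

Variables (G : R -> R) (kappa u1 u2 eta : R).
Hypotheses (mG : measurable_fun setT G) (G_ge0 : forall x, 0 <= G x)
  (kappa0 : 0 <= kappa) (eta0 : 0 <= eta) (u12 : u1 < u2)
  (Gk : forall x, u1 <= x <= u2 -> kappa <= G x)
  (small_ball : forall a, `|a| <= 2 * (`|u1| + 2 * residual_moment) ->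
    (eta%:E <= P [set w | (a <= xi w <= a + (u2 - u1) / response_bound)%R])%E).

(* The residuals Z i - c i xi are independent of xi, which can therefore be
   replaced by an independent copy. *)
Lemma resampling :
  (\int[P]_w (G (y k w))%:E = \int[PP]_x (G (psi x.1 (xi x.2)))%:E)%E.
Proof.
symmetry.
apply: (@law_transfer R _ _ PP _ _ P N
  (fun i x => (Z i x.1 - xi x.1 * c i) + xi x.2 * c i) Z _ _ _
  (fun z => G (euler b dl z k))) => //.
- move=> i; apply: measurable_funD.
    apply: measurable_funB; first exact: measurableT_comp.
    by apply: measurable_funM => //; exact: measurableT_comp.
  by apply: measurable_funM => //; exact: measurableT_comp.
- move=> a g; case: (gZ) => _ _ ->.
  (* [K * s ^ 2] is the covariance of the linear form with [xi]. The form minus [K * xi] is thus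
     orthogonal to [K * xi], and the two variances add up to that of the form. *)
  pose K := \sum_(i < N) a i * c i.
  transitivity (\int[PP]_x cos (\sum_(i < N) (a i - K * e i) * Z i x.1 +
    \sum_(i < N) (K * e i) * Z i x.2 + g)).
    apply: eq_Rintegral => x _; congr (cos (_ + _)).
    under [X in _ = X + _]eq_bigr do rewrite mulrBl -mulrA.
    under [X in _ = _ + X]eq_bigr do rewrite -mulrA.
    rewrite sumrB -!mulr_sumr -!xiE /K !mulr_suml -sumrB -big_split/=.
    by apply: eq_bigr => i _; ring.
  have := gaussian_pair_char gZ (fun i => a i - K * e i) (fun i => K * e i) g.
  rewrite /= => ->; congr (_ * expR (- _ / 2)).
  pose La w := \sum_(i < N) a i * Z i w.
  have E1 w : \sum_(i < N) (a i - K * e i) * Z i w = La w - K * xi w.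
    under eq_bigr do rewrite mulrBl -mulrA.
    by rewrite sumrB -mulr_sumr -xiE.
  have E2 w : \sum_(i < N) (K * e i) * Z i w = K * xi w.
    by under eq_bigr do rewrite -mulrA; rewrite -mulr_sumr -xiE.
  under eq_Rintegral do rewrite E1.
  under [X in _ + X]eq_Rintegral do rewrite E2.
  have i1 : P.-integrable setT (EFin \o (fun w => La w ^+ 2)).
    exact: (integrable_comb_sqr gZ).
  have i2 : P.-integrable setT (EFin \o (fun w => La w * xi w)).
    have := integrable_comb_mul gZ a e; apply: eq_integrable => // w _ /=.
    by rewrite -xiE.
  have i3 : P.-integrable setT (EFin \o (fun w => xi w ^+ 2)) by exact: block2.
  have EK : \int[P]_w (La w * xi w) = K * s ^+ 2.
    transitivity (\int[P]_w (\sum_(i < N) a i * (Z i w * xi w))).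
      by apply: eq_Rintegral => w _; rewrite /La mulr_suml; apply: eq_bigr => i _; rewrite mulrA.
    rewrite (@Rintegral_sum _ _ _ P N (fun i w => a i * (Z i w * xi w))); last first.
      by move=> i; exact: integrable_fZ.
    rewrite /K mulr_suml; apply: eq_bigr => i _; rewrite RintegralZl//.
    by rewrite /c -mulrA divfK// gt_eqF.
  rewrite (_ : \int[P]_w (La w - K * xi w) ^+ 2 = \int[P]_w La w ^+ 2 - K ^+ 2 * s ^+ 2).
    rewrite (_ : \int[P]_w (K * xi w) ^+ 2 = K ^+ 2 * s ^+ 2) ?subrK//.
    under eq_Rintegral do rewrite exprMn.
    by rewrite RintegralZl// xi_var.
  transitivity (\int[P]_w (La w ^+ 2 + (- (2 * K) * (La w * xi w) + K ^+ 2 * xi w ^+ 2))).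
    by apply: eq_Rintegral => w _; ring.
  have j2 := integrable_fZ (- (2 * K)) i2; have j3 := integrable_fZ (K ^+ 2) i3.
  rewrite RintegralD//; last exact: integrable_fD.
  rewrite RintegralD// !RintegralZl// EK xi_var; ring.
- by move=> z z' zz'; congr G; apply: euler_local => i ik; rewrite zz'// (leq_trans ik).
- by move=> d' T' U mU; apply: measurableT_comp => //; exact: (euler_measurable _ db).
Qed.

(** By Markov's inequality |psi w 0| <= 2 * [residual_moment] with probability at least 1/2. For
    each such [w], an independent copy of [xi] falls with probability at least [eta] into an
    interval that [psi w] sends into [u1, u2], where [G] is at least [kappa]. *)
Lemma mean_lower_bound :
  ((kappa * eta / 2)%:E <= \int[P]_w (G (y k w))%:E)%E.
Proof.
have m2 : measurable_fun setT (fun x : T * T => (G (psi x.1 (xi x.2)))%:E).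
  apply/measurable_EFinP; apply: measurableT_comp => //.
  have h : measurable_functional (fun z => euler b dl z k) by move=> d' T' U' mU'; exact: (euler_measurable _ db).
  apply: (h _ _ (fun i (x : T * T) => (Z i x.1 - xi x.1 * c i) + xi x.2 * c i)) => i.
  apply: measurable_funD.
    apply: measurable_funB; first exact: measurableT_comp.
    by apply: measurable_funM => //; exact: measurableT_comp.
  by apply: measurable_funM => //; exact: measurableT_comp.
rewrite resampling fubini_tonelli1//; last by move=> x; rewrite lee_fin.
have rm0 : 0 < residual_moment.
  have q0 : 0 < ou_moment by rewrite mulr_gt0 ?addr_gt0 ?invr_gt0.
  rewrite /residual_moment /euler_moment -addrA ltr_wpDl ?addr_gt0//.
  rewrite divr_ge0 ?(ltW M0)// /drift_moment addr_ge0// mulr_ge0 ?(ltW q0)//.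
  by rewrite addr_ge0// ltW.
set good := [set w | `|psi w 0| <= 2 * residual_moment].
have Pgood := markov_half (mpsi 0) psi0i rm0 psi0_moment.
have mgood : measurable good.
  rewrite (_ : good = (fun w => `|psi w 0|) @^-1` `]-oo, (2 * residual_moment)]); last first.
    by apply/seteqP; split => w /=; rewrite in_itv.
  by rewrite -[_ @^-1` _]setTI; apply: (measurableT_comp (@normr_measurable R setT) (mpsi 0)).
have ke : 0 <= kappa * eta by rewrite mulr_ge0.
apply: (@le_trans _ _ ((kappa * eta)%:E * P good)%E).
  by rewrite EFinM; apply: lee_wpmul2l; rewrite ?lee_fin.
have -> : P good = (\int[P]_w (\1_good w)%:E)%E by rewrite integral_indic// setIT.
rewrite -ge0_integralZl//; last by apply/measurable_EFinP; exact: measurable_indic.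
apply: ge0_le_integral => //.
- by move=> w _; rewrite mule_ge0// lee_fin.
- by apply/measurable_EFinP; apply: measurable_funM => //; exact: measurable_indic.
- by apply: measurable_fun_fubini_tonelli_F => // x; rewrite lee_fin.
move=> w _; rewrite indicE /fubini_F.
have [/set_mem gw|_] := boolP (w \in good); last first.
  by rewrite mule0; apply: integral_ge0 => w' _; rewrite lee_fin.
rewrite mule1 /=.
have [a [ab ag]] := slope_interval response_gt0 (@psi_slope w) gw u12.
set D := [set w' | a <= xi w' <= a + (u2 - u1) / response_bound].
have mD : measurable D.
  rewrite (_ : D = xi @^-1` `[a, (a + (u2 - u1) / response_bound)]); last first.
    by apply/seteqP; split => w' /=; rewrite in_itv.
  by rewrite -[_ @^-1` _]setTI; exact: mxi.
have PD := small_ball ab.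
apply: (@le_trans _ _ (kappa%:E * P D)%E).
  by rewrite EFinM; apply: lee_wpmul2l; rewrite ?lee_fin.
have -> : P D = (\int[P]_w' (\1_D w')%:E)%E by rewrite integral_indic// setIT.
rewrite -ge0_integralZl//; last by apply/measurable_EFinP; exact: measurable_indic.
apply: ge0_le_integral => //.
- by move=> w' _; rewrite mule_ge0// lee_fin.
- by apply/measurable_EFinP; apply: measurable_funM => //; exact: measurable_indic.
- exact: (measurableT_comp m2 (@pair1_measurable _ _ T T w)).
move=> w' _; rewrite -EFinM lee_fin indicE.
have [/set_mem h|_] := boolP (w' \in D); last by rewrite mulr0.
by rewrite mulr1; apply: Gk; exact: ag.
Qed.

End fixed_time.
End mean_lower_bound.

(** * Increments of fractional Brownian motion *)

Section fractional_brownian_increments.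
Context d (Omega : measurableType d) (R : realType) (P : probability Omega R).
Variables (H : R) (B : R -> {RV P >-> R}).
Hypotheses (hH : 1 / 2 < H < 1) (gB : gaussian_process B)
  (EB : forall t : R, 0 <= t -> ('E_P[B t] = 0)%E)
  (covB : forall s t : R, 0 <= s -> 0 <= t -> covariance P (B s) (B t) =
    ((s `^ (2 * H) + t `^ (2 * H) - `|t - s| `^ (2 * H)) / 2)%:E).

Let p := 2 * H.
Let p1 : 1 < p. Proof. by rewrite /p; case/andP: hH; lra. Qed.
Let p2 : p < 2. Proof. by rewrite /p; case/andP: hH; lra. Qed.
Let p0 : p != 0. Proof. by rewrite gt_eqF// (lt_trans _ p1). Qed.

Let mB t : measurable_fun setT (B t). Proof. exact: measurable_funPT. Qed.

Let covBE s t : 0 <= s -> 0 <= t ->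
  (\int[P]_w (B s w * B t w)%:E = ((s `^ p + t `^ p - `|t - s| `^ p) / 2)%:E)%E.
Proof.
move=> s0 t0; rewrite -covB// unlock !EB//= unlock.
by apply: eq_integral => w _; rewrite !fctE /= !subr0.
Qed.

(** The covariance formula at s = t is an equality of extended reals with a finite right-hand side,
    and [B t] is centered. *)
Lemma fbm_square_integrable t : 0 <= t ->
  P.-integrable setT (EFin \o (fun w => B t w ^+ 2)).
Proof.
move=> t0; apply/integrableP; split.
  by apply/measurable_EFinP; exact: measurable_funX.
under eq_integral do rewrite /= ger0_norm ?sqr_ge0// expr2.
by rewrite covBE// ltry.
Qed.

Lemma fbm_covariance s t : 0 <= s -> 0 <= t ->
  \int[P]_w (B s w * B t w) = (s `^ p + t `^ p - `|t - s| `^ p) / 2.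
Proof. by move=> s0 t0; rewrite /Rintegral covBE. Qed.

Lemma fbm_increment_square_integrable s t : 0 <= s -> 0 <= t ->
  P.-integrable setT (EFin \o (fun w => (B t w - B s w) ^+ 2)).
Proof.
move=> s0 t0; apply: (@integrable_dominated _ _ _ P _
    (fun w => 2 * (B t w ^+ 2 + B s w ^+ 2))).
- by apply: measurable_funX; exact: measurable_funB.
- by move=> w; rewrite ger0_norm ?sqr_ge0//; have := sqr_ge0 (B t w + B s w); nra.
- by apply: integrable_fZ; apply: integrable_fD; exact: fbm_square_integrable.
Qed.

Lemma fbm_increment_covariance s t u v : 0 <= s -> 0 <= t -> 0 <= u -> 0 <= v ->
  \int[P]_w ((B t w - B s w) * (B v w - B u w)) =
  (`|v - s| `^ p + `|u - t| `^ p - `|v - t| `^ p - `|u - s| `^ p) / 2.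
Proof.
move=> s0 t0 u0 v0.
have I x y : 0 <= x -> 0 <= y -> P.-integrable setT (EFin \o (fun w => B x w * B y w)).
  by move=> x0 y0; apply: integrable_mul_square => //; exact: fbm_square_integrable.
transitivity (\int[P]_w ((B t w * B v w - B t w * B u w) -
    (B s w * B v w - B s w * B u w))).
  by apply: eq_Rintegral => w _; ring.
rewrite RintegralB//; last 2 first.
- by apply: integrable_fB; exact: I.
- by apply: integrable_fB; exact: I.
rewrite !RintegralB//; try exact: I.
by rewrite !fbm_covariance//; field.
Qed.

Lemma fbm_increment_variance s t : 0 <= s -> 0 <= t ->
  \int[P]_w (B t w - B s w) ^+ 2 = `|t - s| `^ p.
Proof.
move=> s0 t0; transitivity (\int[P]_w ((B t w - B s w) * (B t w - B s w))).
  by apply: eq_Rintegral => w _; rewrite expr2.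
by rewrite fbm_increment_covariance// !subrr normr0 powR0// (distrC s); field.
Qed.

Lemma fbm_increment_mean s t : 0 <= s -> 0 <= t -> \int[P]_w (B t w - B s w) = 0.
Proof.
move=> s0 t0; have E x : 0 <= x -> \int[P]_w B x w = 0.
  by move=> x0; have := EB x0; rewrite unlock /Rintegral => ->.
by rewrite RintegralB ?E ?subrr//; apply: integrable_square_integrable => //;
  exact: fbm_square_integrable.
Qed.

Lemma powR_midpoint x y : 0 <= x -> 0 <= y ->
  (2^-1 * x + 2^-1 * y) `^ p <= 2^-1 * x `^ p + 2^-1 * y `^ p.
Proof.
move=> x0 y0; rewrite {2 4}(_ : 2^-1 = 1 - 2^-1); last by field.
by apply: (convex_powR (ltW p1) (Itv01 _ _)) => //=;
  rewrite ?inE/= ?in_itv/= ?x0 ?y0// ?invr_ge0// invf_le1 ?ler1n.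
Qed.

Variables (sigma dl : R).
Hypothesis dl0 : 0 < dl.

Definition noise i w := sigma * (B (i.+1%:R * dl) w - B (i%:R * dl) w).

Let g0 (i : nat) : 0 <= i%:R * dl. Proof. by rewrite mulr_ge0// ltW. Qed.

Lemma noise_measurable i : measurable_fun setT (noise i).
Proof. by apply: measurable_funM => //; exact: measurable_funB. Qed.

Lemma noise_square_integrable i : P.-integrable setT (EFin \o (fun w => noise i w ^+ 2)).
Proof.
have := integrable_fZ (sigma ^+ 2) (fbm_increment_square_integrable (g0 i) (g0 i.+1)).
by apply: eq_integrable => // w _; rewrite /noise /= exprMn.
Qed.

(** At lag k + 1 the covariance is a nonnegative multiple of (k + 2)^p + k^p - 2 (k + 1)^p with p =
    2H, a second difference of a convex function. *)
Lemma noise_covariance_ge0 i j : 0 <= \int[P]_w (noise i w * noise j w).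
Proof.
wlog ij : i j / (i <= j)%N.
  move=> h; have [/h//|/ltnW/h] := leqP i j.
  by under eq_Rintegral do rewrite mulrC.
rewrite (_ : \int[P]_w _ = sigma ^+ 2 * \int[P]_w ((B (i.+1%:R * dl) w - B (i%:R * dl) w) *
    (B (j.+1%:R * dl) w - B (j%:R * dl) w))); last first.
  rewrite -RintegralZl//.
    by apply: eq_Rintegral => w _; rewrite /noise; ring.
  by apply: integrable_mul_square; [exact: measurable_funB|exact: measurable_funB|
    exact: fbm_increment_square_integrable|exact: fbm_increment_square_integrable].
rewrite mulr_ge0 ?sqr_ge0// fbm_increment_covariance// divr_ge0//.
have [jE|ji] := eqVneq i j.
  by rewrite jE !subrr normr0 powR0// !subr0 addr_ge0 ?powR_ge0.
have {ij ji} ij : (i < j)%N by rewrite ltn_neqAle ji.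
have [k kE] : exists k, j = (i + k.+1)%N.
  by exists (j - i.+1)%N; rewrite addnS -addSn subnKC.
have e1 : j.+1%:R * dl - i%:R * dl = k.+2%:R * dl.
  by rewrite kE -mulrBl -addnS natrD addrAC subrr add0r.
have e2 : j%:R * dl - i.+1%:R * dl = k%:R * dl.
  by rewrite kE addnS -addSn -mulrBl natrD addrAC subrr add0r.
have e3 : j.+1%:R * dl - i.+1%:R * dl = k.+1%:R * dl.
  by rewrite kE -addSn -mulrBl natrD addrAC subrr add0r.
have e4 : j%:R * dl - i%:R * dl = k.+1%:R * dl.
  by rewrite kE -mulrBl natrD addrAC subrr add0r.
rewrite e1 e2 e3 e4 !ger0_norm//.
have := powR_midpoint (g0 k.+2) (g0 k).
rewrite (_ : 2^-1 * (k.+2%:R * dl) + 2^-1 * (k%:R * dl) = k.+1%:R * dl); first by lra.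
by rewrite -!natr1; field.
Qed.

Lemma noise_block k j w : (j <= k)%N ->
  \sum_(i < j) noise (k - i.+1)%N w = sigma * (B (k%:R * dl) w - B ((k - j)%:R * dl) w).
Proof.
elim: j => [|j ih] jk; first by rewrite big_ord0 subn0 subrr mulr0.
rewrite big_ord_recr/= ih ?(ltnW jk)// /noise -subSn// subSS; ring.
Qed.

Lemma noise_block_variance k j : (j <= k)%N ->
  \int[P]_w (\sum_(i < j) noise (k - i.+1)%N w) ^+ 2 = sigma ^+ 2 * (j%:R * dl) `^ p.
Proof.
move=> jk; under eq_Rintegral do rewrite noise_block// exprMn.
rewrite RintegralZl//; last exact: fbm_increment_square_integrable.
rewrite fbm_increment_variance// -mulrBl natrB// opprB addrC subrK.
by rewrite ger0_norm.
Qed.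

Lemma noise_sum_variance n :
  \int[P]_w (\sum_(i < n) noise i w) ^+ 2 = sigma ^+ 2 * (n%:R * dl) `^ p.
Proof.
rewrite -(noise_block_variance (leqnn n)); apply: eq_Rintegral => w _.
congr (_ ^+ 2); rewrite (reindex_inj rev_ord_inj)/=.
by apply: eq_bigr.
Qed.

(** The summand 1 brings the base above 1, where the exponent 2H < 2 may be raised to 2. *)
Lemma noise_block_variance_le k j : (j <= k)%N ->
  \int[P]_w (\sum_(i < j) noise (k - i.+1)%N w) ^+ 2 <= (`|sigma| * (1 + j%:R * dl)) ^+ 2.
Proof.
move=> jk; rewrite noise_block_variance// exprMn real_normK ?num_real//.
rewrite ler_wpM2l ?sqr_ge0//; have x0 := g0 j.
apply: (@le_trans _ _ ((1 + j%:R * dl) `^ p)).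
  by rewrite ge0_ler_powR// ?nnegrE ?addr_ge0// ?lerDr// ltW// (lt_trans _ p1).
by rewrite -powR_mulrn ?addr_ge0// ler_powR ?lerDl// ltW.
Qed.

Lemma noise_comb_gaussian n (a : nat -> R) :
  gaussian_rv P (fun w => \sum_(i < n) a i * noise i w).
Proof.
(* Each increment is split into two values of [B]: the first half of the indices carries the right
   endpoints, the second half the left endpoints with the opposite sign. *)
pose al (k : 'I_(n + n)) :=
  match fintype.split k with inl i => a i * sigma | inr i => - (a i * sigma) end.
pose t (k : 'I_(n + n)) :=
  match fintype.split k with inl i => i.+1%:R * dl | inr i => i%:R * dl end.
have t0 k : 0 <= t k by rewrite /t; case: fintype.split => i; exact: g0.
have := gB al t0; congr (gaussian_rv P); apply/funext => w.
rewrite big_split_ord/= -big_split/=; apply: eq_bigr => i _.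
rewrite /al /t (_ : fintype.split (lshift n i) = inl i); last exact: (unsplitK (inl i)).
rewrite (_ : fintype.split (rshift n i) = inr i); last exact: (unsplitK (inr i)).
by rewrite /noise; ring.
Qed.

Lemma noise_comb_mean n (a : nat -> R) :
  \int[P]_w (\sum_(i < n) a i * noise i w) = 0.
Proof.
have ni i : P.-integrable setT (EFin \o noise i).
  by apply: integrable_square_integrable;
    [exact: noise_measurable|exact: noise_square_integrable].
rewrite (@Rintegral_sum _ _ _ P n (fun i w => a i * noise i w)); last first.
  by move=> i; exact: integrable_fZ.
rewrite big1// => i _; rewrite RintegralZl// /noise RintegralZl//; last first.
  apply: integrable_square_integrable; first exact: measurable_funB.
  exact: fbm_increment_square_integrable.
by rewrite fbm_increment_mean// !mulr0.
Qed.

Lemma noise_comb_square_integrable n (a : nat -> R) :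
  P.-integrable setT (EFin \o (fun w => (\sum_(i < n) a i * noise i w) ^+ 2)).
Proof.
apply: (@integrable_sqr_sum _ _ _ P n (fun i w => a i * noise i w)).
  by move=> i; apply: measurable_funM => //; exact: noise_measurable.
move=> i; have := integrable_fZ (a i ^+ 2) (noise_square_integrable i).
by apply: eq_integrable => // w _; rewrite /= -exprMn.
Qed.

Lemma noise_centered_gaussian n : centered_gaussian P n noise.
Proof.
split; [exact: noise_measurable|exact: noise_square_integrable|].
move=> a c.
have mY : measurable_fun setT (fun w => \sum_(i < n) a i * noise i w).
  by apply: measurable_sum => i; apply: measurable_funM => //; exact: noise_measurable.
pose Ymf := isMeasurableFun.Build _ _ Omega R _ mY.
pose Y : {mfun Omega >-> R} := HB.pack (fun w => \sum_(i < n) a i * noise i w) Ymf.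
exact: (@gaussian_char _ _ _ P Y (noise_comb_square_integrable n a) c
  (noise_comb_gaussian n a) (noise_comb_mean n a)).
Qed.

Lemma noise_block_small_ball (s rho l a : R) k j : (j <= k)%N -> 0 < s ->
  sigma ^+ 2 * (j%:R * dl) `^ p = s ^+ 2 -> 0 <= l -> `|a| <= rho ->
  ((normal_peak s * expR (- (rho + l) ^+ 2 / (s ^+ 2 *+ 2)) * l)%:E <=
   P [set w | (a <= \sum_(i < j) noise (k - i.+1)%N w <= a + l)%R])%E.
Proof.
move=> jk s0 sE l0 arho.
(* The block becomes a combination of the first [k] increments with 0-1 coefficients, hence a
   Gaussian variable. *)
pose e i : R := if (k - j <= i < k)%N then 1 else 0.
have blockE w : \sum_(i < k) e i * noise i w = \sum_(i < j) noise (k - i.+1)%N w.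
  rewrite (reindex_inj rev_ord_inj)/=.
  rewrite (big_ord_widen _ (fun i => noise (k - i.+1)%N w) jk) [RHS]big_mkcond/=.
  apply: eq_bigr => i _; rewrite /e ltn_subrL/= (leq_ltn_trans _ (ltn_ord i))// andbT.
  have ik := ltn_ord i.
  rewrite (_ : (k - j <= k - i.+1)%N = (i < j)%N); last by rewrite leq_sub2lE.
  by case: ifP => _; rewrite ?mul1r ?mul0r.
have mY : measurable_fun setT (fun w => \sum_(i < k) e i * noise i w).
  by apply: measurable_sum => i; apply: measurable_funM => //; exact: noise_measurable.
pose Ymf := isMeasurableFun.Build _ _ Omega R _ mY.
pose Y : {mfun Omega >-> R} := HB.pack (fun w => \sum_(i < k) e i * noise i w) Ymf.
have V : \int[P]_w Y w ^+ 2 = s ^+ 2.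
  rewrite -sE -(noise_block_variance jk); apply: eq_Rintegral => w _.
  by rewrite -blockE.
have := @gaussian_small_ball _ _ _ P Y (noise_comb_square_integrable k e) s rho l a
  (noise_comb_gaussian k e) (noise_comb_mean k e) s0 V l0 arho.
rewrite (_ : [set w | (a <= Y w <= a + l)%R] =
  [set w | (a <= \sum_(i < j) noise (k - i.+1)%N w <= a + l)%R])//.
by apply/seteqP; split => w /=; rewrite -blockE.
Qed.

End fractional_brownian_increments.

(** * Quadratic variation and the Young integral *)

Section partition_sums.
Context (R : realType).
Implicit Types (phi : R -> R -> R) (a b : R) (s : seq R).

(** The recursive counterpart of indexed sums such as [left_riemann_sum], suited to induction on the
    list of points. *)
Fixpoint partition_sum phi a s :=
  if s is b :: s' then phi a b + partition_sum phi b s' else 0.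

Lemma path_lt_last a s : path <%R a s -> a <= last a s.
Proof.
elim: s a => [|b s ih] a //= /andP[ab bs].
by apply: le_trans (ltW ab) (ih _ bs).
Qed.

Definition small_steps (e : R) a s :=
  forall i, (i < size s)%N -> nth 0 (a :: s) i.+1 - nth 0 (a :: s) i < e.

Lemma small_steps_cons e a b s : small_steps e a (b :: s) -> b - a < e /\ small_steps e b s.
Proof. by move=> h; split; [exact: (h 0%N)|move=> i si; exact: (h i.+1)]. Qed.

Lemma partition_sum_le phi psi e T a s : path <%R a s -> small_steps e a s ->
  0 <= a -> last a s <= T ->
  (forall x y, 0 <= x -> x < y -> y <= T -> y - x < e -> phi x y <= psi x y) ->
  partition_sum phi a s <= partition_sum psi a s.
Proof.
move=> + + + + h; elim: s a => [//|b s ih] a /= /andP[ab bs] /small_steps_cons[e1 e2] a0 lT.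
rewrite lerD ?ih//; last by rewrite (le_trans a0)// ltW.
by apply: h => //; apply: le_trans lT; exact: path_lt_last.
Qed.

Lemma partition_sumD phi psi a s :
  partition_sum (fun x y => phi x y + psi x y) a s =
  partition_sum phi a s + partition_sum psi a s.
Proof. by elim: s a => [|b s ih] a /=; rewrite ?addr0// ih addrACA. Qed.

Lemma partition_sumZ k phi a s :
  partition_sum (fun x y => k * phi x y) a s = k * partition_sum phi a s.
Proof. by elim: s a => [|b s ih] a /=; rewrite ?mulr0// ih mulrDr. Qed.

Lemma partition_sum_telescope (g : R -> R) a s :
  partition_sum (fun x y => g y - g x) a s = g (last a s) - g a.
Proof. by elim: s a => [|b s ih] a /=; rewrite ?subrr// ih addrC subrKA. Qed.

Lemma partition_sum_cvg (phi : nat -> R -> R -> R) psi a s : 0 <= a ->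
  path <%R a s -> (forall x y, 0 <= x -> x < y -> phi n x y @[n --> \oo] --> psi x y) ->
  partition_sum (phi n) a s @[n --> \oo] --> partition_sum psi a s.
Proof.
move=> + + h; elim: s a => [|b s ih] a a0 /=; first by move=> _; exact: cvg_cst.
move=> /andP[ab bs]; apply: (@cvgD _ R^o); first exact: h.
by apply: ih => //; rewrite (le_trans a0)// ltW.
Qed.

End partition_sums.

(** * Quadratic variation along arbitrary partitions by dyadic chaining *)

Section dyadic_chaining.
Context (R : realType) (f : R -> R) (z : R).
Hypotheses (cf : continuous f) (z0 : 0 < z) (z1 : z < 1).

Definition dyadic_floor m (t : R) := Num.truncn (t * 2 ^+ m).
Definition dyadic_increment m k : R := f (k.+1%:R / 2 ^+ m) - f (k%:R / 2 ^+ m).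
Definition dyadic_variation m (T : R) : R :=
  \sum_(k < dyadic_floor m T) dyadic_increment m k ^+ 2.

Local Notation c := dyadic_floor.
Local Notation inc := dyadic_increment.

Let p2 m : 0 < 2 ^+ m :> R. Proof. exact: exprn_gt0. Qed.

Lemma dyadic_floor_itv m t : 0 <= t ->
  (c m t)%:R / 2 ^+ m <= t < (c m t).+1%:R / 2 ^+ m.
Proof.
move=> t0; rewrite ler_pdivrMr// ltr_pdivlMr//.
by apply: truncn_itv; rewrite mulr_ge0// ltW.
Qed.

Lemma dyadic_floor_le m s t : s <= t -> (c m s <= c m t)%N.
Proof. by move=> st; apply: le_truncn; rewrite ler_pM2r. Qed.

Lemma dyadic_floorS m t : 0 <= t ->
  c m.+1 t = (c m t).*2 \/ c m.+1 t = (c m t).*2.+1.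
Proof.
move=> t0; have /andP[h1 h2] := dyadic_floor_itv m t0.
rewrite ler_pdivrMr// in h1; rewrite ltr_pdivlMr// in h2.
set k := c m t in h1 h2 *.
have E n : (c m.+1 t == n) = (n%:R <= t * 2 ^+ m.+1 < n.+1%:R).
  by rewrite /c truncn_eq// mulr_ge0// ltW.
have e2 : t * 2 ^+ m.+1 = 2 * (t * 2 ^+ m) by rewrite exprS; ring.
have k2 : k.*2%:R = 2 * k%:R :> R by rewrite -mul2n natrM.
have [h|h] := ltP (t * 2 ^+ m.+1) (k.*2.+1)%:R; [left|right]; apply/eqP; rewrite E.
  by rewrite h andbT e2 k2 ler_pM2l.
by rewrite h e2 /= -doubleS -mul2n natrM ltr_pM2l.
Qed.

Let pt2 m k : k.*2%:R / 2 ^+ m.+1 = k%:R / 2 ^+ m :> R.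
Proof. by rewrite -mul2n natrM exprS; field; rewrite gt_eqF. Qed.

(* The increment of f between the extreme dyadic points of level m in ]s, t]. *)
Let D m s t : R := if (c m s < c m t)%N
  then f ((c m t)%:R / 2 ^+ m) - f ((c m s).+1%:R / 2 ^+ m) else 0.

(** A finer level adds at most one dyadic increment at each end of the interval, both with an index
    strictly between the two dyadic floors. The cases are the parities given by [dyadic_floorS]. *)
Let D_step m s t Q : 0 <= s -> s <= t -> 0 <= Q ->
  (forall k, (c m.+1 s < k < c m.+1 t)%N -> `|inc m.+1 k| <= Q) ->
  `|D m.+1 s t - D m s t| <= 2 * Q.
Proof.
move=> s0 st Q0 hQ; have t0 := le_trans s0 st; rewrite /D.
have Q2 : 0 <= 2 * Q by rewrite mulr_ge0.
have [cm|cm] := ltnP (c m s) (c m t); last first.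
  rewrite subr0; have [cm'|_] := ltnP (c m.+1 s) (c m.+1 t); last by rewrite normr0.
  have -> : c m.+1 t = (c m.+1 s).+1.
    move: cm'; have [->|->] := dyadic_floorS m s0; have [->|->] := dyadic_floorS m t0;
      rewrite -!muln2; move: cm; set u := c m s; set v := c m t; lia.
  by rewrite subrr normr0.
have cm' : (c m.+1 s < c m.+1 t)%N.
  have [->|->] := dyadic_floorS m s0; have [->|->] := dyadic_floorS m t0;
    rewrite -!muln2; move: cm; set u := c m s; set v := c m t; lia.
rewrite cm' -(pt2 m (c m t)) -(pt2 m (c m s).+1).
have rt : `|f ((c m.+1 t)%:R / 2 ^+ m.+1) - f ((c m t).*2%:R / 2 ^+ m.+1)| <= Q.
  have [e|e] := dyadic_floorS m t0; first by rewrite e subrr normr0.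
  rewrite e; apply: hQ; rewrite e ltnSn andbT.
  have [->|->] := dyadic_floorS m s0; rewrite -!muln2; move: cm;
    set u := c m s; set v := c m t; lia.
have lt : `|f ((c m s).+1.*2%:R / 2 ^+ m.+1) - f ((c m.+1 s).+1%:R / 2 ^+ m.+1)| <= Q.
  have [e|e] := dyadic_floorS m s0; last by rewrite doubleS e subrr normr0.
  rewrite doubleS e; apply: hQ; rewrite e ltnSn/=.
  have [->|->] := dyadic_floorS m t0; rewrite -!muln2; move: cm;
    set u := c m s; set v := c m t; lia.
rewrite (_ : _ - _ - (_ - _) =
  (f ((c m.+1 t)%:R / 2 ^+ m.+1) - f ((c m t).*2%:R / 2 ^+ m.+1)) +
  (f ((c m s).+1.*2%:R / 2 ^+ m.+1) - f ((c m.+1 s).+1%:R / 2 ^+ m.+1))); last by ring.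
rewrite (_ : 2 * Q = Q + Q); last by ring.
by apply: le_trans (ler_normD _ _) _; rewrite lerD.
Qed.

(** [w] sums the squared dyadic increments of level m that lie inside [s, t]. The weight z^(-2m) in
    [W] makes each of them at most z^m times the square root of [W], a geometric bound in m. *)
Let w m s t : R := \sum_((c m s).+1 <= k < c m t) inc m k ^+ 2.
Let W n s t : R := \sum_(m < n) (z ^- 2) ^+ m * w m s t.

Let w_ge0 m s t : 0 <= w m s t.
Proof. by apply: sumr_ge0 => k _; exact: sqr_ge0. Qed.

(** An interval ]s, t] shorter than 2^-N contains at most one dyadic point of level N. *)
Let D_start N s t : 0 <= s -> s <= t -> t - s < 2 ^- N -> D N s t = 0.
Proof.
move=> s0 st ts; rewrite /D; case: ltnP => // ct.
have t0 := le_trans s0 st.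
have /andP[h1 h2] := dyadic_floor_itv N t0; have /andP[h3 h4] := dyadic_floor_itv N s0.
have -> : c N t = (c N s).+1.
  apply/eqP; rewrite eqn_leq ct andbT -ltnS -(ltr_nat R).
  rewrite -(ltr_pM2r (_ : 0 < 2 ^- N)) ?invr_gt0//.
  apply: le_lt_trans h1 _; rewrite -natr1 mulrDl mul1r.
  by move: ts h4; lra.
by rewrite subrr.
Qed.

(** Chaining starts at level [N], where [D] vanishes, with steps of at most 2 z^m sqrt(W), whose
    geometric sum is of order z^N. The factor 1 - z stays on the left to avoid a division. *)
Let D_bound N n s t : 0 <= s -> s <= t -> t - s < 2 ^- N ->
  ((1 - z) * D (N + n) s t) ^+ 2 <= 4 * (z ^+ N) ^+ 2 * W (N + n).+1 s t.
Proof.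
move=> s0 st ts; set S := Num.sqrt (W (N + n).+1 s t).
have z2 : 0 < z ^- 2 by rewrite invr_gt0 exprn_gt0.
have W0 : 0 <= W (N + n).+1 s t.
  by apply: sumr_ge0 => m _; rewrite mulr_ge0// exprn_ge0// ltW.
have S0 : 0 <= S by exact: sqrtr_ge0.
have incS m k : (m <= N + n)%N -> (c m s < k < c m t)%N -> `|inc m k| <= z ^+ m * S.
  move=> mn kin; rewrite -(@ler_pXn2r _ 2)// ?nnegrE ?mulr_ge0 ?exprn_ge0 ?(ltW z0)//.
  rewrite exprMn sqr_sqrtr// real_normK ?num_real//.
  apply: (@le_trans _ _ (w m s t)).
    rewrite /w (bigD1_seq k) ?mem_index_iota ?iota_uniq//=.
    by rewrite lerDl sumr_ge0// => j _; exact: sqr_ge0.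
  rewrite -exprM mulnC exprM -ler_pdivrMl ?exprn_gt0//.
  rewrite /W (bigD1 (Ordinal (mn : (m < (N + n).+1)%N)))//= -exprVn lerDl.
  by apply: sumr_ge0 => j _; rewrite mulr_ge0// exprn_ge0// ltW.
have main j : (j <= n)%N -> (1 - z) * `|D (N + j) s t| <= 2 * S * (z ^+ N - z ^+ (N + j)).
  elim: j => [|j ih] jn; first by rewrite addn0 D_start// normr0 mulr0 subrr mulr0.
  have st1 : `|D (N + j).+1 s t - D (N + j) s t| <= 2 * (z ^+ (N + j).+1 * S).
    apply: D_step => //; first by rewrite mulr_ge0// exprn_ge0// ltW.
    by move=> k; apply: incS; rewrite -addnS leq_add2l.
  have {}ih := ih (ltnW jn).
  have tri : `|D (N + j).+1 s t| <= `|D (N + j) s t| + 2 * (z ^+ (N + j).+1 * S).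
    by rewrite -[D (N + j).+1 s t](subrK (D (N + j) s t)) addrC (le_trans (ler_normD _ _))// lerD2l.
  have z1' : 0 <= 1 - z by rewrite subr_ge0 ltW.
  rewrite addnS; apply: le_trans (ler_wpM2l z1' tri) _; rewrite mulrDr.
  apply: le_trans (lerD ih (lexx _)) _.
  rewrite exprS; set u := z ^+ (N + j).
  have u0 : 0 <= u by rewrite exprn_ge0// ltW.
  have Su : 0 <= S * u by rewrite mulr_ge0.
  have := mulr_ge0 Su z1'; nra.
have := main n (leqnn n) => h.
have {}h : (1 - z) * `|D (N + n) s t| <= 2 * S * z ^+ N.
  by apply: le_trans h _; rewrite ler_wpM2l ?mulr_ge0// gerBl exprn_ge0// ltW.
have z1' : 0 <= 1 - z by rewrite subr_ge0 ltW.
rewrite -[leLHS]ger0_norm ?sqr_ge0// normrX normrM (ger0_norm z1').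
have -> : 4 * (z ^+ N) ^+ 2 * W (N + n).+1 s t = (2 * S * z ^+ N) ^+ 2.
  by rewrite !exprMn sqr_sqrtr//; ring.
by rewrite lerXn2r// nnegrE ?mulr_ge0 ?exprn_ge0 ?(ltW z0).
Qed.

(** Distinct intervals of the partition contain distinct dyadic intervals. *)
Let partition_w m a s : path <%R a s ->
  partition_sum (w m) a s <= \sum_(c m a <= k < c m (last a s)) inc m k ^+ 2.
Proof.
elim: s a => [|b s ih] a /=; first by move=> _; rewrite big_geq.
move=> /andP[ab bs]; have cab := dyadic_floor_le m (ltW ab).
have cbl := dyadic_floor_le m (path_lt_last bs).
rewrite (big_cat_nat cab cbl)/= lerD ?ih// /w.
have [l|l] := ltnP (c m a) (c m b); first by rewrite [leRHS]big_ltn// lerDr sqr_ge0.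
by rewrite [leLHS]big_geq ?(leq_trans l)// sumr_ge0// => k _; exact: sqr_ge0.
Qed.

Let partition_W n a s : path <%R a s ->
  partition_sum (W n) a s <= \sum_(m < n) (z ^- 2) ^+ m * dyadic_variation m (last a s).
Proof.
move=> as_; have -> : partition_sum (W n) a s =
    \sum_(m < n) (z ^- 2) ^+ m * partition_sum (w m) a s.
  elim: n => [|n ih].
    rewrite big_ord0; elim: s a {as_} => [//|b s ih] a /=.
    by rewrite ih /W big_ord0 addr0.
  rewrite big_ord_recr/= -ih -partition_sumZ -partition_sumD; congr partition_sum.
  by apply/funext => x; apply/funext => y; rewrite /W big_ord_recr.
apply: ler_sum => m _; rewrite ler_wpM2l//.
  by rewrite exprn_ge0// invr_ge0 exprn_ge0// ltW.
apply: le_trans (partition_w m as_) _.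
rewrite /dyadic_variation -(big_mkord xpredT (fun k => inc m k ^+ 2)).
have ca := dyadic_floor_le m (path_lt_last as_).
rewrite [leRHS](big_cat_nat (leq0n (c m a)) ca)/= lerDr.
by apply: sumr_ge0 => k _; exact: sqr_ge0.
Qed.

Let inv_p2_cvg0 : (2 ^- n : R) @[n --> \oo] --> 0.
Proof.
under eq_fun do rewrite -exprVn.
by apply: cvg_expr; rewrite ger0_norm ?invr_ge0// invf_lt1 ?ltr1n.
Qed.

Let floor_cvg t : 0 <= t -> (c n t)%:R / 2 ^+ n @[n --> \oo] --> t.
Proof.
move=> t0; apply/cvgrPdist_le => e e0.
move/cvgrPdist_le : inv_p2_cvg0 => /(_ e e0); apply: filterS => n.
rewrite sub0r normrN ger0_norm ?invr_ge0 ?exprn_ge0// => h.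
have /andP[h1 h2] := dyadic_floor_itv n t0.
rewrite ger0_norm ?subr_ge0//; move: h2; rewrite -natr1 mulrDl mul1r; lra.
Qed.

Let ceil_cvg t : 0 <= t -> (c n t).+1%:R / 2 ^+ n @[n --> \oo] --> t.
Proof.
move=> t0; under eq_fun do rewrite -natr1 mulrDl mul1r.
have h : (c n t)%:R / 2 ^+ n + 2 ^- n @[n --> \oo] --> t + 0.
  by apply: (@cvgD _ R^o); [exact: floor_cvg|exact: inv_p2_cvg0].
by rewrite addr0 in h.
Qed.

Let D_cvg N s t : 0 <= s -> s < t -> D (N + n) s t @[n --> \oo] --> f t - f s.
Proof.
move=> s0 st; have t0 := le_trans s0 (ltW st).
have h : D n s t @[n --> \oo] --> f t - f s.
  have h1 : f ((c n t)%:R / 2 ^+ n) - f ((c n s).+1%:R / 2 ^+ n) @[n --> \oo] --> f t - f s.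
    apply: (@cvgB _ R^o).
      by apply: (cvg_comp _ _ (floor_cvg t0)); exact: cf.
    by apply: (cvg_comp _ _ (ceil_cvg s0)); exact: cf.
  apply: cvg_trans h1; apply: near_eq_cvg; near=> n.
  rewrite /D; suff -> : (c n s < c n t)%N by [].
  have hs : `|s - (c n s).+1%:R / 2 ^+ n| < (t - s) / 2.
    by near: n; move/cvgrPdist_lt : (ceil_cvg s0); apply; rewrite divr_gt0// subr_gt0.
  have ht : `|t - (c n t)%:R / 2 ^+ n| < (t - s) / 2.
    by near: n; move/cvgrPdist_lt : (floor_cvg t0); apply; rewrite divr_gt0// subr_gt0.
  rewrite -(ltr_nat R) -(ltr_pM2r (_ : 0 < 2 ^- n)) ?invr_gt0//.
  have : (c n s)%:R / 2 ^+ n <= (c n s).+1%:R / 2 ^+ n :> R by rewrite ler_pM2r ?invr_gt0// ler_nat.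
  by move: hs ht; rewrite !ltr_norml => /andP[? ?] /andP[? ?]; lra.
under eq_fun do rewrite addnC.
by have := h; rewrite -(cvg_shiftn N).
Unshelve. all: by end_near. Qed.

(** The chaining bound is summed over the partition, then the dyadic level tends to infinity, where
    [D] tends to the increment of [f] by continuity. The mesh enters only through z^N, and [C]
    bounds all partial sums of the weighted dyadic variations. *)
Lemma quadratic_variation_bound (T C : R) N s : path <%R 0 s -> last 0 s = T ->
  small_steps (2 ^- N) 0 s ->
  (forall n, \sum_(m < n) (z ^- 2) ^+ m * dyadic_variation m T <= C) ->
  (1 - z) ^+ 2 * partition_sum (fun x y => (f y - f x) ^+ 2) 0 s <=
  4 * (z ^+ N) ^+ 2 * C.
Proof.
move=> ps lT ss VC.
rewrite -partition_sumZ.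
have h : partition_sum (fun x y => ((1 - z) * D (N + n) x y) ^+ 2) 0 s @[n --> \oo] -->
    partition_sum (fun x y => (1 - z) ^+ 2 * (f y - f x) ^+ 2) 0 s.
  apply: partition_sum_cvg => // x y x0 xy.
  under eq_fun do rewrite exprMn.
  apply: cvgM; first exact: cvg_cst.
  by apply: cvgM; exact: D_cvg.
apply: (cvgr_to_le h); apply: nearW => n.
apply: (@le_trans _ _ (partition_sum (fun x y => 4 * (z ^+ N) ^+ 2 * W (N + n).+1 x y) 0 s)).
  apply: (@partition_sum_le _ _ _ (2 ^- N) T) => //; first by rewrite lT.
  by move=> x y x0 xy _ yx; apply: D_bound => //; exact: ltW.
rewrite partition_sumZ; apply: ler_wpM2l; first by rewrite mulr_ge0 ?sqr_ge0.
have := partition_W (N + n).+1 ps; rewrite lT => /le_trans; apply; exact: VC.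
Qed.

End dyadic_chaining.

Section half_line_paths.
Context (R : realType).

(** The processes are constrained on [0, +oo[ only; the path is frozen at its initial value for
    negative times to become continuous on the whole line. *)
Lemma continuous_half_line (g : R -> R) : {within `[0, +oo[, continuous g} ->
  continuous (fun t : R => g (Num.max t 0)).
Proof.
move=> /subspace_continuousP cg x.
have x0 : (`[0, +oo[%classic : set R) (Num.max x 0).
  by rewrite /= in_itv/= andbT le_max lexx orbT.
apply: (cvg_comp (fun t : R => Num.max t 0) g _ (cg _ x0)).
have mx : (fun t : R => Num.max t 0) @ x --> Num.max x 0.
  apply: (continuous_max (f := id) (g := cst 0)); first exact: cvg_id.
  exact: cvg_cst.
move=> A; rewrite /within/= => hA.
have := mx _ hA; rewrite /= => h; near=> t.
have ht : Num.max t 0 \in `[0, +oo[ -> A (Num.max t 0) by near: t.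
by apply: ht; rewrite in_itv/= andbT le_max lexx orbT.
Unshelve. all: by end_near. Qed.

Lemma integrable_continuous_itv (g : R -> R) (x y : R) : continuous g ->
  lebesgue_measure.-integrable `[x, y] (EFin \o g).
Proof.
move=> cg; apply: continuous_compact_integrable; first exact: segment_compact.
exact: continuous_subspaceT.
Qed.

Lemma integral_increment (g : R -> R) (c e x y : R) : continuous g ->
  0 <= x -> x <= y -> (forall s, x <= s <= y -> `|g s - c| <= e) ->
  `|\int[lebesgue_measure]_(s in `[0, y]) g s -
    \int[lebesgue_measure]_(s in `[0, x]) g s - c * (y - x)| <= e * (y - x).
Proof.
move=> cg x0 xy gc.
rewrite Rintegral_itvB; [|exact: integrable_continuous_itv|by rewrite bnd_simp|by rewrite bnd_simp].
have gi : lebesgue_measure.-integrable `]x, y] (EFin \o g).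
  apply: integrableS (integrable_continuous_itv x y cg) => //.
  exact: subset_itv_oc_cc.
have ci k : lebesgue_measure.-integrable `]x, y] (EFin \o (fun=> k : R)).
  apply: integrableS (integrable_continuous_itv x y (fun z => cvg_cst k)) => //.
  exact: subset_itv_oc_cc.
have cE k : \int[lebesgue_measure]_(s in `]x, y]) k = k * (y - x).
  rewrite Rintegral_cst//= lebesgue_measure_itv/= lte_fin.
  move: xy; rewrite le_eqVlt => /predU1P[->|->//]; by rewrite ltxx subrr.
have lo : (c - e) * (y - x) <= \int[lebesgue_measure]_(s in `]x, y]) g s.
  rewrite -cE; apply: le_Rintegral => // s; rewrite /= in_itv/= => /andP[xs sy].
  by have := gc s; rewrite (ltW xs) sy ler_norml => /(_ isT) /andP[]; lra.
have hi : \int[lebesgue_measure]_(s in `]x, y]) g s <= (c + e) * (y - x).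
  rewrite -cE; apply: le_Rintegral => // s; rewrite /= in_itv/= => /andP[xs sy].
  by have := gc s; rewrite (ltW xs) sy ler_norml => /(_ isT) /andP[]; lra.
clear gc gi ci cE; move: lo hi; set I := Rintegral _ _ _; rewrite mulrBl mulrDl ler_norml => lo hi.
by rewrite lerBrDr lerBlDr addrC lo addrC hi.
Qed.

End half_line_paths.

(** * Chain rule for the Young integral *)

Section young_chain_rule.
Context (R : realType).
Implicit Types (X : R -> R).

Definition vanishing_quadratic_variation X T := forall e : R, 0 < e ->
  exists2 dl : R, 0 < dl & forall s, path <%R 0 s -> last 0 s = T ->
    small_steps dl 0 s -> partition_sum (fun x y => (X y - X x) ^+ 2) 0 s <= e.

Lemma left_riemann_sumE (f g : R -> R) a b s :
  left_riemann_sum f g a b s = partition_sum (fun x y => f x * (g y - g x)) a s.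
Proof.
elim: s a => [|x s ih] a; rewrite /left_riemann_sum/=; first by rewrite big_geq.
by rewrite big_nat_recl//= -ih.
Qed.

Variables (k F : R -> R) (Lk : R).
Hypotheses (dF : forall x, is_derive x (1 : R) F (k x))
  (kL : forall x y, `|k x - k y| <= Lk * `|x - y|).

(** [k] is only assumed Lipschitz, so the mean value theorem for [F] replaces a Taylor expansion:
    the slope of [F] is the value of [k] at a point between [x] and [y]. *)
Lemma first_order_remainder x y : `|k x * (y - x) - (F y - F x)| <= Lk * (y - x) ^+ 2.
Proof.
have L0 : 0 <= Lk by have := kL 1 0; rewrite subr0 normr1 mulr1; exact: le_trans.
have cF := derive_continuous dF.
have mvt u v : u < v -> exists2 c, u < c < v & F v - F u = k c * (v - u).
  move=> uv; have [c] := MVT uv (fun y _ => dF y) (continuous_subspaceT cF).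
  by rewrite in_itv/= => cin E; exists c.
have [xy|xy|->] := ltgtP x y; last by rewrite !subrr mulr0 subr0 normr0 expr0n mulr0.
- have [c /andP[c1 c2] ->] := mvt _ _ xy.
  rewrite -mulrBl normrM expr2 mulrA (gtr0_norm (_ : 0 < y - x)) ?subr_gt0//.
  rewrite ler_wpM2r ?subr_ge0 ?(ltW xy)//; apply: le_trans (kL _ _) _.
  by rewrite ler_wpM2l// ltr0_norm; lra.
- have [c /andP[c1 c2] E] := mvt _ _ xy.
  have -> : k x * (y - x) - (F y - F x) = (k c - k x) * (x - y).
    by rewrite -(opprB (F x)) E; ring.
  rewrite -sqrrN opprB normrM expr2 mulrA (gtr0_norm (_ : 0 < x - y)) ?subr_gt0//.
  rewrite ler_wpM2r ?subr_ge0 ?(ltW xy)//; apply: le_trans (kL _ _) _.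
  by rewrite ler_wpM2l// ltr0_norm; lra.
Qed.

(** The increments of F(X) telescope along any partition, and their distance to the Riemann sum is
    at most [Lk] times the quadratic variation. *)
Lemma young_chain_rule X T : 0 <= T -> vanishing_quadratic_variation X T ->
  young_integrable (k \o X) X 0 T /\
  young_integral (k \o X) X 0 T = F (X T) - F (X 0).
Proof.
move=> T0 vX; have L0 : 0 <= Lk by have := kL 1 0; rewrite subr0 normr1 mulr1; exact: le_trans.
have h : left_riemann_sum (k \o X) X 0 T s @[s --> mesh_filter 0 T] --> F (X T) - F (X 0).
  apply/cvgrPdist_le => e e0.
  (* The denominator is [Lk + 1] because [Lk] may be 0. *)
  have e1 : 0 < e / (Lk + 1) by rewrite divr_gt0// ltr_wpDl.
  have [dl dl0 hdl] := vX _ e1; exists dl => // s [[ps /eqP lT] ms] /=.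
  have ss : small_steps dl 0 s.
    move=> i si; have := ms i si.
    by rewrite (set_nth_default 0 T) ?ltnS// (set_nth_default 0 T) ?ltnS ?(ltnW si).
  rewrite distrC left_riemann_sumE -lT.
  rewrite -(partition_sum_telescope (F \o X)) /=.
  rewrite -[X in _ - X]mul1r -[1]opprK mulNr opprK -partition_sumZ -partition_sumD.
  apply: (@le_trans _ _ (Lk * partition_sum (fun x y => (X y - X x) ^+ 2) 0 s)).
    rewrite -partition_sumZ; elim: s 0 {ps lT ms ss} => [|y s ih] x /=.
      by rewrite normr0.
    apply: le_trans (ler_normD _ _) _; apply: lerD; last exact: ih.
    by rewrite mulN1r; exact: first_order_remainder.
  have q := hdl s ps lT ss.
  have q0 a : 0 <= partition_sum (fun x y => (X y - X x) ^+ 2) a s.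
    by elim: s a {ps lT ms ss q} => [//|y s ih] x /=; rewrite addr_ge0 ?sqr_ge0.
  apply: (@le_trans _ _ ((Lk + 1) * (e / (Lk + 1)))).
    by apply: ler_pM => //; rewrite lerDl.
  by rewrite mulrC divfK// gt_eqF// ltr_wpDl.
split; first by apply/cvg_ex; exists (F (X T) - F (X 0)).
have pf := mesh_filter_proper T0.
exact: (cvg_lim (@norm_hausdorff _ R^o) h).
Qed.

End young_chain_rule.

Section fbm_quadratic_variation.
Context d (Omega : measurableType d) (R : realType) (P : probability Omega R).
Variables (H : R) (B : R -> {RV P >-> R}).
Hypotheses (hH : 1 / 2 < H < 1) (hB : fractional_brownian_motion H B).

Let p := 2 * H.
(** [eta ^ m] is the variance of an increment of [B] over 2^-m; at most T 2^m such increments make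
    the mean dyadic variation at most T times [theta ^ m]. The choice of [z] gives theta < z^2 < 1,
    so the series weighted by z^(-2m) still converges. *)
Let eta : R := 2^-1 `^ p.
Let theta := 2 * eta.
Let z := (1 + theta) / 2.

Let theta_lt1 : 0 < theta < 1.
Proof.
have p1 : 0 < p - 1 by rewrite /p; case/andP: hH; lra.
have h2 : 0 < 2^-1 :> R by rewrite invr_gt0.
have e0 : 0 < eta by exact: powR_gt0.
rewrite /theta mulr_gt0//= /eta -(@mulr_powRB1 _ _ p) ?(ltW h2)//; last first.
  by rewrite /p; case/andP: hH; lra.
rewrite mulrA divff// mul1r.
have : 2^-1 `^ (p - 1) < 1 `^ (p - 1) :> R.
  by apply: gt0_ltr_powR => //; rewrite ?nnegrE ?(ltW h2)// invf_lt1// ltr1n.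
by rewrite powR1.
Qed.

Let z01 : 0 < z < 1. Proof. by rewrite /z; case/andP: theta_lt1; lra. Qed.

Let theta_z : theta < z ^+ 2.
Proof.
have /andP[t0 t1] := theta_lt1; rewrite /z -subr_gt0.
have -> : ((1 + theta) / 2) ^+ 2 - theta = ((1 - theta) / 2) ^+ 2 by field.
by rewrite exprn_gt0// divr_gt0// subr_gt0.
Qed.

Let V m (T : R) w := dyadic_variation (fun t : R => B (Num.max t 0) w) m T.

Let VE m T w : V m T w = \sum_(k < dyadic_floor m T)
  (B (k.+1%:R / 2 ^+ m) w - B (k%:R / 2 ^+ m) w) ^+ 2.
Proof.
rewrite /V /dyadic_variation; apply: eq_bigr => k _; rewrite /dyadic_increment.
by rewrite !max_l// divr_ge0// exprn_ge0.
Qed.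

Let g0 m (k : nat) : 0 <= k%:R / 2 ^+ m :> R. Proof. by rewrite divr_ge0// exprn_ge0. Qed.

Let mV m T : measurable_fun setT (V m T).
Proof.
rewrite (_ : V m T = fun w => \sum_(k < dyadic_floor m T)
    (B (k.+1%:R / 2 ^+ m) w - B (k%:R / 2 ^+ m) w) ^+ 2); last first.
  by apply/funext => w; exact: VE.
by apply: measurable_sum => k; apply: measurable_funX; apply: measurable_funB;
  exact: measurable_funPT.
Qed.

Let V_ge0 m T w : 0 <= V m T w.
Proof. by apply: sumr_ge0 => k _; exact: sqr_ge0. Qed.

Let powR_half m : (2 ^- m : R) `^ p = eta ^+ m.
Proof.
elim: m => [|m ih]; first by rewrite invr1 powR1.
by rewrite exprS invfM powRM ?invr_ge0 ?exprn_ge0// ih exprS.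
Qed.

Let EV m T : 0 <= T -> (\int[P]_w (V m T w)%:E <= (T * theta ^+ m)%:E)%E.
Proof.
case: hB => _ EB covB _ T0.
have iI k : P.-integrable setT
    (EFin \o (fun w => (B (k.+1%:R / 2 ^+ m) w - B (k%:R / 2 ^+ m) w) ^+ 2)).
  exact: (fbm_increment_square_integrable EB covB).
have -> : (\int[P]_w (V m T w)%:E)%E = (\int[P]_w V m T w)%:E.
  rewrite fineK// integrable_fin_num//.
  apply: eq_integrable (@integrable_fsum _ _ _ P (dyadic_floor m T)
    (fun k w => (B (k.+1%:R / 2 ^+ m) w - B (k%:R / 2 ^+ m) w) ^+ 2) iI) => // w _ /=.
  by rewrite VE.
rewrite lee_fin; under eq_Rintegral do rewrite VE.
rewrite (@Rintegral_sum _ _ _ P (dyadic_floor m T)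
    (fun k w => (B (k.+1%:R / 2 ^+ m) w - B (k%:R / 2 ^+ m) w) ^+ 2))//.
have EI (k : nat) : \int[P]_w (B (k.+1%:R / 2 ^+ m) w - B (k%:R / 2 ^+ m) w) ^+ 2 = eta ^+ m.
  rewrite (fbm_increment_variance hH EB covB)// -mulrBl -natr1 addrAC subrr add0r mul1r.
  by rewrite ger0_norm ?invr_ge0 ?exprn_ge0// powR_half.
under eq_bigr do rewrite EI.
rewrite sumr_const card_ord -mulr_natl /theta exprMn mulrA ler_wpM2r//.
  by rewrite exprn_ge0// powR_ge0.
have /andP[h _] := dyadic_floor_itv m T0.
by rewrite ler_pdivrMr ?exprn_gt0// in h.
Qed.

(** The weighted series of dyadic variations has a finite expectation, hence almost surely a finite
    sum. This sum is the constant of the chaining bound, in which z^(2N) tends to 0 with the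
    mesh. *)
Lemma fbm_vanishing_quadratic_variation T : 0 <= T ->
  {ae P, forall w, vanishing_quadratic_variation (fun t : R => B (Num.max t 0) w) T}.
Proof.
move=> T0; have /andP[z0 z1] := z01; have /andP[t0 t1] := theta_lt1.
have x0 : 0 < z ^- 2 by rewrite invr_gt0 exprn_gt0.
set q := z ^- 2 * theta.
have q0 : 0 <= q by rewrite mulr_ge0// ltW.
have q1 : q < 1 by rewrite /q mulrC ltr_pdivrMr ?exprn_gt0// mul1r.
pose f m w : \bar R := ((z ^- 2) ^+ m * V m T w)%:E.
have f0 m w : (0 <= f m w)%E by rewrite lee_fin mulr_ge0 ?exprn_ge0 ?(ltW x0).
have mf m : measurable_fun setT (f m).
  by apply/measurable_EFinP; exact: measurable_funM.
pose F w : \bar R := (\sum_(0 <= m <oo) f m w)%E.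
have mF : measurable_fun setT F.
  by apply: ge0_emeasurable_sum => // m _; exact: mf.
have F0 w : (0 <= F w)%E by apply: nneseries_ge0.
have intF : (\int[P]_w F w <= (T * (1 - q)^-1)%:E)%E.
  rewrite integral_nneseries//; apply: lime_le.
    by apply: is_cvg_nneseries => m _ _; exact: integral_ge0.
  apply: nearW => n.
  apply: (@le_trans _ _ (\sum_(0 <= m < n) (T * q ^+ m)%:E)%E).
    apply: lee_sum => m _; rewrite /f; under eq_integral do rewrite EFinM.
    rewrite ge0_integralZl//; last 3 first.
    - by apply/measurable_EFinP; exact: mV.
    - by move=> w _; rewrite lee_fin.
    - by rewrite lee_fin exprn_ge0// ltW.
    apply: le_trans (lee_wpmul2l _ (EV m T0)) _; first by rewrite lee_fin exprn_ge0// ltW.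
    have -> : q ^+ m = z ^- 2 ^+ m * theta ^+ m by exact: exprMn.
    by rewrite -EFinM lee_fin mulrCA.
  rewrite sumEFin lee_fin -mulr_sumr ler_wpM2l// big_mkord.
  have q1' : 0 < 1 - q by rewrite subr_gt0.
  rewrite -[leRHS]mul1r ler_pdivlMr//.
  have := subrX1 q n; have : 0 <= q ^+ n by exact: exprn_ge0.
  by set s := \sum_(i < n) _; lra.
have Fi : P.-integrable setT F.
  apply/integrableP; split => //.
  under eq_integral do rewrite gee0_abs//.
  by apply: le_lt_trans intF _; rewrite ltry.
have Ffin := integrable_ae measurableT Fi.
have [_ _ _ cB] := hB.
move: Ffin cB; apply: filterS2 => w Fw cw; have {}Fw := Fw I.
have cw' := continuous_half_line cw.
have VC n : \sum_(m < n) (z ^- 2) ^+ m * V m T w <= fine (F w).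
  rewrite -lee_fin fineK// -(big_mkord xpredT (fun m => (z ^- 2) ^+ m * V m T w)) -sumEFin.
  by apply: (@nneseries_lim_ge _ (fun m => f m w) xpredT) => m _ _; exact: f0.
set C := fine (F w) in VC.
have C0 : 0 <= C by have := VC 0%N; rewrite big_ord0.
move=> e e0.
have z1' : 0 < (1 - z) ^+ 2 by rewrite exprn_gt0// subr_gt0.
have : 4 * (z ^+ N) ^+ 2 * C @[N --> \oo] --> (0 : R).
  have zN : z ^+ N @[N --> \oo] --> (0 : R).
    by apply: cvg_expr; rewrite ger0_norm// ltW.
  have zC : 4 * (z ^+ N * z ^+ N) * C @[N --> \oo] --> 4 * (0 * 0) * C.
    by apply: cvgM; [apply: cvgM; [exact: cvg_cst|exact: cvgM]|exact: cvg_cst].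
  by rewrite mul0r mulr0 mul0r in zC.
move=> /cvgrPdist_le /(_ ((1 - z) ^+ 2 * e)) []; first by rewrite mulr_gt0.
move=> N _ hN; exists (2 ^- N); first by rewrite invr_gt0 exprn_gt0.
move=> s ps lT ss; rewrite -(ler_pM2l z1').
apply: le_trans (quadratic_variation_bound cw' z0 z1 ps lT ss VC) _.
have := hN N (leqnn N); rewrite /= sub0r normrN; apply: le_trans; exact: ler_norm.
Qed.

End fbm_quadratic_variation.

(** * Comparison of the solution with the Euler scheme *)

Section solution_path.
Context (R : realType).

Lemma uniformly_continuous_itv (g : R -> R) (T e : R) : continuous g -> 0 < e ->
  exists2 dl : R, 0 < dl &
    forall s t, 0 <= s <= T -> `|t - s| < dl -> `|g t - g s| <= e.
Proof.
move=> cg e0; have /compact_near_coveringP cov := @segment_compact R 0 T.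
have near_r : \forall dl \near (0 : R)^'+,
    `[0, T] `<=` [set s | forall t, `|t - s| < dl -> `|g t - g s| <= e].
  apply: cov => x _; have e2 : 0 < e / 2 by rewrite divr_gt0.
  have /cvgrPdist_le/(_ _ e2)[r /= r0 hr] := cg x.
  have r2 : 0 < r / 2 by rewrite divr_gt0.
  exists (ball x (r / 2), [set dl | dl < r / 2]) => /=.
    split; first exact: nbhsx_ballx.
    exact: nbhs_right_lt.
  move=> [y dl] [/= xy dlr] t ty.
  have ty' : `|x - t| < r.
    have -> : x - t = (x - y) - (t - y) by ring.
    apply: le_lt_trans (ler_normB _ _) _.
    by have := ltrD xy (lt_trans ty dlr); rewrite -splitr.
  have xy' : `|x - y| < r by apply: lt_trans xy _; rewrite ltr_pdivrMr// ltr_pMr// ltr1n.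
  have -> : g t - g y = (g x - g y) - (g x - g t) by ring.
  apply: le_trans (ler_normB _ _) _.
  by have := lerD (hr y xy') (hr t ty'); rewrite -splitr.
have [r [hr r0]] := filter_ex (filterI near_r (nbhs_right_gt (0 : R))).
by exists r => // s t sT; apply: hr; rewrite /= in_itv.
Qed.

Variables (b X beta : R -> R) (x0 sigma : R).
Hypotheses (cb : continuous b) (cX : {within `[0, +oo[, continuous X})
  (eqX : forall t, 0 <= t -> X t =
    x0 + \int[lebesgue_measure]_(s in `[0, t]) b (X s) + sigma * beta t).

Let Y t := X (Num.max t 0).
Let cY : continuous Y. Proof. exact: continuous_half_line. Qed.
Let YE t : 0 <= t -> Y t = X t. Proof. by move=> t0; rewrite /Y max_l. Qed.

Let integralY (g : R -> R) t :
  \int[lebesgue_measure]_(s in `[0, t]) g (X s) =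
  \int[lebesgue_measure]_(s in `[0, t]) g (Y s).
Proof.
by apply: eq_Rintegral => s; rewrite inE/= in_itv/= => /andP[s0 _]; rewrite YE.
Qed.

Lemma occupation_increment (g : R -> R) c e s t : continuous g -> 0 <= s -> s <= t ->
  (forall u, s <= u <= t -> `|g (X u) - c| <= e) ->
  `|\int[lebesgue_measure]_(u in `[0, t]) g (X u) -
    \int[lebesgue_measure]_(u in `[0, s]) g (X u) - c * (t - s)| <= e * (t - s).
Proof.
move=> cg s0 st gc; rewrite !integralY.
apply: (@integral_increment _ (g \o Y)) => //.
  by move=> u; apply: continuous_comp; [exact: cY|exact: cg].
by move=> u /andP[su ut]; rewrite /= YE ?(le_trans s0)// gc// su.
Qed.

Lemma occupation_ge0 (g : R -> R) t : (forall y, 0 <= g y) ->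
  0 <= \int[lebesgue_measure]_(u in `[0, t]) g (X u).
Proof. by move=> g0; apply: Rintegral_ge0 => u _; exact: g0. Qed.

Lemma occupation_monotone (g : R -> R) s t : continuous g -> (forall y, 0 <= g y) ->
  s <= t ->
  \int[lebesgue_measure]_(u in `[0, s]) g (X u) <=
  \int[lebesgue_measure]_(u in `[0, t]) g (X u).
Proof.
move=> cg g0 st; rewrite !integralY.
have cgY : continuous (g \o Y).
  by move=> u; apply: continuous_comp; [exact: cY|exact: cg].
have [s0|s0] := leP 0 s; last first.
  rewrite set_itv_ge ?Rintegral_set0; last by rewrite bnd_simp -ltNge.
  by apply: Rintegral_ge0 => u _; exact: g0.
rewrite -subr_ge0 Rintegral_itvB; [|exact: (integrable_continuous_itv _ _ cgY)|by rewrite bnd_simp|by rewrite bnd_simp].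
by apply: Rintegral_ge0 => u _; exact: g0.
Qed.

Lemma path_increment c e s t : 0 <= s -> s <= t ->
  (forall u, s <= u <= t -> `|b (X u) - c| <= e) ->
  `|X t - X s - sigma * (beta t - beta s) - c * (t - s)| <= e * (t - s).
Proof.
move=> s0 st bc; have := occupation_increment cb s0 st bc.
rewrite (eqX s0) (eqX (le_trans s0 st)); congr (`|_| <= _); ring.
Qed.

(** On [0, T] the drift part of [X] is Lipschitz, so its squared increments add up to at most a
    constant times the mesh; the bound (a + c)^2 <= 2 a^2 + 2 c^2 separates it from the noise. *)
Lemma path_vanishing_quadratic_variation T : 0 <= T ->
  vanishing_quadratic_variation (fun t : R => beta (Num.max t 0)) T ->
  vanishing_quadratic_variation X T.
Proof.
move=> T0 vB e e0.
have cbY : continuous (fun t => `|b (Y t)|).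
  by move=> u; apply: cvg_norm; apply: (cvg_comp Y b _ _); [exact: cY|exact: cb].
have [v _ vmax] := EVT_max T0 (continuous_subspaceT cbY).
set K := `|b (Y v)|; have K0 : 0 <= K by exact: normr_ge0.
have bK u : 0 <= u <= T -> `|b (X u)| <= K.
  by move=> uT; rewrite -(YE (proj1 (andP uT))); apply: vmax; rewrite in_itv.
have s1 : 0 < 4 * sigma ^+ 2 + 1 by rewrite ltr_wpDl// mulr_ge0// sqr_ge0.
have k1 : 0 < 4 * K ^+ 2 * T + 1 by rewrite ltr_wpDl// !mulr_ge0// sqr_ge0.
(* Each of the two contributions falls below e / 2; the summands 1 guard against zero
   denominators. *)
pose e1 := e / (4 * sigma ^+ 2 + 1); pose dl1 := e / (4 * K ^+ 2 * T + 1).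
have [dl dl0 hdl] := vB e1 (divr_gt0 e0 s1).
have dl10 : 0 < dl1 by exact: divr_gt0.
exists (Num.min dl dl1); first by rewrite lt_min dl0.
move=> s ps lT ss.
have ssd r : Num.min dl dl1 <= r -> small_steps r 0 s.
  by move=> hr i si; apply: lt_le_trans (ss i si) hr.
have q : partition_sum (fun x y : R => (beta (Num.max y 0) - beta (Num.max x 0)) ^+ 2) 0 s
    <= e1.
  by apply: hdl => //; apply: ssd; rewrite ge_min lexx.
apply: (@le_trans _ _ (partition_sum (fun x y => 2 * K ^+ 2 * dl1 * (y - x) +
    2 * sigma ^+ 2 * (beta (Num.max y 0) - beta (Num.max x 0)) ^+ 2) 0 s)).
  apply: (partition_sum_le ps (ssd dl1 _)); rewrite ?ge_min ?lexx ?orbT ?lT//.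
  move=> x y x0' xy yT yx; have y0 := le_trans x0' (ltW xy).
  rewrite !max_l//.
  have := @path_increment 0 K x y x0' (ltW xy) _; rewrite mul0r subr0.
  have bu u : x <= u <= y -> `|b (X u) - 0| <= K.
    by move=> /andP[xu uy]; rewrite subr0 bK// (le_trans x0' xu) (le_trans uy).
  move=> /(_ bu); set A := _ - sigma * _ => hA.
  have -> : X y - X x = A + sigma * (beta y - beta x) by rewrite /A; ring.
  have A2 : A ^+ 2 <= K ^+ 2 * dl1 * (y - x).
    have -> : K ^+ 2 * dl1 * (y - x) = K ^+ 2 * (y - x) * dl1 by ring.
    rewrite -[leLHS]ger0_norm ?sqr_ge0// normrX.
    apply: (@le_trans _ _ ((K * (y - x)) ^+ 2)).
      by rewrite lerXn2r// nnegrE mulr_ge0// subr_ge0 ltW.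
    rewrite exprMn -!mulrA ler_wpM2l ?sqr_ge0// expr2 ler_wpM2l//.
    by apply: ler_wpM2l; [rewrite subr_ge0 ltW|exact: ltW].
  set c := sigma * _; rewrite -(mulrA 2 (sigma ^+ 2)) -exprMn -/c.
  have := sqr_ge0 (A - c); move: A2; nra.
rewrite partition_sumD !partition_sumZ (partition_sum_telescope id) lT subr0.
have h1 : 2 * K ^+ 2 * dl1 * T <= e / 2.
  have -> : 2 * K ^+ 2 * dl1 * T = (4 * K ^+ 2 * T) * dl1 / 2 by field.
  rewrite ler_pM2r ?invr_gt0// /dl1 mulrCA ler_piMr ?(ltW e0)//.
  by rewrite ler_pdivrMr// mul1r lerDl.
have h2 : 2 * sigma ^+ 2 * e1 <= e / 2.
  have -> : 2 * sigma ^+ 2 * e1 = (4 * sigma ^+ 2) * e1 / 2 by field.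
  rewrite ler_pM2r ?invr_gt0// /e1 mulrCA ler_piMr ?(ltW e0)//.
  by rewrite ler_pdivrMr// mul1r lerDl.
rewrite [leRHS]splitr; apply: (lerD h1); apply: le_trans h2.
by rewrite ler_wpM2l// pmulr_rge0// sqr_ge0.
Qed.

Section euler_comparison.
Variables (b' : R -> R) (M L : R).
Hypotheses (M0 : 0 < M) (L0 : 0 < L) (db : forall x, is_derive x (1 : R) b (b' x))
  (bM : forall x, b' x <= - M) (bL : forall x, `|b' x| <= L).
Variables (G : R -> R) (Lk : R).
Hypotheses (cG : continuous G) (G_ge0 : forall x, 0 <= G x)
  (GL : forall x y, `|G x - G y| <= Lk * `|x - y|).

Let bL' x : - L <= b' x. Proof. by have := bL x; rewrite ler_norml => /andP[]. Qed.

Section fixed_step.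
Variables (dl e : R) (N : nat).
Hypotheses (dl0 : 0 < dl) (dlL : dl * L <= 1) (e0 : 0 <= e)
  (modX : forall s t, 0 <= s <= N%:R * dl -> `|t - s| <= dl -> `|Y t - Y s| <= e).

Let z i := sigma * (beta (i.+1%:R * dl) - beta (i%:R * dl)).
Let y k := euler b dl z k.
Let t k : R := k%:R * dl.

Let t_ge0 k : 0 <= t k. Proof. by rewrite mulr_ge0// ltW. Qed.
Let tS k : t k.+1 - t k = dl. Proof. by rewrite /t -natr1; ring. Qed.
Let tSle k : t k <= t k.+1. Proof. by rewrite -subr_ge0 tS ltW. Qed.

Let modXk k u : (k < N)%N -> t k <= u <= t k.+1 -> `|X u - X (t k)| <= e.
Proof.
move=> kN /andP[ku uk]; rewrite -!YE//; last exact: le_trans ku.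
apply: modX; first by rewrite t_ge0/= /t ler_pM2r// ler_nat ltnW.
by rewrite ger0_norm ?subr_ge0// -(tS k) lerD2r.
Qed.

Let q : 0 <= 1 - dl * M <= 1.
Proof. exact: (contraction_ratio M0 dl0 dlL bM bL'). Qed.

(** The noise cancels in the difference, which contracts by 1 - dl M and gains a local error of at
    most L e dl per step. The fixed point L e / M of this recursion does not depend on the
    horizon. *)
Lemma euler_error k : (k <= N)%N ->
  `|X (t k) - y k| <= (1 - dl * M) ^+ k * `|X 0| + L * e / M.
Proof.
have Le : 0 <= L * e / M by rewrite !mulr_ge0// ?invr_ge0 ltW.
elim: k => [|k ih] kN; first by rewrite /t mul0r subr0 expr0 mul1r lerDl.
have {}ih := ih (ltnW kN).
have drift : `|X (t k.+1) - X (t k) - z k - b (X (t k)) * dl| <= L * e * dl.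
  have := @path_increment (b (X (t k))) (L * e) _ _ (t_ge0 k) (tSle k).
  rewrite tS; apply => u uk; apply: le_trans (derive_lipschitz _ _ db bL) _.
  by rewrite ler_wpM2l ?(ltW L0)// modXk.
have -> : X (t k.+1) - y k.+1 = (X (t k.+1) - X (t k) - z k - b (X (t k)) * dl) +
    (X (t k) + dl * b (X (t k)) - (y k + dl * b (y k))) by rewrite /y/=; ring.
apply: le_trans (ler_normD _ _) _.
apply: le_trans (lerD drift (drift_contraction dl0 dlL db bM bL' _ _)) _.
have /andP[q0 _] := q.
apply: le_trans (lerD (lexx _) (ler_wpM2l q0 ih)) _.
rewrite exprS mulrDr mulrA le_eqVlt; apply/orP; left; apply/eqP.
by field; rewrite gt_eqF.
Qed.

(** Three errors add up: the initial one, whose geometric decay sums to |X 0| / M; the scheme error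
    L e / M; and the oscillation e of the path within a step. Only the last two grow with the
    horizon, and both are proportional to [e]. *)
Lemma occupation_time_average :
  N%:R * dl * time_average b dl G N z - Lk * (`|X 0| / M + N%:R * dl * (L / M + 1) * e) <=
  \int[lebesgue_measure]_(u in `[0, N%:R * dl]) G (X u).
Proof.
have Lk0 : 0 <= Lk by have := GL 1 0; rewrite subr0 normr1 mulr1; exact: le_trans.
have /andP[q0 _] := q.
(* The induction carries the initial error as an exact geometric sum, which is bounded by |X 0| / M
   only at the end. *)
suff h k : (k <= N)%N -> dl * \sum_(i < k) G (y i) -
    Lk * (\sum_(i < k) dl * (1 - dl * M) ^+ i * `|X 0| + k%:R * dl * (L / M + 1) * e) <=
    \int[lebesgue_measure]_(u in `[0, t k]) G (X u).
  apply: le_trans (h N (leqnn N)); apply: lerB.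
    rewrite /time_average -/y; have [->|N0] := posnP N; first by rewrite big_ord0 !mul0r mulr0.
    by rewrite mulrACA mulfV ?mul1r// pnatr_eq0 -lt0n.
  rewrite ler_wpM2l// lerD2r -mulr_suml mulrC ler_wpM2l//.
  rewrite -mulr_sumr -[leRHS]mul1r ler_pdivlMr//.
  have := subrX1 (1 - dl * M) N; set S := \sum_(i < N) _.
  have : 0 <= (1 - dl * M) ^+ N by rewrite exprn_ge0.
  move=> r0 E; have -> : dl * S * M = - ((1 - dl * M - 1) * S) by ring.
  by rewrite -E opprB lerBlDr lerDl.
elim: k => [|k ih] kN.
  by rewrite !big_ord0 mulr0n !mul0r addr0 !mulr0 subr0 occupation_ge0.
have {}ih := ih (ltnW kN).
have inc := @occupation_increment G (G (X (t k))) (Lk * e) _ _ cG (t_ge0 k) (tSle k).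
rewrite tS in inc; have {}inc := inc _.
have : `|G (X (t k)) - G (y k)| <= Lk * ((1 - dl * M) ^+ k * `|X 0| + L * e / M).
  by apply: le_trans (GL _ _) _; rewrite ler_wpM2l// euler_error// ltnW.
have : `|\int[lebesgue_measure]_(u in `[0, t k.+1]) G (X u) -
    \int[lebesgue_measure]_(u in `[0, t k]) G (X u) - G (X (t k)) * dl| <= Lk * e * dl.
  by apply: inc => u uk; apply: le_trans (GL _ _) _; rewrite ler_wpM2l// modXk.
rewrite !ler_norml => /andP[+ _] /andP[+ _].
move: ih; rewrite !big_ord_recr/=.
set I1 := Rintegral _ _ _; set I0 := Rintegral _ _ _.
set S := \sum_(i < k) _; set S' := \sum_(i < k) _; set g := G (X _); set p := _ ^+ k.
move=> ih hI hG; have {}hG := ler_wpM2l (ltW dl0) hG.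
rewrite -natr1; set n := k%:R.
have -> : dl * (S + G (y k)) - Lk * (S' + dl * p * `|X 0| + (n + 1) * dl * (L / M + 1) * e) =
  (dl * S - Lk * (S' + n * dl * (L / M + 1) * e)) + dl * (G (y k)) -
  dl * (Lk * (p * `|X 0| + L * e / M)) - Lk * e * dl by ring.
move: ih hI hG; rewrite mulrBr mulrN; lra.
Qed.

End fixed_step.
(** For any tolerance, one of the infinitely many admissible steps is fine enough to make the errors
    proportional to [e] smaller than it; only the initial error, free of the horizon, remains. *)
Lemma occupation_frequently_lower_bound (tau c : R) (j : nat) : 0 < tau ->
  (forall n0, exists2 n, (n0 <= n)%N & c <= time_average b (tau / n.+1%:R) G (j * n.+1)
    (fun i => sigma * (beta (i.+1%:R * (tau / n.+1%:R)) - beta (i%:R * (tau / n.+1%:R))))) ->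
  j%:R * tau * c - Lk * (`|X 0| / M) <=
  \int[lebesgue_measure]_(u in `[0, j%:R * tau]) G (X u).
Proof.
move=> tau0 io; set T := j%:R * tau.
have Lk0 : 0 <= Lk by have := GL 1 0; rewrite subr0 normr1 mulr1; exact: le_trans.
have T0 : 0 <= T by rewrite mulr_ge0// ltW.
apply/ler_addgt0Pr => eps eps0.
pose C := Lk * (T * (L / M + 1)).
have C0 : 0 <= C by rewrite /C (mulr_ge0 Lk0)// (mulr_ge0 T0)// addr_ge0// divr_ge0// ltW.
have C1 : 0 < C + 1 by rewrite ltr_wpDl.
have e0 : 0 < eps / (C + 1) by rewrite divr_gt0.
set e := eps / (C + 1) in e0.
have [dl0 dl00 mod] := @uniformly_continuous_itv Y T e cY e0.
(* One [n] serves both needs: a step below the modulus of continuity [dl0], and [dl * L <= 1]. *)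
have [n nn0 hn] := io (Num.truncn (tau / dl0) + Num.truncn (tau * L))%N.
have n1 : 0 < n.+1%:R :> R by rewrite ltr0n.
set dl := tau / n.+1%:R in hn.
have dlgt0 : 0 < dl by rewrite divr_gt0.
have trunc_lt (r : R) : (Num.truncn r <= n)%N -> r < n.+1%:R.
  by move=> rn; apply: (lt_le_trans (truncnS_gt r)); rewrite ler_nat.
have NT : (j * n.+1)%:R * dl = T.
  by rewrite natrM /dl -mulrA (mulrC n.+1%:R) divfK// gt_eqF.
have := @occupation_time_average dl e (j * n.+1) dlgt0 _ (ltW e0) _.
rewrite NT; have dlL : dl * L <= 1.
  rewrite /dl mulrAC ler_pdivrMr// mul1r ltW// trunc_lt//.
  by apply: leq_trans nn0; rewrite leq_addl.
have md s u : 0 <= s <= T -> `|u - s| <= dl -> `|Y u - Y s| <= e.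
  move=> sT us; apply: mod => //; apply: le_lt_trans us _.
  rewrite /dl ltr_pdivrMr// mulrC -ltr_pdivrMr// trunc_lt//.
  by apply: leq_trans nn0; rewrite leq_addr.
move=> /(_ dlL md) h.
have h1 : T * c <= T * time_average b dl G (j * n.+1)
    (fun i => sigma * (beta (i.+1%:R * dl) - beta (i%:R * dl))) by rewrite ler_wpM2l.
have h2 : C * e <= eps.
  by rewrite /e mulrCA ler_piMr ?(ltW eps0)// ler_pdivrMr// mul1r lerDl.
move: h h1 h2; set ta := time_average _ _ _ _ _; rewrite mulrDr.
have -> : Lk * (T * (L / M + 1) * e) = C * e by rewrite /C; ring.
set I := Rintegral _ _ _; lra.
Qed.

End euler_comparison.

End solution_path.

(** * The Nadaraya-Watson estimator *)

Section kernels.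
Context (R : realType).

Lemma class_C1_is_derive (f : R -> R) : class_C 1 f ->
  forall y, is_derive y (1 : R) f ((f^`())%classic y).
Proof.
move=> [df _] y; have dfy : derivable f y 1 := df 0%N isT y.
by rewrite derive1E; exact: derivableP.
Qed.

Lemma bounded_fun_bound (f : R -> R) : bounded_fun f ->
  exists2 C : R, 0 < C & forall y, `|f y| <= C.
Proof.
move=> [N [_ hN]]; exists (Num.max N 0 + 1); first by rewrite ltr_wpDl// le_max lexx orbT.
by move=> y; apply: hN => //; rewrite ltr_pwDr// le_max lexx.
Qed.

Variable K : R -> R.
Hypotheses (cK : continuous K) (K0 : forall y, 0 <= K y)
  (K1 : (\int[lebesgue_measure]_y (K y)%:E = 1)%E).

Lemma kernel_primitive : exists Phi : R -> R,
  (forall y, is_derive y (1 : R) Phi (K y)) /\ forall y, 0 <= Phi y <= 1.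
Proof.
have mK : measurable_fun setT (EFin \o K).
  by apply/measurable_EFinP; exact: continuous_measurable_fun.
have Ki : lebesgue_measure.-integrable setT (EFin \o K).
  apply/integrableP; split => //.
  rewrite (_ : (\int[_]_(_ in _) _)%E = 1%E) ?ltry// -[RHS]K1.
  by apply: eq_integral => y _; rewrite /= ger0_norm.
have Kiu u : lebesgue_measure.-integrable [set` Interval -oo%O (BRight u)] (EFin \o K).
  by apply: integrableS Ki => //; exact: measurable_itv.
exists (fun y => \int[lebesgue_measure]_(t in [set` Interval -oo%O (BRight y)]) K t).
split=> y; last first.
  apply/andP; split; first by apply: Rintegral_ge0 => t _; exact: K0.
  have -> : 1 = \int[lebesgue_measure]_t K t by rewrite /Rintegral K1.
  rewrite /Rintegral fine_le ?integrable_fin_num//.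
  apply: ge0_subset_integral => //.
  by move=> t _; rewrite lee_fin.
have yy : y < y + 1 by rewrite ltrDl.
have [|dF <-] := @continuous_FTC1 _ K -oo%O y (y + 1) yy (Kiu _) _ (@cK y).
  by rewrite /= ltNyr.
by rewrite derive1E; exact: derivableP.
Qed.

(** A kernel of integral 1 is positive somewhere, and continuity keeps half of that value on an
    interval. *)
Lemma kernel_positive_interval : exists u1 u2 kappa : R,
  [/\ u1 < u2, 0 < kappa & forall y, u1 <= y <= u2 -> kappa <= K y].
Proof.
have [y0 Ky0] : exists y0, 0 < K y0.
  apply: contrapT => /forallNP h; have := K1.
  under eq_integral => y _.
    have -> : K y = 0 by apply/eqP; rewrite eq_le K0 andbT leNgt; apply/negP; exact: h.
    over.
  by rewrite integral0 => /eqP; rewrite eqe eq_sym oner_eq0.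
have k2 : 0 < K y0 / 2 by rewrite divr_gt0.
have /cvgrPdist_le/(_ _ k2)[r /= r0 hr] := @cK y0.
exists (y0 - r / 2), (y0 + r / 2), (K y0 / 2); split => //.
  by rewrite ltrD2l -subr_gt0 opprK -splitr.
move=> y yin; have := hr y; rewrite /ball_/=.
have yr : `|y0 - y| < r.
  by rewrite ltr_norml; move: yin r0 => /andP[]; lra.
by move=> /(_ yr); rewrite ler_norml => /andP[_]; lra.
Qed.

End kernels.

Lemma is_derive_rescaled (R : realType) (x h : R) (f f' : R -> R) y :
  (forall u, is_derive u (1 : R) f (f' u)) ->
  is_derive y (1 : R) (fun u => f ((u - x) / h)) (f' ((y - x) / h) / h).
Proof.
move=> df; have da : is_derive y (1 : R) (fun u => (u - x) / h) h^-1.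
  rewrite (_ : (fun _ => _) = (h^-1 \*: (id - cst x))); last first.
    by apply/funext => u /=; rewrite mulrC.
  by apply: is_derive_eq; rewrite subr0 /GRing.scale/= mulr1.
have := @is_derive1_comp _ f (fun u => (u - x) / h) y _ _ (df _) da.
by rewrite mulrC.
Qed.


Section nw_path.
Context (R : realType) (K : R -> R) (x h C : R).
Hypotheses (h0 : 0 < h) (dK : forall y, is_derive y (1 : R) K ((K^`())%classic y))
  (K0 : forall y, 0 <= K y) (K'C : forall y, `|(K^`())%classic y| <= C)
  (K1 : (\int[lebesgue_measure]_y (K y)%:E = 1)%E).

Let k u := K ((u - x) / h).

Lemma rescaled_kernel_lipschitz u v : `|k u - k v| <= C / h * `|u - v|.
Proof.
apply: (derive_lipschitz u v (fun y => is_derive_rescaled x h y dK)) => y.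
by rewrite normrM normfV (gtr0_norm h0) ler_pM2r ?invr_gt0.
Qed.

Lemma nw_numerator_bound X T : 0 <= T -> vanishing_quadratic_variation X T ->
  young_integrable (nw_weight K x h X) X 0 T /\ `|nw_numerator K x h T X| <= h.
Proof.
move=> T0 vX; have cK := derive_continuous dK.
have [Phi [dPhi Phi01]] := kernel_primitive cK K0 K1.
pose F u := h * Phi ((u - x) / h).
have dF u : is_derive u (1 : R) F (k u).
  have dPhiu := is_derive_rescaled x h u dPhi.
  rewrite (_ : F = h \*: (fun u => Phi ((u - x) / h)))//.
  by apply: is_derive_eq; rewrite /GRing.scale/= mulrC divfK// gt_eqF.
have [yi yE] := young_chain_rule dF rescaled_kernel_lipschitz T0 vX.
split=> //; rewrite /nw_numerator yE -mulrBr normrM (gtr0_norm h0) ler_piMr ?(ltW h0)//.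
have /andP[a1 a2] := Phi01 ((X T - x) / h); have /andP[b1 b2] := Phi01 ((X 0 - x) / h).
by rewrite ler_norml; apply/andP; split; lra.
Qed.

Lemma nw_estimator_small X T e : 0 <= T -> 0 < e -> vanishing_quadratic_variation X T ->
  h / e <= nw_denominator K x h T X ->
  nw_defined K x h T X /\ `|nw_estimator K x h T X| <= e.
Proof.
move=> T0 e0 vX hden; have [yi num] := nw_numerator_bound T0 vX.
have den0 : 0 < nw_denominator K x h T X by apply: lt_le_trans hden; rewrite divr_gt0.
split=> //; rewrite /nw_estimator normrM normfV (gtr0_norm den0) ler_pdivrMr//.
by apply: le_trans num _; rewrite mulrC -ler_pdivrMr.
Qed.

End nw_path.

(** * Small time averages have small probability, uniformly in the step *)

Section time_average_small.
Context d (Omega : measurableType d) (R : realType) (P : probability Omega R).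
Variables (H sigma : R) (B : R -> {RV P >-> R}) (b b' G G' : R -> R)
  (M L G0 G1 kappa u1 u2 : R).
Hypotheses (hH : 1 / 2 < H < 1) (hB : fractional_brownian_motion H B)
  (sigma0 : sigma != 0) (M0 : 0 < M) (L0 : 0 < L)
  (db : forall x, is_derive x (1 : R) b (b' x))
  (bM : forall x, b' x <= - M) (bL : forall x, `|b' x| <= L)
  (G_ge0 : forall x, 0 <= G x) (GG0 : forall x, G x <= G0)
  (dG : forall x, is_derive x (1 : R) G (G' x)) (GG1 : forall x, `|G' x| <= G1)
  (u12 : u1 < u2) (kappa0 : 0 < kappa)
  (Gk : forall x, u1 <= x <= u2 -> kappa <= G x).

Let gB : gaussian_process B. Proof. by case: hB. Qed.
Let EB t : 0 <= t -> ('E_P[B t] = 0)%E. Proof. by case: hB => _ h _ _; exact: h. Qed.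
Let covB s t : 0 <= s -> 0 <= t -> covariance P (B s) (B t) =
  ((s `^ (2 * H) + t `^ (2 * H) - `|t - s| `^ (2 * H)) / 2)%:E.
Proof. by case: hB => _ _ h _; exact: h. Qed.

Let bL' x : - L <= b' x. Proof. by have := bL x; rewrite ler_norml => /andP[]. Qed.

(* A window of this duration consists of m steps dl with m * (dl * L) <= 1/2, so
   that an increment entering it is damped by a factor at least 1/2. *)
Definition window_length := (2 * L)^-1.

(** The standard deviation of the noise accumulated over one window. *)
Definition window_deviation := `|sigma| * window_length `^ H.

(** The location bound of [slope_interval], taken at the Markov threshold 2 * [residual_moment]. *)
Definition window_radius := 2 * (`|u1| + 2 * residual_moment b M L `|sigma|).

Definition window_gap := (u2 - u1) / response_bound M `|sigma| window_deviation.

(** The Gaussian small-ball bound for the window sum. Neither the step nor the horizon enters it. *)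
Definition window_mass := normal_peak window_deviation *
  expR (- (window_radius + window_gap) ^+ 2 / (window_deviation ^+ 2 *+ 2)) * window_gap.

Local Notation tau := window_length.

Let tau0 : 0 < tau. Proof. by rewrite invr_gt0 mulr_gt0. Qed.
Let sig0 : 0 < `|sigma|. Proof. by rewrite normr_gt0. Qed.
Let s0 : 0 < window_deviation. Proof. by rewrite mulr_gt0// powR_gt0. Qed.

Let dev2 : window_deviation ^+ 2 = sigma ^+ 2 * tau `^ (2 * H).
Proof.
rewrite /window_deviation exprMn real_normK ?num_real//.
by rewrite -(powR_mulrn 2 (powR_ge0 _ _)) -powRrM (mulrC H).
Qed.

Let gap0 : 0 < window_gap.
Proof. by rewrite divr_gt0 ?subr_gt0// !mulr_gt0 ?invr_gt0// addr_gt0// invr_gt0. Qed.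

Lemma window_mass_gt0 : 0 < window_mass.
Proof.
apply: mulr_gt0 gap0; apply: mulr_gt0; last exact: expR_gt0.
by rewrite normal_peak_gt0// gt_eqF.
Qed.

Section fixed_step.
Variable n : nat.

Let m := n.+1.
Let dl := tau / m%:R.
Let m0 : 0 < m%:R :> R. Proof. by rewrite ltr0n. Qed.
Let dl0 : 0 < dl. Proof. exact: divr_gt0. Qed.
Let mdl : m%:R * dl = tau. Proof. by rewrite /dl mulrC divfK// gt_eqF. Qed.

Let mL : m%:R * (dl * L) <= 2^-1.
Proof. by rewrite mulrA mdl /window_length invfM mulfVK ?gt_eqF. Qed.

Let dlL : dl * L <= 1.
Proof.
have h : dl * L <= m%:R * (dl * L) by rewrite ler_peMl ?ler1n// mulr_ge0// ltW.
by apply: le_trans h (le_trans mL _); rewrite invf_le1// ler1n.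
Qed.

Local Notation Z := (noise B sigma dl).

Let gZ N : centered_gaussian P N Z. Proof. exact: (noise_centered_gaussian gB EB covB). Qed.

Let mZ i : measurable_fun setT (Z i). Proof. exact: noise_measurable. Qed.

Let mG : measurable_fun setT G.
Proof. by apply: continuous_measurable_fun; exact: (derive_continuous dG). Qed.

Lemma euler_occupation_mean N k : (m <= k <= N)%N ->
  kappa * window_mass / 2 <= \int[P]_w G (euler b dl (fun i => Z i w) k).
Proof.
move=> /andP[mk kN].
have mE : measurable_fun setT (fun w => G (euler b dl (fun i => Z i w) k)).
  by apply: measurableT_comp => //; exact: (euler_measurable _ db).
have iE : P.-integrable setT (EFin \o (fun w => G (euler b dl (fun i => Z i w) k))).
  by apply: (@integrable_bounded _ _ _ _ _ G0) => // w; rewrite ger0_norm.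
rewrite -lee_fin /Rintegral fineK ?integrable_fin_num//.
apply: (@mean_lower_bound _ _ _ P b b' dl M L M0 dl0 dlL db bM bL N m Z `|sigma|
  window_deviation (gZ N) sig0 s0 _ _ _ mL k mk kN G kappa u1 u2 window_mass) => //.
- by move=> i j _ _; exact: (noise_covariance_ge0 hH EB covB).
- by move=> k' j /andP[jk _]; exact: (noise_block_variance_le hH EB covB).
- move=> k' /andP[mk' _]; by rewrite (noise_block_variance hH EB covB)// mdl dev2.
- exact: ltW.
- exact/ltW/window_mass_gt0.
- move=> a ha; apply: (noise_block_small_ball hH gB EB covB) => //; last exact: ltW.
  by rewrite mdl dev2.
Qed.

(** The mean bound holds from time [m] on, after one full window. As [j >= 2], such times are at
    least half of all, which turns the factor 1/2 into 1/4. *)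
Lemma mean_time_average (j : nat) : (2 <= j)%N ->
  kappa * window_mass / 4 <=
  \int[P]_w time_average b dl G (j * m) (fun i => Z i w).
Proof.
move=> j2; set N := (j * m)%N.
have N0 : 0 < N%:R :> R by rewrite ltr0n muln_gt0 (leq_trans _ j2).
have mN : (m <= N)%N by rewrite leq_pmull// (leq_trans _ j2).
have iE k : P.-integrable setT (EFin \o (fun w => G (euler b dl (fun i => Z i w) k))).
  apply: (@integrable_bounded _ _ _ _ _ G0); last by move=> w; rewrite ger0_norm.
  by apply: measurableT_comp => //; exact: (euler_measurable _ db).
have -> : \int[P]_w time_average b dl G N (fun i => Z i w) =
    N%:R^-1 * \sum_(k < N) \int[P]_w G (euler b dl (fun i => Z i w) k).
  rewrite -(@Rintegral_sum _ _ _ P N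
    (fun k w => G (euler b dl (fun i => Z i w) k)) iE) -RintegralZl//.
  exact: (@integrable_fsum _ _ _ P N (fun k w => G (euler b dl (fun i => Z i w) k)) iE).
rewrite [leRHS]mulrC ler_pdivlMr// -(big_mkord xpredT
  (fun k => \int[P]_w G (euler b dl (fun i => Z i w) k))) (big_cat_nat (leq0n m) mN)/=.
apply: (@le_trans _ _ (\sum_(m <= k < N) kappa * window_mass / 2)).
  rewrite sumr_const_nat -(mulr_natr (kappa * window_mass / 2)) natrB//.
  have : m%:R * 2 <= N%:R :> R by rewrite -natrM ler_nat mulnC leq_mul2r j2 orbT.
  have : 0 <= kappa * window_mass by rewrite mulr_ge0// ltW// window_mass_gt0.
  move: (kappa * window_mass) => q q0 mq; have := ler_wpM2l q0 mq; lra.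
apply: ler_wpDl.
  by apply: sumr_ge0 => k _; apply: Rintegral_ge0 => w _; exact: G_ge0.
apply: ler_sum_nat => k /andP[mk kN].
by apply: (@euler_occupation_mean N); rewrite mk ltnW.
Qed.

Definition time_average_constant :=
  (pi / 2) ^+ 2 * (G1 / M) ^+ 2 * sigma ^+ 2 / (kappa * window_mass / 8) ^+ 2.

(** With T = j tau, the squared gradient bound (G1 / (T M))^2 times the noise variance sigma^2
    T^(2H) gives the power 2H - 2. The threshold, with its factor 1/8, is half the lower bound on
    the mean. *)
Lemma time_average_small (j : nat) : (2 <= j)%N ->
  (P [set w | (time_average b dl G (j * m) (fun i => Z i w) <=
      kappa * window_mass / 8)%R] <=
   (time_average_constant * (j%:R * tau) `^ (2 * H - 2))%:E)%E.
Proof.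
move=> j2; set N := (j * m)%N; set c := kappa * window_mass / 4.
have N0 : (0 < N)%N by rewrite muln_gt0 (leq_trans _ j2).
have c0 : 0 < c by rewrite divr_gt0// mulr_gt0// window_mass_gt0.
have posZ i k : (i < N)%N -> (k < N)%N -> 0 <= \int[P]_w (Z i w * Z k w).
  by move=> _ _; exact: (noise_covariance_ge0 hH EB covB).
have := time_average_concentration M0 dl0 dlL db bM bL' G_ge0 GG0 dG GG1 N0 (gZ N)
  posZ c0 (mean_time_average j2).
rewrite (noise_sum_variance hH EB covB)//.
have -> : c / 2 = kappa * window_mass / 8 by rewrite /c; field.
set a := kappa * window_mass / 8; have a0 : 0 < a by rewrite divr_gt0// mulr_gt0// window_mass_gt0.
have NT : N%:R * dl = j%:R * tau by rewrite natrM -mulrA mdl.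
rewrite NT; set T := j%:R * tau => h.
have T0 : 0 < T by rewrite mulr_gt0// ltr0n (leq_trans _ j2).
rewrite -(@lee_pmul2r _ (a ^+ 2)%:E)//; last by rewrite lte_fin exprn_gt0.
apply: le_trans h _; rewrite -EFinM lee_fin /time_average_constant.
rewrite powRB; last by rewrite (gt_eqF T0) implybT.
rewrite (powR_mulrn 2)// ?(ltW T0)// le_eqVlt; apply/orP; left; apply/eqP.
rewrite -/a; move: (T `^ _) => V.
by field; rewrite !gt_eqF.
Qed.

End fixed_step.
End time_average_small.

(** * Limits of probabilities *)

Section probability_limits.
Context d (Omega : measurableType d) (R : realType) (P : probability Omega R).

Lemma powR_lt0_eventually_le (a e : R) : a < 0 -> 0 < e ->
  exists V0 : R, forall V, V0 <= V -> V `^ a <= e.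
Proof.
move=> a0 e0; exists (e `^ a^-1) => V hV.
have v0 : 0 < e `^ a^-1 by exact: powR_gt0.
have V0 : 0 < V by exact: lt_le_trans hV.
rewrite -[leRHS]powRr1 ?(ltW e0)// -(@mulVf _ a) ?lt_eqF// powRrM.
move: (e `^ _) v0 hV => v v0 vV; rewrite -(opprK a) !(powRN _ (- a)).
rewrite lef_pV2 ?posrE ?powR_gt0//.
by apply: ge0_ler_powR => //; rewrite ?nnegrE ?oppr_ge0 ltW.
Qed.

(** Continuity from below along the tail intersections, each of which is contained in its first
    set. *)
Lemma probability_eventually_le (S : (set Omega)^nat) (q : \bar R) :
  (forall n, measurable (S n)) -> (forall n, (P (S n) <= q)%E) ->
  measurable (\bigcup_m \bigcap_(n >= m) S n) /\
  (P (\bigcup_m \bigcap_(n >= m) S n) <= q)%E.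
Proof.
move=> mS Sq.
have mI m : measurable (\bigcap_(n >= m) S n) by apply: bigcap_measurableType => n _; exact: mS.
have mU : measurable (\bigcup_m \bigcap_(n >= m) S n) by exact: bigcup_measurable.
split=> //.
have nd : nondecreasing_seq (fun m => \bigcap_(n >= m) S n).
  by move=> m m' mm'; apply/subsetPset => w h n /= mn; apply: h; exact: leq_trans mn.
have cv := @nondecreasing_cvg_mu _ _ _ P _ mI mU nd.
rewrite -(cvg_lim _ cv)//; apply: lime_le; first by apply/cvg_ex; exists (P (\bigcup_m \bigcap_(n >= m) S n)).
apply: nearW => m /=; apply: le_trans (Sq m); apply: le_measure; rewrite ?inE//.
by move=> w; apply => /=.
Qed.

Lemma probability_tail (Y : {RV P >-> R}) (e : R) : 0 < e ->
  exists r : R, measurable [set w | r < `|Y w|] /\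
    (P [set w | (r < `|Y w|)%R] <= e%:E)%E.
Proof.
move=> e0; pose F (n : nat) := [set w | n%:R < `|Y w|].
have mF n : measurable (F n).
  have mlt : measurable_fun setT (fun w => n%:R < `|Y w|).
    apply: measurable_fun_ltr; first exact: measurable_cst.
    by apply: measurableT_comp => //; exact: measurable_funPT.
  by rewrite -[F n]setTI; exact: (mlt measurableT [set true] I).
have FI : \bigcap_n F n = set0.
  rewrite -subset0 => w /(_ (Num.truncn `|Y w|).+1 I); rewrite /F/= ltNge.
  by rewrite (ltW (truncnS_gt _)).
have ni : nonincreasing_seq F.
  move=> m n mn; apply/subsetPset => w; rewrite /F/=; apply: le_lt_trans.
  by rewrite ler_nat.
have F0 : (P (F 0%N) < +oo)%E by rewrite (le_lt_trans (probability_le1 _ _))// ltry.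
have := @nonincreasing_cvg_mu _ _ _ P F F0 mF _ ni.
rewrite FI measure0 => /(_ measurable0) /fine_cvgP[ff /cvgrPdist_le/(_ e e0) fe].
have [n [/= h1 h2]] := filter_ex (filterI ff fe).
exists n%:R; split; first exact: mF.
rewrite -[P _]fineK// lee_fin; move: h2; rewrite sub0r normrN; apply: le_trans.
exact: ler_norm.
Qed.

End probability_limits.

Theorem proposition3p3 (R : realType) (d : measure_display)
    (Omega : measurableType d) (P : probability Omega R)
    (H sigma : R) (B : R -> {RV P >-> R}) (b K : R -> R)
    (X0 : {RV P >-> R}) (X : R -> {RV P >-> R})
    (hH : 1 / 2 < H < 1) (hsigma : sigma != 0)
    (hB : fractional_brownian_motion H B)
    (hb : Lip_b_infty b)
    (hdiss : exists M : R, 0 < M /\ forall y : R, (b^`())%classic y <= - M)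
    (hK0 : forall y : R, 0 <= K y)
    (hK1 : class_C 1 K) (hKb : bounded_fun K) (hK'b : bounded_fun (K^`())%classic)
    (hKsupp : supp K = `[-1, 1]%classic)
    (hKint : (\int[lebesgue_measure]_y (K y)%:E = 1)%E)
    (hX : sde_solution b sigma B X0 X)
    (x h : R) (hh : 0 < h) :
  cvg_in_probability P
    (fun T => [set w | nw_defined K x h T (fun t => X t w)])
    (fun T w => nw_estimator K x h T (fun t => X t w))
    0.
Proof.
have [M [M0 bM]] := hdiss.
have [_ bC1 /(_ 1%N isT) b'b] := hb 1%N isT.
have db := class_C1_is_derive bC1; have cb := derive_continuous db.
have [L L0 bL] := bounded_fun_bound b'b.
have dK := class_C1_is_derive hK1; have cK := derive_continuous dK.
have [C C0 K'C] := bounded_fun_bound hK'b.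
have [K00 K000 KC] := bounded_fun_bound hKb.
have [v1 [v2 [kappa [v12 kappa0 Kk]]]] := kernel_positive_interval cK hK0 hKint.
pose G u := K ((u - x) / h).
have dG u := is_derive_rescaled x h u dK.
have cG : continuous G := derive_continuous dG.
have G_ge0 u : 0 <= G u by exact: hK0.
have GG0 u : G u <= K00 by apply: le_trans (KC ((u - x) / h)); exact: ler_norm.
have GG1 u : `|(K^`())%classic ((u - x) / h) / h| <= C / h.
  by rewrite normrM normfV (gtr0_norm hh) ler_pM2r ?invr_gt0.
have GL := rescaled_kernel_lipschitz x hh dK K'C.
have u12 : x + h * v1 < x + h * v2 by rewrite ltrD2l ltr_pM2l.
have Gk u : x + h * v1 <= u <= x + h * v2 -> kappa <= G u.
  move=> /andP[a1 a2]; apply: Kk.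
  by rewrite ler_pdivlMr// ler_pdivrMr// !(mulrC _ h) lerBrDl a1 lerBlDl a2.
have small := time_average_small hH hB hsigma M0 L0 db bM bL G_ge0 GG0 dG GG1 u12 kappa0 Gk.
set tau := window_length L in small; set mass := window_mass _ _ _ _ _ _ _ in small.
set Ct := time_average_constant _ _ _ _ _ _ _ _ _ in small.
have tau0 : 0 < tau by rewrite invr_gt0 mulr_gt0.
have mass0 : 0 < mass by exact: window_mass_gt0.
set c := kappa * mass / 8 in small.
have c0 : 0 < c by rewrite divr_gt0// mulr_gt0.
pose S j n := [set w | time_average b (tau / n.+1%:R) G (j * n.+1)
  (fun i => noise B sigma (tau / n.+1%:R) i w) <= c].
have mS j n : measurable (S j n).
  have mt : measurable_fun setT (fun w => time_average b (tau / n.+1%:R) G (j * n.+1)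
      (fun i => noise B sigma (tau / n.+1%:R) i w)).
    by apply: (time_average_measurable _ db _ dG) => i; exact: noise_measurable.
  have mle := measurable_fun_ler mt (@measurable_cst _ _ _ _ setT c).
  by rewrite -[S j n]setTI; exact: (mle measurableT [set true] I).
(* On [E j] the average is small for all fine enough steps. Off [E j] it exceeds [c] for infinitely
   many of them, as [occupation_frequently_lower_bound] asks. *)
pose E j := \bigcup_m \bigcap_(n >= m) S j n.
have PE j : (2 <= j)%N ->
    measurable (E j) /\ (P (E j) <= (Ct * (j%:R * tau) `^ (2 * H - 2))%:E)%E.
  by move=> j2; apply: probability_eventually_le => // n; exact: small.
have Ct0 : 0 <= Ct.
  by apply: divr_ge0 (sqr_ge0 _); apply: mulr_ge0 (sqr_ge0 _); apply: mulr_ge0; exact: sqr_ge0.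
move=> e e0.
(* The pathwise part: off the exceptional events the denominator is at least h / e, while the
   numerator is at most h in modulus. *)
have good_path w T r j : 0 <= T -> j%:R * tau <= T ->
    {within `[0, +oo[, continuous (fun t : R => X t w)} ->
    (forall t : R, 0 <= t -> X t w = X0 w +
      (\int[lebesgue_measure]_(s in `[0, t]) b (X s w)) + sigma * B t w) ->
    vanishing_quadratic_variation (fun t : R => B (Num.max t 0) w) T ->
    `|X 0 w| <= r -> ~ E j w -> h / e <= j%:R * tau * c - C / h * (r / M) ->
    nw_defined K x h T (fun t => X t w) /\
    `|nw_estimator K x h T (fun t => X t w)| <= e.
  move=> T0 jT cX eqX vB Xr nE hc.
  have vX := @path_vanishing_quadratic_variation _ b (fun t => X t w) (fun t => B t w)
    (X0 w) sigma cb cX eqX T T0 vB.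
  apply: (nw_estimator_small hh dK hK0 K'C hKint T0 e0 vX).
  apply: le_trans hc _.
  have occ := @occupation_frequently_lower_bound _ b (fun t => X t w) (fun t => B t w)
    (X0 w) sigma cb cX eqX _ M L M0 L0 db bM bL G (C / h) cG G_ge0 GL tau c j tau0.
  apply: le_trans (occupation_monotone cX cG G_ge0 jT).
  apply: le_trans (occ _).
    rewrite lerB// ler_wpM2l ?divr_ge0 ?(ltW hh) ?(ltW C0)//.
    by rewrite ler_pM2r ?invr_gt0.
  move=> n0; apply: contrapT => hn; apply: nE; exists n0 => // n /= n0n.
  rewrite /S/= leNgt; apply/negP => hlt; apply: hn; exists n => //; exact: ltW.
pose bad T := ~` ([set w | nw_defined K x h T (fun t => X t w)] `&`
  [set w | `|nw_estimator K x h T (fun t => X t w) - 0| <= e]).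
suff near_small eps : 0 < eps -> \forall T \near +oo, (mu_ext P (bad T) <= eps%:E)%E.
  apply/fine_cvgP; split.
    near=> T; rewrite ge0_fin_numE ?mu_ext_ge0//.
    apply: (@le_lt_trans _ _ 1%:E); last exact: ltry.
    by near: T; exact: near_small.
  apply/cvgrPdist_le => eps eps0; near=> T.
  have hT : (mu_ext P (bad T) <= eps%:E)%E by near: T; exact: near_small.
  have T0 : (0 <= mu_ext P (bad T))%E by exact: mu_ext_ge0.
  rewrite sub0r normrN /= ger0_norm ?fine_ge0//.
  rewrite -lee_fin fineK// ge0_fin_numE//; apply: le_lt_trans hT _; exact: ltry.
move=> eps0; have eps2 : 0 < eps / 2 by rewrite divr_gt0.
have [r [mr Pr]] := probability_tail (X 0) eps2.
(* Chosen so that the bound on the probability of [E j] is at most eps / 2; the denominator is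
   [Ct + 1] because [Ct] is only known to be nonnegative. *)
have [V0 hV0] : exists V0 : R, forall V, V0 <= V -> V `^ (2 * H - 2) <= eps / 2 / (Ct + 1).
  apply: powR_lt0_eventually_le; first by case/andP: hH; lra.
  by rewrite divr_gt0// ltr_wpDl.
near=> T.
(* [T] will be rounded down to the multiple [j * tau]; the summand [tau] in the next bounds pays for
   this rounding, and the present one ensures [j >= 2]. *)
have T2 : 2 * tau <= T by near: T; apply: nbhs_pinfty_ge; rewrite num_real.
have T0 : 0 <= T by apply: le_trans T2; rewrite mulr_ge0// ltW.
have TV : V0 + tau <= T by near: T; apply: nbhs_pinfty_ge; rewrite num_real.
have Tc : (h / e + C / h * (r / M)) / c + tau <= T.
  by near: T; apply: nbhs_pinfty_ge; rewrite num_real.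
pose j := Num.truncn (T / tau).
have /andP[jT Tj] : j%:R * tau <= T < j.+1%:R * tau.
  by rewrite -ler_pdivlMr// -ltr_pdivrMr// truncn_itv// divr_ge0// ltW.
have j2 : (2 <= j)%N by rewrite truncn_ge_nat ?ler_pdivlMr// divr_ge0// ltW.
have {}Tj : T < j%:R * tau + tau by move: Tj; rewrite -natr1 mulrDl mul1r.
have [mE PEj] := PE j j2.
have PE2 : (P (E j) <= (eps / 2)%:E)%E.
  apply: le_trans PEj _; rewrite lee_fin.
  have hv : (j%:R * tau) `^ (2 * H - 2) <= eps / 2 / (Ct + 1) by apply: hV0; lra.
  apply: le_trans (ler_wpM2l Ct0 hv) _.
  by rewrite mulrCA ler_piMr ?(ltW eps2)// ler_pdivrMr ?ltr_wpDl// mul1r lerDl.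
have hc : h / e <= j%:R * tau * c - C / h * (r / M).
  rewrite lerBrDr -ler_pdivrMr//; lra.
have : {ae P, forall w, nw_defined K x h T (fun t => X t w) /\
    `|nw_estimator K x h T (fun t => X t w) - 0| <= e \/ r < `|X 0 w| \/ E j w}.
  move: hX (fbm_vanishing_quadratic_variation hH hB T0); apply: filterS2 => w [cX eqX] vB.
  have [Xr|Xr] := ltP r `|X 0 w|; first by right; left.
  have [Ej|Ej] := pselect (E j w); first by right; right.
  by left; rewrite subr0; exact: (good_path w T r j).
move=> [A [mA PA sub]].
(* The failure set may fail to be measurable; its outer measure is bounded through a measurable
   cover made of a null set, the tail event of [X 0] and [E j]. *)
have sub2 : bad T `<=` A `|` ([set w | r < `|X 0 w|] `|` E j).
  move=> w hw; have [[gw|rE]|nw] := pselect (nw_defined K x h T (fun t => X t w) /\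
    `|nw_estimator K x h T (fun t => X t w) - 0| <= e \/ r < `|X 0 w| \/ E j w).
  - by exfalso; apply: hw.
  - by right.
  - by left; apply: sub.
have mU := measurableU _ _ mr mE.
apply: le_trans (le_mu_ext P sub2) _.
rewrite (measurable_mu_extE P (measurableU _ _ mA mU)).
apply: (@le_trans _ _ (P A + (P [set w | (r < `|X 0 w|)%R] + P (E j)))%E).
  apply: (le_trans (@measureU2 _ _ _ P _ _ mA mU)); apply: leeD => //.
  exact: measureU2.
by rewrite (PA : P A = 0%E) add0e (splitr eps) EFinD leeD.
Unshelve. all: by end_near. Qed.
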